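(* Let $f\in C(\mathbb R_+\times D,Y)$, $D_B\supseteq D_A=D$, $\dim\ker A=n<\infty$, and let $\lambda A+B$ be a regular pencil of index $\nu$. Put $W=Y_1\dot{+}Y_{2\Sigma}$. Assume: 1. For each $t\in\mathbb R_+$, $x_1+x_{2\Sigma}\in D_1\dot{+}D_{2\Sigma}$ there exists a unique $x_{20}\in D_{20}$ such that $(t,x_1+x_{2\Sigma}+x_{20})\in L_0$. 2. One of the following two conditions holds. (2A) $f(t,x)$ satisfies locally a Lipschitz condition with respect to $x$ on $\mathbb R_+\times D$; and for any fixed $(t',x')\in L_0$, $x'=x_1'+x_{2\Sigma}'+x_{20}'$, there exist open neighborhoods $U_\delta(t',x_1',x_{2\Sigma}')=U_{\delta_1}(t')\times U_{\delta_2}(x_1')\times U_{\delta_3}(x_{2\Sigma}')\subset\mathbb R_+\times D_1\times D_{2\Sigma}$ and $U_\varepsilon(x_{20}')\subset D_{20}$ and an operator $W_{t',x'}\in\mathrm L(D_{20},Y_{2*})$ having an inverse $W_{t',x'}^{-1}\in\mathrm L(Y_{2*},D_{20})$ such that for each $(t,x_1,x_{2\Sigma})\in U_\delta(t',x_1',x_{2\Sigma}')$ and each $x_{20}^1,x_{20}^2\in U_\varepsilon(x_{20}')$ $$\|F_{2*}(t,x_1,x_{2\Sigma},x_{20}^1)-F_{2*}(t,x_1,x_{2\Sigma},x_{20}^2)-W_{t',x'}[x_{20}^1-x_{20}^2]\|\le q(\delta,\varepsilon)\|x_{20}^1-x_{20}^2\|,$$ where $q(\delta,\varepsilon)$ is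 such that $\lim_{\delta,\varepsilon\to0}q(\delta,\varepsilon)<\|W_{t',x'}^{-1}\|^{-1}$ (the numbers $\delta,\varepsilon>0$ depend on the choice of $t',x'$). (2B) $f(t,x)$ has a continuous (strong) partial derivative with respect to $x$ on $\mathbb R_+\times D$; and for any fixed $(t',x')\in L_0$ the operator $W_{t',x'}:=[\partial_x(Q_{2*}f)(t',x')-Q_{2*}B]P_{20}|_{D_{20}}:D_{20}\to Y_{2*}$ has an inverse $W_{t',x'}^{-1}\in\mathrm L(Y_{2*},D_{20})$. 3. For every fixed $a_1,a_2>0$ there is a constant $K=K(a_1,a_2)>0$ such that $$\sup_{(t,x)\in L_0,\ t\in[0,a_1],\ \|x_1+x_{2\Sigma}\|\le a_2}\|x_{20}-W_{t,x}^{-1}F_{2*}(t,x_1,x_{2\Sigma},x_{20})\|\le K,$$ $$\sup_{(t,x)\in L_0,\ t\in[0,a_1],\ \|x_1+x_{2\Sigma}\|\le a_2,\ \|x_{20}\|\le K}\|(Q_1+Q_{2\Sigma})f(t,x)\|<\infty\qquad(x=x_1+x_{2\Sigma}+x_{20}).$$ 4. There exist a number $R>0$, a functional $V(w)=\max_{i=1,\dots,m}V_i(w)$, where $w=\widetilde A(x_1+x_{2\Sigma})\in W$ and $V_i\in C(W,\mathbb R_+)$, $i=1,\dots,m$, are continuously differentiable functionals on $U_R^c(0)=\{w\in W:\|w\|\ge R\}$, and functionals $U\in C(\mathbb R_+,\mathbb R_+)$, $\psi:\mathbb R_+\to\mathbb R_+$ such that $\psi$ is integrable on each finite interval in $\mathbb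 R_+$, $$\int^\infty\frac{du}{U(u)}=\infty,\qquad\lim_{\|w\|\to\infty}V(w)=\infty,$$ and for each $(t,\widetilde A^{-1}w+x_{20})\in L_0$ for which $w\in U_R^c(0)$ one has $$\big\langle\widetilde A\,\Pi(t,\widetilde A^{-1}w+x_{20}),\partial_wV_{j(w)}(w)\big\rangle\le U(V(w))\psi(t),$$ where $j(w)\in\{1,\dots,m\}$ is any index for which $V(w)=V_{j(w)}(w)$ for the given $w$. Then for each initial point $(t_0,x_0)\in L_0$ there exists a unique global solution $x(t)$ (i.e. on the maximal interval $[t_0,t_{max})$ with $t_{max}=\infty$) of the initial value problem $\frac{d}{dt}[Ax]+Bx=f(t,x)$, $x(t_0)=x_0$.
   Context: Notation: $\mathbb R_+=[0,\infty)$; $\mathrm L(E,F)$ is the space of bounded linear operators; $\dot{+}$ is direct sum. $\int^\infty h(u)\,du=\infty$ (resp. $<\infty$) means that $\int_{u_0}^\infty h(u)\,du$ diverges (resp. converges) for any $u_0>0$. $\partial_wV(w)$ is the gradient (derivative) of the functional $V$ and $\langle y,\partial_wV(w)\rangle$ its value on $y$. Setting: $X,Y$ are Banach spaces; $A:D_A\to Y$, $B:D_B\to Y$ are closed linear operators with domains dense in $X$; $\operatorname{range}(A)$ is closed; $D=D_A\cap D_B\neq\{0\}$. The abstract differential-algebraic equation (ADAE) is $\frac{d}{dt}[Ax]+Bx=f(t,x)$, $t>0$. A solution on an interval $J\subseteq\mathbb R_+$ is $x\in C(J,X)$ with $Ax\in C^1(J,Y)$ (if $J=\mathbb R_+$: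 $Ax\in C^1((0,\infty),Y)$), $x(t)\in D$, satisfying the equation for every $t\in J$. It is global if it exists on $[t_0,\infty)$. An interval $J$ is the maximal interval of existence of $x(t)$ if $x$ cannot be extended (to the right) to a strictly larger interval so that it remains a solution. Regular pencil of index $\nu\in\mathbb N$: there is $R>0$ such that for every complex $\lambda$ with $|\lambda|>R$ the operator $\lambda A+B:D\to Y$ has an inverse in $\mathrm L(Y,X)$, and $(A+\mu B)^{-1}$ has a pole of order $\nu$ at $\mu=0$ (equivalently, $(\lambda A+B)^{-1}$ has at $\lambda=\infty$ a pole of order $\nu-1$, or a removable singularity if $\nu=1$). For real spaces this is understood via complexification. Projectors: let $\{\varphi_i^1\}_{i=1}^n$ be a basis of $\ker A\cap D$, and $\{\varphi_i^j\}_{i=1,\dots,n}^{j=1,\dots,m_i}\subset D$ a canonical system of root vectors of $A+\mu B$ at $\mu=0$: $A\varphi_i^1=0$, $A\varphi_i^j=-B\varphi_i^{j-1}$ ($j=2,\dots,m_i$), $1\le m_i\le\nu$, $\max_i m_i=\nu$; let $q_i^j\in D_{A^*}\cap D_{B^*}$ be functionals with $A^*q_i^{m_i}=0$, $A^*q_i^j=-B^*q_i^{j+1}$ ($j=1,\dots,m_i-1$), $\langle B\varphi_i^j,q_k^l\rangle=\delta_{ik}\delta_{jl}$. Such systems exist and are fixed. Define $P_2=\sum_{i}\sum_{j=1}^{m_i}\langle\cdot,B^*q_i^j\rangle\varphi_i^j$, $P_1=I-P_2$, $Q_2=\sum_i\sum_{j=1}^{m_i}\langle\cdot,q_i^j\rangle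 B\varphi_i^j$, $Q_1=I-Q_2$, $P_{20}=\sum_i\langle\cdot,B^*q_i^1\rangle\varphi_i^1$, $P_{2\Sigma}=\sum_{i:m_i\ne1}\sum_{j=2}^{m_i}\langle\cdot,B^*q_i^j\rangle\varphi_i^j$, $Q_{2*}=\sum_i\langle\cdot,q_i^{m_i}\rangle B\varphi_i^{m_i}$, $Q_{2\Sigma}=\sum_{i:m_i\ne1}\sum_{j=1}^{m_i-1}\langle\cdot,q_i^j\rangle B\varphi_i^j$. These are bounded projectors on $X$ and $Y$ respectively, with $P_2=P_{20}+P_{2\Sigma}$, $Q_2=Q_{2*}+Q_{2\Sigma}$. Put $D_1=P_1D$, $D_{20}=P_{20}D$, $D_{2\Sigma}=P_{2\Sigma}D$, $Y_1=Q_1Y$, $Y_{2*}=Q_{2*}Y$, $Y_{2\Sigma}=Q_{2\Sigma}Y$, so $D=D_1\dot{+}D_{2\Sigma}\dot{+}D_{20}$, $Y=Y_1\dot{+}Y_{2\Sigma}\dot{+}Y_{2*}$. Write $x=x_1+x_{2\Sigma}+x_{20}$ with $x_1=P_1x$, $x_{2\Sigma}=P_{2\Sigma}x$, $x_{20}=P_{20}x$; the norm used is $\|x\|=\|x_1\|+\|x_{2\Sigma}\|+\|x_{20}\|$. $\widetilde A=A+\sum_{i=1}^n\langle\cdot,B^*q_i^1\rangle B\varphi_i^{m_i}:D\to Y$ has an inverse $\widetilde A^{-1}\in\mathrm L(Y,X)$; $\widetilde A$ coincides with $A$ on $D_1\dot{+}D_{2\Sigma}$ and maps it onto $Y_1\dot{+}Y_{2\Sigma}$.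 $\Pi(t,x)=\widetilde A^{-1}(Q_1+Q_{2\Sigma})[f(t,x)-Bx]$; $F_{2*}(t,x_1,x_{2\Sigma},x_{20})=Q_{2*}f(t,x_1+x_{2\Sigma}+x_{20})-Q_{2*}B(x_{2\Sigma}+x_{20})$; $L_0=\{(t,x)\in\mathbb R_+\times D: Q_{2*}[f(t,x)-Bx]=0\}$. $f$ satisfies locally a Lipschitz condition with respect to $x$ on $J\times M$ if for each $(t',x')\in J\times M$ there are open neighborhoods $U(t'),\widetilde U(x')$ and $L\ge0$ with $\|f(t,x_1)-f(t,x_2)\|\le L\|x_1-x_2\|$ for $t\in U(t')$, $x_1,x_2\in\widetilde U(x')$. Neighborhoods of an endpoint of a time interval are semi-open intervals. *)

(* Defs.v *)
From HB Require Import structures.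
From mathcomp Require Import all_boot all_order all_algebra.
From mathcomp Require Export complex.
From mathcomp Require Import all_classical all_reals all_analysis.

Set Implicit Arguments.
Unset Strict Implicit.
Unset Printing Implicit Defensive.

Import Order.TTheory GRing.Theory Num.Theory.
Import numFieldNormedType.Exports.

Local Open Scope classical_set_scope.
Local Open Scope ring_scope.

(* The field of scalars of the Banach spaces: R[i] if [c] is true, R otherwise. *)
Definition scal (R : realType) (c : bool) : numFieldType :=
  if c then (R[i] : numFieldType) else (R : numFieldType).

Definition ofR (R : realType) (c : bool) : R -> scal R c :=
  match c return R -> scal R c with
  | true => fun r => r%:C%C
  | false => fun r => r
  end.

Definition toR (R : realType) (c : bool) : scal R c -> R :=
  match c return scal R c -> R with
  | true => fun z => complex.Re z
  | false => fun r => r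
  end.

Section BoundedOperators.
Context {R : realType} {c : bool}.
Local Notation K := (scal R c).

(* In the library the norm of a [normedModType K] has values in [K]. *)
Definition nrm (E : normedModType K) (v : E) : R := toR `|v|.

Definition subspace (E : lmodType K) (S : set E) : Prop :=
  S 0 /\ forall (a : K) u v, S u -> S v -> S (a *: u + v).

Definition linear_on (E F : lmodType K) (S : set E) (T : E -> F) : Prop :=
  forall (a : K) u v, S u -> S v -> T (a *: u + v) = a *: T u + T v.

(* T in L(S, S') for linear subspaces S, S'; T is irrelevant off S. *)
Definition boundedL (E F : normedModType K) (S : set E) (S' : set F)
    (T : E -> F) : Prop :=
  [/\ forall x, S x -> S' (T x),
      linear_on S T
    & exists M : R, forall x, S x -> nrm (T x) <= M * nrm x].

Definition inverse_on (E F : Type) (S : set E) (S' : set F)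
    (T : E -> F) (G : F -> E) : Prop :=
  [/\ forall x, S x -> S' (T x),
      forall y, S' y -> S (G y),
      forall x, S x -> G (T x) = x
    & forall y, S' y -> T (G y) = y].

Definition opnorm (E F : normedModType K) (S : set E) (T : E -> F) : R :=
  sup [set nrm (T x) | x in [set x | S x /\ nrm x <= 1]].

Definition is_basis (E : lmodType K) (S : set E) (n : nat)
    (e : 'I_n -> E) : Prop :=
  (forall i, S (e i)) /\
  forall x, S x -> exists! a : {ffun 'I_n -> K}, x = \sum_(i < n) a i *: e i.

(* g : E -> F, defined on the subspace S, has the Frechet derivative T : S -> F
   at x, S being normed by the norm of E. *)
Definition is_frechet (E F : normedModType K) (S : set E) (g : E -> F)
    (x : E) (T : E -> F) : Prop :=
  boundedL S setT T /\
  forall e : R, 0 < e -> exists2 d : R, 0 < d &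
    forall h, S h -> nrm h < d -> nrm (g (x + h) - g x - T h) <= e * nrm h.

(* The same for a real functional: its derivative is only R-linear. *)
Definition is_gradient (E : normedModType K) (S : set E) (g : E -> R)
    (x : E) (T : E -> R) : Prop :=
  [/\ forall (a : R) u v, S u -> S v -> T (ofR c a *: u + v) = a * T u + T v,
      exists M : R, forall h, S h -> `|T h| <= M * nrm h
    & forall e : R, 0 < e -> exists2 d : R, 0 < d &
        forall h, S h -> nrm h < d -> `|g (x + h) - g x - T h| <= e * nrm h].

End BoundedOperators.

Record linop (R : realType) (c : bool) (X Y : normedModType (scal R c)) := LinOp {
  dom : set X;
  fn :> X -> Y;
  dom_subspace : subspace dom;
  fn_linear : linear_on dom fn
}.

Definition closed_op (R : realType) (c : bool) (X Y : normedModType (scal R c))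
    (A : linop X Y) : Prop :=
  closed [set p : X * Y | dom A p.1 /\ p.2 = A p.1].

Section Complexification.
Context {R : realType}.

Definition cplx (X : lmodType R) : Type := (X * X)%type.

HB.instance Definition _ (X : lmodType R) :=
  GRing.Zmodule.copy (cplx X) (X * X)%type.

Variable X : lmodType R.

(* (x, y) stands for x + i y. *)
Definition cplx_scale (z : R[i]) (v : cplx X) : cplx X :=
  (complex.Re z *: v.1 - complex.Im z *: v.2,
   complex.Re z *: v.2 + complex.Im z *: v.1).

Fact cplx_scaleA a b v :
  cplx_scale a (cplx_scale b v) = cplx_scale (a * b) v.
Proof.
case: a b v => [a1 a2] [b1 b2] [x y]; rewrite /cplx_scale /=; congr pair.
- rewrite scalerBr scalerDr !scalerA scalerBl scalerDl !opprD.
  by rewrite [in LHS](addrC (- _) (- _)) addrACA.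
- rewrite scalerBr scalerDr !scalerA scalerBl scalerDl.
  by rewrite (addrC (_ *: x) (- _)) addrACA.
Qed.

Fact cplx_scale1 : left_id 1 cplx_scale.
Proof.
by case=> x y; rewrite /cplx_scale /= !scale1r !scale0r subr0 addr0.
Qed.

Fact cplx_scaleDr : right_distributive cplx_scale +%R.
Proof.
case=> a b [x y] [x' y']; rewrite /cplx_scale /=; congr pair => /=.
- by rewrite !scalerDr opprD addrACA.
- by rewrite !scalerDr addrACA.
Qed.

Fact cplx_scaleDl v : {morph cplx_scale^~ v : a b / a + b}.
Proof.
case: v => x y [a b] [a' b']; rewrite /cplx_scale /=; congr pair => /=.
- by rewrite !scalerDl opprD addrACA.
- by rewrite !scalerDl addrACA.
Qed.

HB.instance Definition _ := GRing.Zmodule_isLmodule.Build R[i] (cplx X)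
  cplx_scaleA cplx_scale1 cplx_scaleDr cplx_scaleDl.

End Complexification.

Section RegularPencil.
Context {R : realType}.

Section ComplexSpaces.
Variables (E F : lmodType R[i]) (nE : E -> R) (nF : F -> R).

Definition cbounded (G : F -> E) : Prop :=
  (forall (a : R[i]) u v, G (a *: u + v) = a *: G u + G v) /\
  exists M : R, forall y, nE (G y) <= M * nF y.

(* T : D -> F has the inverse G in L(F, E). *)
Definition cinverse (D : set E) (T : E -> F) (G : F -> E) : Prop :=
  cbounded G /\ inverse_on D setT T G.

(* (A + mu B)^-1 has a pole of order nu at mu = 0: in a punctured neighbourhood
   of 0 it is the sum of the Laurent series
     \sum_(k >= 0) mu^(k - nu) C_k,   C_k in L(F, E),   C_0 <> 0,
   which converges in the operator norm. *)
Definition pencil_pole (D : set E) (A B : E -> F) (nu : nat) : Prop :=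
  exists (C : nat -> F -> E) (r : R),
    [/\ forall k, cbounded (C k),
        exists y, C 0%N y != 0,
        0 < r
      & forall mu : R[i], 0 < `|mu| < r%:C%C ->
          exists2 G, cinverse D (fun x => A x + mu *: B x) G &
          forall e : R, 0 < e -> exists N : nat, forall n, (N <= n)%N ->
          forall y,
            nE (G y - \sum_(k < n) (mu ^+ k / mu ^+ nu) *: C k y) <= e * nF y].

Definition cregular (D : set E) (A B : E -> F) (nu : nat) : Prop :=
  [/\ (0 < nu)%N,
      exists r : R, 0 < r /\ forall la : R[i], r%:C%C < `|la| ->
        exists G, cinverse D (fun x => la *: A x + B x) G
    & pencil_pole D A B nu].

End ComplexSpaces.

(* For real spaces the pencil is complexified; the norm of X (+) iX used here
   is equivalent to every norm of a complexification of X, and only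
   boundedness and norm convergence are involved. *)
Definition regular_pencil (c : bool) :
    forall (X Y : normedModType (scal R c)), linop X Y -> linop X Y -> nat -> Prop :=
  match c return forall (X Y : normedModType (scal R c)),
      linop X Y -> linop X Y -> nat -> Prop with
  | true => fun X Y A B nu =>
      @cregular X Y (@nrm R true X) (@nrm R true Y) (dom A `&` dom B) A B nu
  | false => fun X Y A B nu =>
      @cregular (@cplx R X) (@cplx R Y)
        (fun v => @nrm R false X v.1 + @nrm R false X v.2)
        (fun v => @nrm R false Y v.1 + @nrm R false Y v.2)
        [set v | (dom A `&` dom B) v.1 /\ (dom A `&` dom B) v.2]
        (fun v => (A v.1, A v.2)) (fun v => (B v.1, B v.2)) nu
  end.

End RegularPencil.

Section Adjoint.
Context {R : realType} {c : bool} {X Y : normedModType (scal R c)}.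
Local Notation K := (scal R c).

Definition functional (E : normedModType K) (q : E -> K) : Prop :=
  boundedL setT setT (q : E -> K^o).

Definition adjoint_rel (A : linop X Y) (q : Y -> K) (p : X -> K) : Prop :=
  functional p /\ forall x, dom A x -> q (A x) = p x.

Definition adjoint_dom (A : linop X Y) (q : Y -> K) : Prop :=
  functional q /\ exists p, adjoint_rel A q p.

(* A^* q, for q in adjoint_dom A; unique when dom A is dense. *)
Definition adjoint (A : linop X Y) (q : Y -> K) : X -> K :=
  xget (fun=> 0) [set p | adjoint_rel A q p].

End Adjoint.

(* The root vectors phi i j and functionals qf i j are indexed by i : 'I_n and
   1 <= j <= mult i. *)
Record root_system (R : realType) (c : bool) (X Y : normedModType (scal R c))
    (A B : linop X Y) (n nu : nat) := RootSystem {
  mult : 'I_n -> nat;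
  phi : 'I_n -> nat -> X;
  qf : 'I_n -> nat -> Y -> scal R c;
  mult_bounds : forall i, (1 <= mult i <= nu)%N;
  mult_max : \max_(i < n) mult i = nu;
  phi_basis :
    is_basis [set x | (dom A `&` dom B) x /\ A x = 0] (fun i => phi i 1);
  phi_dom : forall i j, (1 <= j <= mult i)%N -> (dom A `&` dom B) (phi i j);
  phi_chain : forall i j, (2 <= j <= mult i)%N ->
    A (phi i j) = - B (phi i j.-1);
  qf_dom : forall i j, (1 <= j <= mult i)%N ->
    adjoint_dom A (qf i j) /\ adjoint_dom B (qf i j);
  qf_end : forall i x, adjoint A (qf i (mult i)) x = 0;
  qf_chain : forall i j, (1 <= j < mult i)%N ->
    forall x, adjoint A (qf i j) x = - adjoint B (qf i j.+1) x;
  qf_biorth : forall i j k l, (1 <= j <= mult i)%N -> (1 <= l <= mult k)%N ->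
    qf k l (B (phi i j)) = ((i == k) && (j == l))%:R
}.

Section Decomposition.
Context {R : realType} {c : bool} {X Y : normedModType (scal R c)}.
Context {A B : linop X Y} {n nu : nat} (rs : root_system A B n nu).
Local Notation phi := (phi rs).
Local Notation qf := (qf rs).
Local Notation mult := (mult rs).

Definition Dset : set X := dom A `&` dom B.

Definition P20 (x : X) : X :=
  \sum_(i < n) adjoint B (qf i 1) x *: phi i 1.
Definition P2S (x : X) : X :=
  \sum_(i < n | mult i != 1%N) \sum_(2 <= j < (mult i).+1)
    adjoint B (qf i j) x *: phi i j.
Definition P2 (x : X) : X :=
  \sum_(i < n) \sum_(1 <= j < (mult i).+1) adjoint B (qf i j) x *: phi i j.
Definition P1 (x : X) : X := x - P2 x.

Definition Q2s (y : Y) : Y :=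
  \sum_(i < n) qf i (mult i) y *: B (phi i (mult i)).
Definition Q2S (y : Y) : Y :=
  \sum_(i < n | mult i != 1%N) \sum_(1 <= j < mult i)
    qf i j y *: B (phi i j).
Definition Q2 (y : Y) : Y :=
  \sum_(i < n) \sum_(1 <= j < (mult i).+1) qf i j y *: B (phi i j).
Definition Q1 (y : Y) : Y := y - Q2 y.

Definition D1 : set X := P1 @` Dset.
Definition D2S : set X := P2S @` Dset.
Definition D20 : set X := P20 @` Dset.
Definition Y2s : set Y := range Q2s.
Definition Wsp : set Y := [set y1 + y2 | y1 in range Q1 & y2 in range Q2S].

Definition normD (x : X) : R := nrm (P1 x) + nrm (P2S x) + nrm (P20 x).

Definition Atilde (x : X) : Y :=
  A x + \sum_(i < n) adjoint B (qf i 1) x *: B (phi i (mult i)).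
Definition Atilde_inv (y : Y) : X := xget 0 [set x | Dset x /\ Atilde x = y].

Section RightHandSide.
Variable f : R -> X -> Y.

Definition L0 (t : R) (x : X) : Prop :=
  [/\ 0 <= t, Dset x & Q2s (f t x - B x) = 0].

Definition Pi_ (t : R) (x : X) : X :=
  Atilde_inv (Q1 (f t x - B x) + Q2S (f t x - B x)).

Definition F2s (t : R) (x1 x2S x20 : X) : Y :=
  Q2s (f t (x1 + x2S + x20)) - Q2s (B (x2S + x20)).

Definition locally_lipschitz : Prop :=
  forall t' x', 0 <= t' -> Dset x' ->
  exists d L : R, [/\ 0 < d, 0 <= L & forall t u v, 0 <= t -> `|t - t'| < d ->
    Dset u -> Dset v -> nrm (u - x') < d -> nrm (v - x') < d ->
    nrm (f t u - f t v) <= L * nrm (u - v)].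

Definition continuous_partial : Prop :=
  exists df : R -> X -> X -> Y,
    (forall t x, 0 <= t -> Dset x -> is_frechet Dset (f t) x (df t x)) /\
    (forall t' x', 0 <= t' -> Dset x' -> forall e : R, 0 < e ->
     exists2 d : R, 0 < d & forall t x, 0 <= t -> Dset x ->
       `|t - t'| < d -> nrm (x - x') < d ->
       forall h, Dset h -> nrm (df t x h - df t' x' h) <= e * nrm h).

Definition invertible_family (W : R -> X -> X -> Y) (Winv : R -> X -> Y -> X) :
    Prop :=
  forall t' x', L0 t' x' ->
    inverse_on D20 Y2s (W t' x') (Winv t' x') /\
    boundedL Y2s D20 (Winv t' x').

(* delta = (delta_1, delta_2, delta_3) and epsilon tend to 0 from the right. *)
Definition radii_to0 : set_system ((R * R * R) * R) :=
  filter_prod (filter_prod (filter_prod (0 : R)^'+ (0 : R)^'+) (0 : R)^'+)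
    (0 : R)^'+.

Definition condition_2A (W : R -> X -> X -> Y) (Winv : R -> X -> Y -> X) :
    Prop :=
  [/\ locally_lipschitz,
      invertible_family W Winv
    & forall t' x', L0 t' x' ->
      boundedL D20 Y2s (W t' x') /\
      exists (q : R * R * R -> R -> R) (l : R),
      [/\ \forall p \near radii_to0,
            forall t x1 x2S y z,
              0 <= t -> D1 x1 -> D2S x2S -> D20 y -> D20 z ->
              `|t - t'| < p.1.1.1 -> nrm (x1 - P1 x') < p.1.1.2 ->
              nrm (x2S - P2S x') < p.1.2 ->
              nrm (y - P20 x') < p.2 -> nrm (z - P20 x') < p.2 ->
              nrm (F2s t x1 x2S y - F2s t x1 x2S z - W t' x' (y - z))
                <= q p.1 p.2 * nrm (y - z),
          (fun p => q p.1 p.2) @ radii_to0 --> l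
        & l < (opnorm Y2s (Winv t' x'))^-1]].

Definition condition_2B (W : R -> X -> X -> Y) (Winv : R -> X -> Y -> X) :
    Prop :=
  [/\ continuous_partial,
      invertible_family W Winv
    & forall t' x', L0 t' x' ->
      exists2 T, is_frechet Dset (fun x => Q2s (f t' x)) x' T &
        forall z, D20 z -> W t' x' z = T (P20 z) - Q2s (B (P20 z))].

(* The set of times at which d/dt [A x] is taken: J, or ]0, +oo[ if J = R_+. *)
Definition equation_times (J : set R) : set R :=
  [set t | J t /\ (J = [set s | 0 <= s] -> 0 < t)].

(* One-sided at the end points of J. *)
Definition derivative_within (J : set R) (g : R -> Y) (t : R) (d : Y) : Prop :=
  (fun s => ofR c (s - t)^-1 *: (g s - g t)) @
    within [set s | J s /\ s != t] (nbhs t) --> d.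

Definition is_solution (J : set R) (x : R -> X) : Prop :=
  [/\ {within J, continuous x},
      forall t, J t -> Dset (x t)
    & exists dAx : R -> Y,
      [/\ forall t, equation_times J t ->
            derivative_within (equation_times J) (fun s => A (x s)) t (dAx t),
          {within equation_times J, continuous dAx}
        & forall t, equation_times J t -> dAx t + B (x t) = f t (x t)]].

End RightHandSide.

End Decomposition.

Arguments Dset {R c X Y} A B.
Arguments is_solution {R c X Y} A B f J x.

(* The inverse is taken in \bar R, with 1/0 = +oo. *)
Definition tail_integral_inv_diverges (R : realType) (U : R -> R) : Prop :=
  forall u0 : R, 0 < u0 ->
    (\int[lebesgue_measure]_(u in `[u0, +oo[) ((U u)%:E)^-1 = +oo)%E.

(* Lebesgue integrability, with respect to the completed measure. *)
Definition integrable_on_finite_intervals (R : realType) (psi : R -> R) : Prop :=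
  forall a b : R, 0 <= a <= b ->
    (@completed_lebesgue_measure R).-integrable `[a, b] (EFin \o psi).

(* Main.v *)
(* Put w = A x.  The functionals q_i^{m_i} annihilate range A, so w lies in
   W = ker Q_2*, and x = S w + x_20 with S = Atilde^-1.  The closed graph
   theorem makes S and B S bounded; that Atilde is onto comes from the Laurent
   coefficients of the pencil, which give y = A C_nu y + B C_{nu-1} y with
   C_{nu-1} y in the span of the root vectors.  The algebraic part
   Q_2*[f(t, x) - B x] = 0 of the equation determines x_20 = eta(t, w) by
   condition 1, and condition 2 turns z |-> z - W_{t',x'}^-1 Q_2*[f(t, v + z) - B(v + z)]
   into a contraction near each point of L_0, so that eta is continuous and
   locally Lipschitz in w.  Hence x solves the problem if and only if
   x = S w + eta(t, w) and w' = G(t, w) := f(t, x) - B x, an ordinary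
   differential equation in W to which Picard's theorem applies.  By condition 3,
   G is bounded on bounded sets, so w can stop at a finite time only if it is
   unbounded there; condition 4 gives D^+ V(w) <= U(V(w)) psi for the upper Dini
   derivative as long as |w| >= R, and since the integral of 1/U diverges, V(w)
   and with it w stay bounded on finite intervals. *)
Require Import Defs.
From HB Require Import structures.
From mathcomp Require Import all_boot all_order all_algebra.
From mathcomp Require Import complex ring lra.
From mathcomp Require Import all_classical all_reals all_analysis.
From mathcomp Require Import measurable_realfun.

Set Implicit Arguments.
Unset Strict Implicit.
Unset Printing Implicit Defensive.

Import Order.TTheory GRing.Theory Num.Theory.
Import numFieldNormedType.Exports.

Local Open Scope classical_set_scope.
Local Open Scope ring_scope.

(** The obstacle is that [A] and [B] are unbounded, while [f] is regular only in the norm of [X].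
    The reduced equation is an ordinary one because [B] is bounded relative to [A]: [w = A x]
    controls [B S w], and the other part [B x_20] has finite rank. The same relative bound stands in
    for boundedness when powers of the parameter are compared in the Laurent series. Over the
    half-line [A x] is differentiable only for positive times, and continuity of [x] says nothing
    about [A x]. In the uniqueness part, the continuity of [w] at the initial time therefore has to
    be derived from the equation. The [V_i] are differentiable only outside a ball, [U] may vanish
    and [psi] is merely integrable. So the comparison uses [1 / (U + e)] for [1 / U], a monotone
    majorant for the integral of [psi], and a separate argument for trajectories that keep returning
    to the ball. The analysis is done over R: complex spaces are regarded as real ones, and a real
    pencil is reached through its complexification. *)

(** * Linear identities in modules, by reflection *)

Section ModuleIdentities.
Context {K : pzRingType} {E : lmodType K}.

Inductive mexp :=
  | MZero | MAtom of nat | MAdd of mexp & mexp | MOpp of mexp | MScale of K & mexp.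

Fixpoint meval (env : seq E) (x : mexp) : E :=
  match x with
  | MZero => 0
  | MAtom i => nth 0 env i
  | MAdd x y => meval env x + meval env y
  | MOpp x => - meval env x
  | MScale a x => a *: meval env x
  end.

(** The raw [eqn], in place of [==], is reduced on numerals by the [cbn] call of the tactic
    below. *)
Fixpoint mcoef (i : nat) (x : mexp) : K :=
  match x with
  | MZero => 0
  | MAtom j => (if eqn j i then 1 else 0)
  | MAdd x y => mcoef i x + mcoef i y
  | MOpp x => - mcoef i x
  | MScale a x => a * mcoef i x
  end.

Lemma mevalE env x : meval env x = \sum_(i < size env) mcoef i x *: env`_i.
Proof.
elim: x => [|j|x IHx y IHy|x IHx|a x IHx] /=.
- by rewrite big1 // => i _; rewrite scale0r.
- have [jn|nj] := ltnP j (size env); last first.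
    rewrite nth_default // big1 // => i _.
    case: (@eqnP j i) => [ji|]; last by rewrite scale0r.
    by move: nj; rewrite ji leqNgt ltn_ord.
  rewrite (bigD1 (Ordinal jn)) //= -[eqn j j]/(j == j) eqxx scale1r big1 ?addr0 // => i.
  case: (@eqnP j i) => [ji|]; last by rewrite scale0r.
  by move=> /eqP[]; apply: val_inj.
- by rewrite IHx IHy -big_split; apply: eq_bigr => i _; rewrite scalerDl.
- by rewrite IHx -sumrN; apply: eq_bigr => i _; rewrite scaleNr.
- by rewrite IHx scaler_sumr; apply: eq_bigr => i _; rewrite scalerA.
Qed.

(** Defined by recursion, so that it unfolds to a conjunction with one goal for [ring] per atom. *)
Fixpoint mcoef_eq (n : nat) (x y : mexp) : Prop :=
  match n with
  | 0 => True
  | n'.+1 => mcoef n' x = mcoef n' y /\ mcoef_eq n' x y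
  end.

Lemma meval_eq env x y : mcoef_eq (size env) x y -> meval env x = meval env y.
Proof.
move=> xy; rewrite !mevalE; apply: eq_bigr => i _.
suff -> : mcoef i x = mcoef i y by [].
case: i => i /=; elim: (size env) xy => // n IHn [xyn xy]; rewrite ltnS leq_eqVlt.
by case/orP => [/eqP->//|/(IHn xy)].
Qed.

End ModuleIdentities.

Ltac mod_mem x l :=
  lazymatch l with
  | nil => constr:(false)
  | cons x _ => constr:(true)
  | cons _ ?l' => mod_mem x l'
  end.
Ltac mod_index x l :=
  lazymatch l with
  | cons x _ => constr:(0%N)
  | cons _ ?l' => let n := mod_index x l' in constr:(S n)
  end.
Ltac mod_atoms l t :=
  lazymatch t with
  | GRing.zero => l
  | GRing.add ?x ?y => let l' := mod_atoms l x in mod_atoms l' y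
  | GRing.opp ?x => mod_atoms l x
  | GRing.scale _ ?x => mod_atoms l x
  | _ => lazymatch mod_mem t l with true => l | false => constr:(cons t l) end
  end.
Ltac mod_reify K l t :=
  lazymatch t with
  | GRing.zero => constr:(@MZero K)
  | GRing.add ?x ?y =>
      let x' := mod_reify K l x in let y' := mod_reify K l y in constr:(MAdd x' y')
  | GRing.opp ?x => let x' := mod_reify K l x in constr:(MOpp x')
  | GRing.scale ?a ?x => let x' := mod_reify K l x in constr:(@MScale K a x')
  | _ => let n := mod_index t l in constr:(@MAtom K n)
  end.
(* Decides linear identities between vectors with ring identities as coefficients. *)
Ltac module K :=
  lazymatch goal with |- @eq ?E ?x ?y =>
    let l0 := mod_atoms (@nil E) x in
    let l := mod_atoms l0 y in
    let x' := mod_reify K l x in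
    let y' := mod_reify K l y in
    refine (@meval_eq K _ l x' y' _);
    cbn [mcoef_eq mcoef size eqn]; repeat split; try ring
  end.

(** Only the instance of linearity at [0] is assumed, so that it also serves maps that are linear on
    a subspace. *)
Lemma linear_fun0 {K : pzRingType} {E F : lmodType K} (T : E -> F) :
  T (1 *: 0 + 0) = 1 *: T 0 + T 0 -> T 0 = 0.
Proof. by rewrite !scale1r addr0 => T0; apply: (addrI (T 0)); rewrite -T0 addr0. Qed.

(** * Ordinary differential equations in a Banach space *)

Section RealInduction.
Context {R : realType}.

(** Let [c] be the supremum of the times up to which [P] holds throughout. The last clause gives
    [P c], and if [c < b] the step clause would give a larger time. *)
Lemma real_induction (P : R -> Prop) (a b : R) : a <= b -> P a ->
  (forall t, a <= t < b -> (forall s, a <= s <= t -> P s) ->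
     exists2 d : R, 0 < d & forall s : R, t < s < t + d -> s <= b -> P s) ->
  (forall t, a < t <= b -> (forall s, a <= s < t -> P s) -> P t) ->
  forall t, a <= t <= b -> P t.
Proof.
move=> ab Pa Pr Pl.
pose S := [set t | a <= t <= b /\ forall s, a <= s <= t -> P s].
have Sa : S a.
  by split=> [|s]; [rewrite lexx|rewrite -eq_le => /eqP <-].
have Sb : has_ubound S by exists b => t -[/andP[_]].
have hS : has_sup S by split=> //; exists a.
set c := sup S.
have ac : a <= c by apply: ub_le_sup.
have cb : c <= b by apply: ge_sup; [exists a|move=> t -[/andP[_]]].
have Pc' s : a <= s < c -> P s.
  case/andP=> as_ sc.
  have [t [_ Pt] st] := sup_adherent (eps := c - s) ltac:(by rewrite subr_gt0) hS.
  by apply: Pt; rewrite as_ /=; move: st; rewrite -/c; lra.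
have Pc s : a <= s <= c -> P s.
  rewrite (le_eqVlt s) => /andP[as_ /predU1P[->|sc]]; last by apply: Pc'; rewrite as_.
  have [<-//|ac'] := eqVneq a c.
  by apply: Pl => //; rewrite cb andbT lt_neqAle ac' ac.
have [cbE|cb'] := eqVneq c b; first by move=> t; rewrite -cbE; exact: Pc.
have ltcb : c < b by rewrite lt_neqAle cb' cb.
have [|d d0 Pd] := Pr c _ Pc; first by rewrite ac ltcb.
pose s := Num.min (c + d / 2) b.
have cs : c < s by rewrite /s lt_min ltcb andbT; lra.
suff : S s by move/(ub_le_sup Sb); rewrite -/c; lra.
split=> [|r /andP[ar rs]].
  by rewrite (le_trans ac (ltW cs)) /= /s ge_min lexx orbT.
have [rc|cr] := leP r c; first by apply: Pc; rewrite ar.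
apply: Pd; move: rs; rewrite /s le_min => /andP[]; lra.
Qed.

(* [rho s t] is meant to be [`|u t - u s|], or [z t - z s] for a real function
   [z], which gives one-sided estimates from Dini derivatives. *)
Lemma increment_le (rho : R -> R -> R) (phi : R -> R) (a b : R) : a <= b ->
  rho a a <= 0 ->
  (forall r s t, a <= r -> r <= s -> s <= t -> t <= b ->
     rho r t <= rho r s + rho s t) ->
  (forall s t, a <= s -> s <= t -> t <= b -> phi s <= phi t) ->
  (forall t, a <= t < b -> forall e : R, 0 < e -> exists2 d : R, 0 < d &
     forall s : R, t < s < t + d -> s <= b ->
       rho t s <= phi s - phi t + e * (s - t)) ->
  (forall t, a < t <= b -> forall e : R, 0 < e -> exists2 d : R, 0 < d &
     forall s : R, t - d < s < t -> a <= s -> rho s t <= e) ->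
  rho a b <= phi b - phi a.
Proof.
move=> ab rho0 tri mono right left.
apply/ler_addgt0Pr => e e0.
(* A slope error [e'] accumulates to at most [e' * (b - a) <= e]; the [+ 1] covers [a = b]. *)
pose e' := e / (b - a + 1).
have ba : 0 < b - a + 1 by lra.
have e'0 : 0 < e' by rewrite divr_gt0.
suff H t : a <= t <= b -> rho a t <= phi t - phi a + e' * (t - a).
  apply: (le_trans (H b _)); first by rewrite ab lexx.
  rewrite lerD2l /e' mulrAC ler_pdivrMr // ler_pM2l //; lra.
move: t; apply: (real_induction (P := fun t => rho a t <= phi t - phi a + e' * (t - a))) => //.
- by rewrite !subrr mulr0 addr0.
- move=> t atb /(_ t) Pt.
  have [d d0 H] := right t atb e' e'0; exists d => // s tsd sb.
  case/andP: atb => a_t tb.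
  have := Pt ltac:(by rewrite a_t lexx).
  have := H s tsd sb; have := @tri a t s ltac:(lra) a_t ltac:(lra) sb.
  nra.
- move=> t atb Pt; apply/ler_addgt0Pr => e1 e10.
  have [d d0 H] := left t atb e1 e10.
  case/andP: atb => a_t tb.
  pose s := Num.max a (t - d / 2).
  have sl : t - d < s by rewrite /s lt_max; apply/orP; right; lra.
  have s_a : a <= s by rewrite /s le_max lexx.
  have st : s < t by rewrite /s gt_max; apply/andP; split; lra.
  have := Pt s ltac:(by rewrite s_a st).
  have := H s ltac:(by rewrite sl st) s_a.
  have := @tri a s t ltac:(lra) s_a (ltW st) tb.
  have := mono s t s_a (ltW st) tb.
  nra.
Qed.

End RealInduction.

(** * Derivatives relative to a set of times *)

Section DerivOn.
Context {R : realType} {E : completeNormedModType R}.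
Implicit Types (u v F : R -> E) (J : set R).

(** Without a quotient the estimate makes sense at [s = t] too; the restriction to [J] gives
    one-sided derivatives at end points. *)
Definition deriv_on J u t (l : E) := forall e : R, 0 < e -> exists2 d : R, 0 < d &
  forall s : R, J s -> `|s - t| < d -> `|u s - u t - (s - t) *: l| <= e * `|s - t|.

Lemma deriv_onW J J' u t l : J' `<=` J -> deriv_on J u t l -> deriv_on J' u t l.
Proof.
move=> JJ H e e0; have [d d0 Hd] := H e e0.
by exists d => // s /JJ Js; exact: Hd.
Qed.

Lemma deriv_on_near J J' u t l d0 : 0 < d0 ->
  (forall s, J' s -> `|s - t| < d0 -> J s) -> deriv_on J u t l -> deriv_on J' u t l.
Proof.
move=> d00 JJ H e e0; have [d dp Hd] := H e e0.
exists (Num.min d d0) => [|s J's]; first by rewrite lt_min dp.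
by rewrite lt_min => /andP[sd sd0]; apply: Hd => //; exact: JJ.
Qed.

Lemma eq_deriv_on J u v t l : J t -> (forall s, J s -> u s = v s) ->
  deriv_on J u t l -> deriv_on J v t l.
Proof.
move=> Jt uv H e e0; have [d d0 Hd] := H e e0.
by exists d => // s Js st; rewrite -!uv //; exact: Hd.
Qed.

Lemma deriv_on_glue a b c u t l : a <= t <= c ->
  deriv_on [set s | a <= s <= b] u t l \/ b < t ->
  deriv_on [set s | b <= s <= c] u t l \/ t < b ->
  deriv_on [set s | a <= s <= c] u t l.
Proof.
move=> atc Hl Hr e e0.
have [d1 d10 H1] : exists2 d : R, 0 < d & forall s : R, a <= s <= b -> `|s - t| < d ->
    `|u s - u t - (s - t) *: l| <= e * `|s - t|.
  case: Hl => [/(_ e e0)//|bt].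
  exists (t - b) => [|s /andP[_ sb]]; first by rewrite subr_gt0.
  by rewrite distrC ger0_norm; lra.
have [d2 d20 H2] : exists2 d : R, 0 < d & forall s : R, b <= s <= c -> `|s - t| < d ->
    `|u s - u t - (s - t) *: l| <= e * `|s - t|.
  case: Hr => [/(_ e e0)//|bt].
  exists (b - t) => [|s /andP[sb _]]; first by rewrite subr_gt0.
  by rewrite ger0_norm; lra.
exists (Num.min d1 d2) => [|s /andP[as_ sc]]; first by rewrite lt_min d10.
rewrite lt_min => /andP[sd1 sd2].
by have [sb|bs] := leP s b; [apply: H1; rewrite ?as_|apply: H2; rewrite ?(ltW bs)].
Qed.

Lemma deriv_onB J u v t l k : deriv_on J u t l -> deriv_on J v t k ->
  deriv_on J (fun s => u s - v s) t (l - k).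
Proof.
move=> Hu Hv e e0.
have [d1 d10 H1] := Hu (e / 2) ltac:(lra); have [d2 d20 H2] := Hv (e / 2) ltac:(lra).
exists (Num.min d1 d2) => [|s Js]; first by rewrite lt_min d10.
rewrite lt_min => /andP[sd1 sd2].
have := H1 s Js sd1; have := H2 s Js sd2.
have -> : u s - v s - (u t - v t) - (s - t) *: (l - k) =
    (u s - u t - (s - t) *: l) - (v s - v t - (s - t) *: k).
  module R.
have := ler_normB (u s - u t - (s - t) *: l) (v s - v t - (s - t) *: k).
nra.
Qed.
End DerivOn.

Section Completeness.
Context {R : realType} {E : completeNormedModType R}.

Lemma dist_lim_le (u : nat -> E) (l x : E) C N :
  u n @[n --> \oo] --> l -> (forall n, (N <= n)%N -> `|u n - x| <= C) ->
  `|l - x| <= C.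
Proof.
move=> ul uC; have : `|u n - x| @[n --> \oo] --> `|l - x|.
  by apply: cvg_norm; apply: cvgB => //; exact: cvg_cst.
move=> H; rewrite -(cvg_lim _ H)//; apply: limr_le; first by apply/cvg_ex; exists `|l - x|.
by exists N => // n /=; exact: uC.
Qed.

Lemma geometric_cvg (u : nat -> E) (C : R) :
  (forall n, `|u n.+1 - u n| <= C * 2^-1 ^+ n) ->
  exists2 l, u n @[n --> \oo] --> l & forall n, `|u n - l| <= 2 * C * 2^-1 ^+ n.
Proof.
move=> uC.
have C0 : 0 <= C by have := uC 0%N; rewrite expr0 mulr1; apply: le_trans.
have p0 n : 0 < 2^-1 ^+ n :> R by rewrite exprn_gt0.
(* The factor [1 - 2^-m] is the exact partial sum of the geometric series, which lets the induction
   close. *)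
have uD n m : `|u (n + m)%N - u n| <= 2 * C * 2^-1 ^+ n * (1 - 2^-1 ^+ m).
  elim: m => [|m IHm]; first by rewrite addn0 expr0 !subrr mulr0 normr0.
  apply: le_trans (ler_distD (u (n + m)%N) _ _) _; rewrite addnS.
  have := uC (n + m)%N; rewrite exprD exprS; move: IHm (p0 n) (p0 m).
  move: (2^-1 ^+ n) (2^-1 ^+ m) => p q h1 h2 h3 h4; apply: le_trans (lerD h4 h1) _; nra.
have uD' n m : (n <= m)%N -> `|u m - u n| <= 2 * C * 2^-1 ^+ n.
  move=> nm; have := uD n (m - n)%N; rewrite subnKC //.
  have := mulr_ge0 (mulr_ge0 C0 (ltW (p0 n))) (ltW (p0 (m - n)%N)).
  by move: ((2^-1 : R) ^+ n) ((2^-1 : R) ^+ (m - n)%N) => p q; nra.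
have uc : cvg (u n @[n --> \oo]).
  apply/cauchy_cvgP; apply: cauchy_exP => e e0.
  have [n Cn] : exists n, 2 * C * 2^-1 ^+ n < e.
    have : (2 * C * 2^-1 ^+ n) @[n --> \oo] --> (0 : R).
      rewrite -[X in _ --> X](mulr0 (2 * C)); apply: cvgM; first exact: cvg_cst.
      by apply: cvg_expr; rewrite gtr0_norm; lra.
    move=> /cvgrPdist_lt /(_ e e0)[n _ /(_ n (leqnn n))].
    by rewrite /= sub0r normrN => H; exists n; apply: le_lt_trans H; exact: ler_norm.
  exists (u n); exists n => // m nm; rewrite -ball_normE /= distrC.
  by apply: le_lt_trans Cn; exact: uD'.
exists (lim (u n @[n --> \oo])) => // n; rewrite distrC.
by apply: dist_lim_le uc _ => m; exact: uD'.
Qed.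

Lemma lipschitz_left_lim (u : R -> E) (a b M : R) : a < b ->
  (forall s t, a <= s -> s <= t -> t < b -> `|u t - u s| <= M * (t - s)) ->
  exists l, forall t, a <= t -> t < b -> `|u t - l| <= M * (b - t).
Proof.
move=> ab uM.
(* Times approaching [b] geometrically, so that the increments of [u] between them are summable. *)
pose t_ n := b - (b - a) * 2^-1 ^+ n.
have p0 n : 0 < 2^-1 ^+ n :> R by rewrite exprn_gt0.
have p1 n : 2^-1 ^+ n <= 1 :> R by apply: exprn_ile1; lra.
have M0 : 0 <= M.
  have := uM a ((a + b) / 2) ltac:(lra) ltac:(lra) ltac:(lra).
  by move=> /(le_trans (normr_ge0 _)); rewrite pmulr_lge0 //; lra.
have ta n : a <= t_ n by rewrite /t_; have := p1 n; nra.
have tb n : t_ n < b by rewrite /t_; have := p0 n; nra.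
have tS n : t_ n <= t_ n.+1 by rewrite /t_ exprS; have := p0 n; nra.
have [n|l ul _] := @geometric_cvg (u \o t_) (M * (b - a)).
  apply: (le_trans (uM _ _ (ta n) (tS n) (tb n.+1))); rewrite /t_ exprS.
  have ba : 0 <= b - a by lra.
  have := mulr_ge0 (mulr_ge0 M0 ba) (ltW (p0 n)); nra.
exists l => t a_t t_b; rewrite distrC.
have tl : t_ n @[n --> \oo] --> b.
  rewrite -[X in _ --> X](subr0 b); apply: cvgB; first exact: cvg_cst.
  rewrite -[X in _ --> X](mulr0 (b - a)); apply: cvgM; first exact: cvg_cst.
  by apply: cvg_expr; rewrite gtr0_norm; lra.
have : \forall n \near \oo, t < t_ n.
  move/cvgrPdist_lt: tl => /(_ (b - t) ltac:(lra))[N0 _ H]; exists N0 => // n /H /=.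
  by rewrite gtr0_norm; [lra|have := tb n; lra].
move=> [N1 _ HN1]; apply: (dist_lim_le (N := N1)) ul _ => n Nn /=.
have tn := HN1 n Nn; apply: le_trans (uM _ _ a_t (ltW tn) (tb n)) _.
by apply: ler_wpM2l => //; have := tb n; rewrite /=; lra.
Qed.

End Completeness.

Section Geometric.
Context {R : realType}.

Lemma half_pow_gt0 n : 0 < (2^-1 : R) ^+ n.
Proof. by rewrite exprn_gt0. Qed.

Lemma half_pow_small (C e : R) : 0 < e -> exists n, C * 2^-1 ^+ n <= e.
Proof.
move=> e0; have : (C * 2^-1 ^+ n) @[n --> \oo] --> (0 : R).
  rewrite -[X in _ --> X](mulr0 C); apply: cvgM; first exact: cvg_cst.
  by apply: cvg_expr; rewrite gtr0_norm; lra.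
move=> /cvgrPdist_lt /(_ e e0)[n _ /(_ n (leqnn n))].
by rewrite /= sub0r normrN => H; exists n; exact: le_trans (ler_norm _) (ltW H).
Qed.

Lemma half_pow_eq0 (E : normedModType R) (x : E) (C : R) :
  (forall n, `|x| <= C * 2^-1 ^+ n) -> x = 0.
Proof.
move=> H; apply/eqP; rewrite -normr_le0; apply/ler_addgt0Pr => e e0; rewrite add0r.
by have [n Cn] := half_pow_small C e0; exact: le_trans (H n) Cn.
Qed.
End Geometric.

(** * Mean value inequality and primitives of continuous functions *)

Section Primitives.
Context {R : realType} {E : completeNormedModType R}.
Implicit Types (u v F g : R -> E) (J : set R).

Definition cont_on J u t := forall e : R, 0 < e -> exists2 d : R, 0 < d &
  forall s : R, J s -> `|s - t| < d -> `|u s - u t| <= e.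

Lemma deriv_on_cont J u t l : deriv_on J u t l -> cont_on J u t.
Proof.
move=> H e e0; have [d d0 Hd] := H 1 ltr01.
have l0 := normr_ge0 l.
exists (Num.min d (e / (1 + `|l|))) => [|s Js].
  by rewrite lt_min d0 divr_gt0 //; lra.
rewrite lt_min => /andP[sd]; rewrite ltr_pdivlMr; last lra.
move=> se; have := Hd s Js sd; rewrite mul1r => H1.
have -> : u s - u t = (u s - u t - (s - t) *: l) + (s - t) *: l by module R.
apply: le_trans (ler_normD _ _) _; rewrite normrZ; nra.
Qed.

(** Mean value inequality: [increment_le] for the distance, compared with a linear function of slope
    [M]. *)
Lemma deriv_on_le u a b M : a <= b ->
  (forall t, a <= t <= b -> exists2 l, deriv_on [set s | a <= s <= b] u t l & `|l| <= M) ->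
  `|u b - u a| <= M * (b - a).
Proof.
move=> ab H; rewrite mulrBr.
have M0 : 0 <= M.
  by have [|l _] := H a; [rewrite lexx|apply: le_trans].
apply: (increment_le (rho := fun s t => `|u t - u s|)
  (phi := fun t => M * t)) => //.
- by rewrite subrr normr0.
- by move=> r s t _ _ _ _; rewrite [leRHS]addrC; exact: ler_distD.
- by move=> s t _ st _; apply: ler_wpM2l.
- move=> t /andP[a_t tb] e e0; have [|l Hl lM] := H t; first by rewrite a_t ltW.
  have [d d0 Hd] := Hl e e0; exists d => // s /andP[ts sd] sb.
  have := Hd s ltac:(by rewrite /= sb andbT; lra) ltac:(by rewrite gtr0_norm; lra).
  rewrite [u s - u t in X in _ -> X](_ : _ = (u s - u t - (s - t) *: l) + (s - t) *: l); last by module R.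
  have st0 : 0 <= s - t by lra.
  have := ler_wpM2l st0 lM; rewrite ger0_norm // => h1 h2.
  by apply: le_trans (ler_normD _ _) _; rewrite /= normrZ ger0_norm //; lra.
- move=> t /andP[a_t tb] e e0; have [|l Hl lM] := H t; first by rewrite tb ltW.
  have [d d0 Hd] := deriv_on_cont Hl e0; exists d => // s /andP[ts sd] as_.
  by rewrite distrC; apply: Hd; rewrite /= ?as_ /=; [lra|rewrite ltr0_norm; lra].
Qed.

(** A primitive up to a slope error [e]. It plays the part of a Riemann sum: a primitive is obtained
    as the limit of such functions. *)
Definition eps_primitive (g : R -> E) a e F c := forall t, a <= t <= c ->
  exists2 d : R, 0 < d & forall s : R, a <= s <= c -> `|s - t| < d ->
    `|F s - F t - (s - t) *: g t| <= e * `|s - t|.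

(** Beyond [c'] the function continues with constant slope [g c]. The reference point [c] is left
    free because it is the left end of the new piece in one clause of the real induction and the
    right end in the other. *)
Lemma eps_primitive_extend g a (e : R) F c c' c'' : a <= c' -> c' <= c'' ->
  (forall t, c' <= t <= c'' -> `|g c - g t| <= e) -> 0 <= e ->
  eps_primitive g a e F c' -> exists F', eps_primitive g a e F' c''.
Proof.
move=> ac' c'c'' gc e0 HF.
pose F' (t : R) := if t <= c' then F t else F c' + (t - c') *: g c.
have F'r (t : R) : c' <= t -> F' t = F c' + (t - c') *: g c.
  rewrite /F'; have [tc|//] := leP t c' => ct.
  have -> : t = c' by lra.
  by rewrite subrr scale0r addr0.
have F'l (t : R) : t <= c' -> F' t = F t by rewrite /F' => ->.
exists F' => t /andP[a_t tc''].
have Hr : c' <= t -> forall s : R, c' <= s <= c'' ->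
    `|F' s - F' t - (s - t) *: g t| <= e * `|s - t|.
  move=> ct s /andP[cs sc''] ; rewrite !F'r //.
  rewrite (_ : _ - _ = (s - t) *: (g c - g t)); last by module R.
  by rewrite normrZ mulrC ler_wpM2r //; apply: gc; rewrite ct.
have [tc|ct|tc] := ltgtP t c'.
- have [d1 d10 Hd] := HF t ltac:(by rewrite a_t ltW).
  exists (Num.min d1 (c' - t)) => [|s /andP[as_ sc]]; first by rewrite lt_min d10 subr_gt0.
  rewrite lt_min => /andP[sd1 sct].
  have sc' : s <= c' by move: sct; have := ler_norm (s - t); lra.
  by rewrite (F'l s sc') (F'l t (ltW tc)); apply: Hd => //; rewrite as_.
- exists (t - c') => [|s /andP[as_ sc] st]; first by rewrite subr_gt0.
  apply: Hr; first exact: ltW.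
  by rewrite sc andbT; move: st; have := ler_norm (t - s); rewrite distrC; lra.
- subst t; have [d1 d10 Hd] := HF c' ltac:(by rewrite ac' lexx).
  exists d1 => // s /andP[as_ sc] st.
  have [sc'|cs] := leP s c'; last by apply: Hr; rewrite // ltW.
  by rewrite (F'l s sc') (F'l c') //; apply: Hd; rewrite ?as_.
Qed.

Lemma eps_primitive_exists g a b e : a <= b -> 0 < e ->
  (forall t, a <= t <= b -> cont_on [set s | a <= s <= b] g t) ->
  exists F, eps_primitive g a e F b.
Proof.
move=> ab e0 gc.
apply: (real_induction (P := fun c => exists F, eps_primitive g a e F c)
  (a := a) (b := b)) => //; last by rewrite ab lexx.
- exists (fun=> 0) => t; rewrite -eq_le => /eqP <-.
  by exists 1 => // s; rewrite -eq_le => /eqP <-; rewrite !subrr scale0r !subr0 !normr0 mulr0.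
- move=> t /andP[a_t tb] /(_ t); rewrite a_t lexx => /(_ erefl)[F HF].
  have [d d0 Hd] := gc t ltac:(by rewrite a_t ltW) e e0.
  exists d => // s /andP[ts std] sb.
  apply: (eps_primitive_extend (c := t) a_t (ltW ts) _ (ltW e0) HF) => r /andP[tr rs].
  by rewrite distrC; apply: Hd; rewrite /= ?ger0_norm; lra.
- move=> t /andP[a_t tb] Ps.
  have [d d0 Hd] := gc t ltac:(by rewrite tb ltW) e e0.
  pose s := Num.max a (t - d / 2).
  have sl : t - d < s by rewrite /s lt_max; apply/orP; right; lra.
  have s_a : a <= s by rewrite /s le_max lexx.
  have st : s < t by rewrite /s gt_max; apply/andP; split; lra.
  have [F HF] := Ps s ltac:(by rewrite s_a st).
  apply: (eps_primitive_extend (c := t) s_a (ltW st) _ (ltW e0) HF) => r /andP[tr rs].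
  by rewrite distrC; apply: Hd; rewrite /= ?ler0_norm; lra.
Qed.

(** Both slopes are close to [g], so the difference has slope at most [e1 + e2]. Hence approximate
    primitives with errors tending to [0] have increments that form Cauchy sequences. *)
Lemma eps_primitiveB g a b e1 e2 F1 F2 s t : 0 <= e1 -> 0 <= e2 ->
  eps_primitive g a e1 F1 b -> eps_primitive g a e2 F2 b ->
  a <= s -> s <= t -> t <= b ->
  `|(F1 t - F1 s) - (F2 t - F2 s)| <= (e1 + e2) * `|t - s|.
Proof.
move=> e10 e20 H1 H2 as_ st tb; rewrite (ger0_norm (x := t - s)) ?subr_ge0 // mulrBr.
have loc r : s <= r <= t -> exists2 d : R, 0 < d & forall q, s <= q <= t -> `|q - r| < d ->
    `|(F1 q - F1 r) - (F2 q - F2 r)| <= (e1 + e2) * `|q - r|.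
  move=> /andP[sr rt].
  have arb : a <= r <= b by apply/andP; lra.
  have [d1 d10 Hd1] := H1 r arb; have [d2 d20 Hd2] := H2 r arb.
  exists (Num.min d1 d2) => [|q /andP[sq qt]]; first by rewrite lt_min d10.
  rewrite lt_min => /andP[qd1 qd2].
  have aqb : a <= q <= b by apply/andP; lra.
  have := Hd1 q aqb qd1; have := Hd2 q aqb qd2.
  rewrite (_ : _ - (F2 q - F2 r) =
    (F1 q - F1 r - (q - r) *: g r) - (F2 q - F2 r - (q - r) *: g r)); last by module R.
  by move=> h2 h1; apply: le_trans (ler_normB _ _) _; lra.
apply: (increment_le (rho := fun s t => `|(F1 t - F1 s) - (F2 t - F2 s)|)
  (phi := fun t => (e1 + e2) * t)) => //.
- by rewrite !subrr normr0.
- move=> p q r _ _ _ _; rewrite (_ : _ - (F2 r - F2 p) =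
    (F1 q - F1 p - (F2 q - F2 p)) + (F1 r - F1 q - (F2 r - F2 q))); last by module R.
  exact: ler_normD.
- by move=> p q _ pq _; apply: ler_wpM2l; lra.
- move=> r /andP[sr rt] e e0; have [|d d0 Hd] := loc r; first by rewrite sr ltW.
  exists d => // q /andP[rq qd] qt.
  have := Hd q ltac:(by rewrite qt andbT; lra); rewrite gtr0_norm; last lra.
  by move=> /(_ ltac:(lra)); nra.
- move=> r /andP[sr rt] e e0; have [|d d0 Hd] := loc r; first by rewrite rt ltW.
  exists (Num.min d (e / (1 + (e1 + e2)))) => [|q].
    by rewrite lt_min d0 divr_gt0; lra.
  move=> /andP[qd rq] sq; rewrite (_ : _ - (F2 r - F2 q) =
    - (F1 q - F1 r - (F2 q - F2 r))); last by module R.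
  have : r - q < Num.min d (e / (1 + (e1 + e2))) by lra.
  rewrite lt_min ltr_pdivlMr; last lra.
  move=> /andP[h1 h2].
  rewrite normrN; apply: le_trans (Hd q _ _) _.
  + by rewrite sq; lra.
  + by rewrite ltr0_norm; lra.
  + by rewrite ltr0_norm; nra.
Qed.

Lemma primitive g a b : a <= b ->
  (forall t, a <= t <= b -> cont_on [set s | a <= s <= b] g t) ->
  exists F, forall t, a <= t <= b -> deriv_on [set s | a <= s <= b] F t (g t).
Proof.
move=> ab gc.
have p0 := @half_pow_gt0 R.
have [F HF] : {F : nat -> R -> E & forall n, eps_primitive g a (2^-1 ^+ n) (F n) b}.
  by apply: (@choice _ _ (fun n F => eps_primitive g a (2^-1 ^+ n) F b)) => n; exact: eps_primitive_exists (p0 n) gc.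
(* Only increments are controlled, hence the normalisation at [a]. *)
pose u n t := F n t - F n a.
have uB n m s t : (n <= m)%N -> a <= s <= b -> a <= t <= b ->
    `|(u m t - u m s) - (u n t - u n s)| <= 2 * 2^-1 ^+ n * `|t - s|.
  move=> nm /andP[as_ sb] /andP[a_t tb].
  have pnm : 2^-1 ^+ m <= (2^-1 : R) ^+ n by apply: ler_wiXn2l => //; lra.
  rewrite /u (_ : _ - _ = (F m t - F m s) - (F n t - F n s)); last by module R.
  have le2 : (2^-1 ^+ m + 2^-1 ^+ n) * `|t - s| <= 2 * 2^-1 ^+ n * `|t - s|.
    by apply: ler_wpM2r => //; lra.
  apply: le_trans le2; have [st|ts] := leP s t.
    by apply: (eps_primitiveB (ltW (p0 m)) (ltW (p0 n)) (HF m) (HF n)).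
  have -> : `|F m t - F m s - (F n t - F n s)| = `|F m s - F m t - (F n s - F n t)|.
    by rewrite -normrN; congr `|_|; module R.
  rewrite (distrC t s).
  by apply: (eps_primitiveB (ltW (p0 m)) (ltW (p0 n)) (HF m) (HF n)) => //; exact: ltW.
have [f Hf] : {f : R -> E & forall t, a <= t <= b -> u n t @[n --> \oo] --> f t}.
  apply: (@choice _ _ (fun t l => a <= t <= b -> u n t @[n --> \oo] --> l)) => t.
  have [atb|] := boolP (a <= t <= b); last by exists 0.
  have [n|l ul _] := @geometric_cvg _ _ (u ^~ t) (2 * (b - a)); last by exists l.
  have := uB n n.+1 a t (leqnSn n) ltac:(by rewrite lexx ab) atb.
  rewrite [u n.+1 a]subrr [u n a]subrr !subr0 => /le_trans; apply.
  rewrite [leRHS]mulrAC; apply: ler_wpM2l; first by have := p0 n; lra.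
  by rewrite ger0_norm; case/andP: atb; lra.
exists f => t atb e e0.
(* The constant is 2 for the passage from [u n] to the limit plus 1 for the slope error of [F n]. *)
have [n Hn] := half_pow_small 3 e0.
have [d d0 Hd] := HF n t atb.
exists d => // s asb st.
have fu : `|f s - f t - (u n s - u n t)| <= 2 * 2^-1 ^+ n * `|s - t|.
  have H : (u m s - u m t) @[m --> \oo] --> f s - f t by apply: cvgB; exact: Hf.
  by apply: (dist_lim_le (N := n) H) => m nm; exact: (uB n m t s nm atb asb).
have := Hd s asb st.
have -> : f s - f t - (s - t) *: g t =
  (f s - f t - (u n s - u n t)) + (F n s - F n t - (s - t) *: g t) by rewrite /u; module R.
move=> h; apply: le_trans (ler_normD _ _) _.
by have := normr_ge0 (s - t); nra.
Qed.

End Primitives.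

(** * The Cauchy problem: uniqueness, local and global existence *)

Section CauchyProblem.
Context {R : realType} {E : completeNormedModType R}.
Implicit Types (u v : R -> E).
Variable G : R -> E -> E.

Definition jcont := forall (t : R) (w : E) (e : R), 0 < e -> exists2 d : R, 0 < d &
  forall (s : R) (v : E), `|s - t| < d -> `|v - w| < d -> `|G s v - G t w| <= e.

Definition loc_lipschitz := forall (t : R) (w : E), exists d L : R,
  [/\ 0 < d, 0 <= L & forall (s : R) (u v : E), `|s - t| < d ->
     `|u - w| < d -> `|v - w| < d -> `|G s u - G s v| <= L * `|u - v|].

Definition sol (J : set R) u := forall t, J t -> deriv_on J u t (G t (u t)).

Hypotheses (Gc : jcont) (GL : loc_lipschitz).

Lemma sol_itvW a b a' b' u : a <= a' -> b' <= b ->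
  sol [set s | a <= s <= b] u -> sol [set s | a' <= s <= b'] u.
Proof.
move=> aa bb H t /= /andP[at_ tb].
apply: deriv_onW (H t _) => [s /= /andP[as_ sb]|/=]; lra.
Qed.

Lemma sol_unique a b u v : a <= b ->
  sol [set s | a <= s <= b] u -> sol [set s | a <= s <= b] v -> u a = v a ->
  forall t, a <= t <= b -> u t = v t.
Proof.
move=> ab su sv uva.
apply: (real_induction (P := fun t => u t = v t) (a := a) (b := b)) => //.
- move=> t /andP[a_t tb] /(_ t); rewrite a_t lexx => /(_ erefl) uvt.
  have [d [L [d0 L0 HL]]] := GL t (u t).
  have atb : a <= t <= b by rewrite a_t ltW.
  have [d1 d10 H1] := deriv_on_cont (su t atb) (e := d / 2) ltac:(lra).
  have [d2 d20 H2] := deriv_on_cont (sv t atb) (e := d / 2) ltac:(lra).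
  (* Chosen so that [L * h <= 1 / 2] and both solutions stay where the Lipschitz estimate holds;
     [L + 1] avoids a division by zero. *)
  pose h := Num.min (Num.min d (2 * (L + 1))^-1) (Num.min d1 d2).
  have i0 : 0 < (2 * (L + 1))^-1 by rewrite invr_gt0; lra.
  have h0 : 0 < h by rewrite !lt_min d0 i0 d10 d20.
  have [hd [hL [hd1 hd2]]] : h <= d /\ (h * (2 * (L + 1)) <= 1 /\ (h <= d1 /\ h <= d2)).
    split; first by rewrite /h !ge_min lexx.
    split; first by rewrite -ler_pdivlMr ?div1r ?/h ?ge_min ?lexx ?orbT //; lra.
    by split; rewrite /h !ge_min lexx !orbT.
  have near (r : R) : t <= r < t + h -> r <= b -> `|u r - u t| < d /\ `|v r - u t| < d.
    move=> /andP[tr rh] rb.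
    have := H1 r ltac:(rewrite /=; lra) ltac:(by rewrite ger0_norm; lra).
    have := H2 r ltac:(rewrite /=; lra) ltac:(by rewrite ger0_norm; lra).
    by rewrite -uvt; lra.
  (* Each application of the mean value inequality on an interval shorter than [h] halves the bound;
     this replaces Gronwall's inequality. *)
  have key n (r : R) : t <= r < t + h -> r <= b -> `|u r - v r| <= 2 * d * 2^-1 ^+ n.
    elim: n r => [|n IHn] r /andP[tr rh] rb.
      have [ur vr] := near r ltac:(by rewrite tr) rb.
      have := ler_distD (u t) (u r) (v r); rewrite (distrC (u t)) expr0; lra.
    have p0 := @half_pow_gt0 R n.
    have -> : u r - v r = (u r - v r) - (u t - v t) by rewrite uvt subrr subr0.
    apply: le_trans (deriv_on_le (u := fun r => u r - v r) (M := L * (2 * d * 2^-1 ^+ n)) tr _) _.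
      move=> q /andP[tq qr]; have aqb : a <= q <= b by apply/andP; lra.
      exists (G q (u q) - G q (v q)).
        apply: deriv_onW (deriv_onB (su q aqb) (sv q aqb)) => s /= /andP[]; lra.
      have [uq vq] := near q ltac:(lra) ltac:(lra).
      apply: le_trans (HL q (u q) (v q) _ uq vq) _; first by rewrite ger0_norm; lra.
      by apply: ler_wpM2l => //; apply: IHn; lra.
    rewrite exprS.
    have rh' : (r - t) * (2 * (L + 1)) <= 1.
      apply: le_trans hL; apply: ler_wpM2r; lra.
    have rL : L * (r - t) <= 2^-1 by nra.
    have pd : 0 <= 2 * d * 2^-1 ^+ n by apply: mulr_ge0; lra.
    have := ler_wpM2r pd rL; lra.
  exists h => // s /andP[ts sh] sb.
  apply/eqP; rewrite -subr_eq0; apply/eqP.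
  by apply: (@half_pow_eq0 _ _ _ (2 * d)) => n; apply: key; lra.
- move=> t /andP[a_t tb] Ps; apply/eqP; rewrite -subr_eq0 -normr_le0.
  apply/ler_addgt0Pr => e e0; rewrite add0r.
  have atb : a <= t <= b by rewrite tb ltW.
  have [d1 d10 H1] := deriv_on_cont (su t atb) (e := e / 2) ltac:(lra).
  have [d2 d20 H2] := deriv_on_cont (sv t atb) (e := e / 2) ltac:(lra).
  pose d := Num.min d1 d2.
  have d0 : 0 < d by rewrite lt_min d10.
  have [dd1 dd2] : d <= d1 /\ d <= d2 by rewrite /d !ge_min !lexx orbT.
  pose s := Num.max a (t - d / 2).
  have sl : t - d < s by rewrite /s lt_max; apply/orP; right; lra.
  have s_a : a <= s by rewrite /s le_max lexx.
  have st : s < t by rewrite /s gt_max; apply/andP; split; lra.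
  have uvs := Ps s ltac:(by rewrite s_a st).
  have := H1 s ltac:(rewrite /=; lra) ltac:(by rewrite ltr0_norm; lra).
  have := H2 s ltac:(rewrite /=; lra) ltac:(by rewrite ltr0_norm; lra).
  rewrite -uvs (distrC (u s) (u t)).
  have := ler_distD (u s) (u t) (v t); lra.
Qed.

End CauchyProblem.

Section LocalExistence.
Context {R : realType} {E : completeNormedModType R}.
Implicit Types (u v : R -> E).
Variable G : R -> E -> E.
Hypotheses (Gc : jcont G) (GL : loc_lipschitz G).
Local Notation sol := (sol G).

(** The same step [h] serves all initial data near [(t0, w0)]. This uniformity lets a solution be
    restarted shortly before a critical time and carried past it. *)
Lemma picard (t0 : R) (w0 : E) : exists2 h : R, 0 < h & forall (s : R) (w : E),
  `|s - t0| <= h -> `|w - w0| <= h ->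
  exists2 u, u s = w & sol [set t | s <= t <= s + h] u.
Proof.
have [d [L [d0 L0 HL]]] := GL t0 w0.
have [d2 d20 HM] := Gc t0 w0 ltr01.
pose M := `|G t0 w0| + 1.
have M1 : 1 <= M by rewrite lerDr.
pose r := Num.min d d2 / 2.
have dm0 : 0 < Num.min d d2 by rewrite lt_min d0.
have r0 : 0 < r by rewrite divr_gt0.
have [rd rd2] : r < d /\ r < d2.
  have [] : Num.min d d2 <= d /\ Num.min d d2 <= d2 by rewrite !ge_min !lexx orbT.
  rewrite /r; lra.
have {}HM (t : R) (v : E) : `|t - t0| <= r -> `|v - w0| <= r -> `|G t v| <= M.
  move=> tr vr; have := HM t v ltac:(lra) ltac:(lra).
  have := ler_normD (G t v - G t0 w0) (G t0 w0); rewrite subrK /M; lra.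
have {}HL (t : R) (u v : E) : `|t - t0| <= r -> `|u - w0| <= r -> `|v - w0| <= r ->
    `|G t u - G t v| <= L * `|u - v|.
  by move=> tr ur vr; apply: HL; lra.
(* The first bound keeps the time offset [2 * h] and the drift [(M + 1) * h] below [r]; the second
   gives [L * h <= 1 / 2]. *)
pose h := Num.min (r / (2 + M)) (2 * (L + 1))^-1.
have i0 : 0 < (2 * (L + 1))^-1 by rewrite invr_gt0; lra.
have h0 : 0 < h by rewrite lt_min i0 andbT divr_gt0 //; lra.
have hM : h * (2 + M) <= r.
  by rewrite -ler_pdivlMr; [rewrite /h ge_min lexx|lra].
have hL : h * (2 * (L + 1)) <= 1.
  by rewrite -ler_pdivlMr; [rewrite div1r /h ge_min lexx orbT|lra].
exists h => // s w sh wh.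
pose J := [set t : R | s <= t <= s + h].
have Jr t : J t -> `|t - t0| <= r.
  move=> /= /andP[st tsh].
  have := ler_distD s t t0; rewrite (ger0_norm (x := t - s)); last lra.
  nra.
(* Continuity makes [primitive] applicable to [G t (u t)], and the bound keeps [u] where [HM] and
   [HL] hold. *)
pose good u := forall t, J t -> cont_on J u t /\ `|u t - w0| <= r.
pose step u v := [/\ good v, v s = w & forall t, J t -> deriv_on J v t (G t (u t))].
have Js : J s by rewrite /J /=; lra.
have stepE u : exists v, good u -> step u v.
  have [gu|] := pselect (good u); last by exists u.
  have [|t Jt|F HF] := @primitive _ _ (fun t => G t (u t)) s (s + h); first lra.
    move=> e e0; have [d1 d10 H1] := Gc t (u t) e0.
    have [d3 d30 H3] := (gu t Jt).1 (d1 / 2) ltac:(lra).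
    exists (Num.min d1 d3) => [|q Jq]; first by rewrite lt_min d10.
    rewrite lt_min => /andP[qd1 qd3]; apply: H1 => //.
    by have := H3 q Jq qd3; lra.
  pose v t := w + (F t - F s).
  have dv t : J t -> deriv_on J v t (G t (u t)).
    move=> Jt e e0; have [d1 d10 H1] := HF t Jt e e0; exists d1 => // q Jq qt.
    rewrite /v (_ : _ - _ - _ = F q - F t - (q - t) *: G t (u t)); last by module R.
    exact: H1.
  exists v => _; split=> //; last by rewrite /v subrr addr0.
  move=> t Jt; split; first exact: deriv_on_cont (dv t Jt).
  have [st tsh] := andP Jt.
  have : `|v t - v s| <= M * (t - s).
    apply: deriv_on_le => // q /andP[sq qt].
    have Jq : J q by rewrite /J /=; lra.
    exists (G q (u q)); last by apply: HM; [exact: Jr|exact: (gu q Jq).2].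
    by apply: deriv_onW (dv q Jq) => p /=; rewrite /J /=; lra.
  have -> : v s = w by rewrite /v subrr addr0.
  have := ler_distD w (v t) w0; nra.
have [S HS] : {S : (R -> E) -> (R -> E) & forall u, good u -> step u (S u)}.
  exact: (@choice _ _ (fun u v => good u -> step u v)).
have contr u v (C : R) : good u -> good v -> (forall t, J t -> `|u t - v t| <= C) ->
    forall t, J t -> `|S u t - S v t| <= C / 2.
  move=> gu gv uvC t Jt.
  have [gSu Sus dSu] := HS u gu; have [gSv Svs dSv] := HS v gv.
  have [st tsh] := andP Jt.
  have C0 : 0 <= C by apply: le_trans (uvC t Jt).
  have -> : S u t - S v t = (S u t - S v t) - (S u s - S v s).
    by rewrite Sus Svs subrr subr0.
  apply: le_trans (deriv_on_le (u := fun t => S u t - S v t) (M := L * C) st _) _.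
    move=> q /andP[sq qt]; have Jq : J q by rewrite /J /=; lra.
    exists (G q (u q) - G q (v q)).
      by apply: deriv_onW (deriv_onB (dSu q Jq) (dSv q Jq)) => p /=; rewrite /J /=; lra.
    apply: le_trans (HL q _ _ (Jr q Jq) (gu q Jq).2 (gv q Jq).2) _.
    by apply: ler_wpM2l => //; exact: uvC.
  have : (t - s) * (2 * (L + 1)) <= 1.
    by apply: le_trans hL; apply: ler_wpM2r; lra.
  move=> h1; have tL : L * (t - s) <= 2^-1 by nra.
  by have := ler_wpM2r C0 tL; lra.
(* The iteration converges pointwise at a geometric rate that does not depend on [t], so no function
   space is needed. *)
pose u_ n := iter n S (fun=> w).
have g0 : good (fun=> w).
  move=> t Jt; split; last by nra.
  by move=> e e0; exists 1 => // q _ _; rewrite subrr normr0 ltW.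
have gu n : good (u_ n) by elim: n => [//|n IHn]; have [] := HS _ IHn.
have uS n t : J t -> `|u_ n.+1 t - u_ n t| <= 2 * r * 2^-1 ^+ n.
  elim: n t => [|n IHn] t Jt.
    have := (gu 1%N t Jt).2; have := (gu 0%N t Jt).2.
    have := ler_distD w0 (u_ 1%N t) (u_ 0%N t); rewrite (distrC w0) expr0; lra.
  apply: le_trans (contr _ _ _ (gu n.+1) (gu n) IHn t Jt) _.
  by rewrite exprS; lra.
have [U HU] : {U : R -> E & forall t, J t -> u_ n t @[n --> \oo] --> U t /\
    forall n, `|u_ n t - U t| <= 4 * r * 2^-1 ^+ n}.
  apply: (@choice _ _ (fun t l => J t -> u_ n t @[n --> \oo] --> l /\
    forall n, `|u_ n t - l| <= 4 * r * 2^-1 ^+ n)) => t.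
  have [Jt|] := pselect (J t); last by exists 0.
  have [l ul Hl] := geometric_cvg (fun n => uS n t Jt).
  by exists l => _; split => // n; apply: le_trans (Hl n) _; lra.
have gU : good U.
  move=> t Jt; split; last first.
    by apply: (dist_lim_le (N := 0) (HU t Jt).1) => n _; exact: (gu n t Jt).2.
  move=> e e0; have [n Hn] := half_pow_small (4 * r) (e := e / 3) ltac:(lra).
  have [d1 d10 H1] := (gu n t Jt).1 (e / 3) ltac:(lra).
  exists d1 => // q Jq qt; have := H1 q Jq qt.
  have := (HU t Jt).2 n; have := (HU q Jq).2 n.
  have := ler_distD (u_ n q) (U q) (U t); rewrite (distrC (U q) (u_ n q)).
  have := ler_distD (u_ n t) (u_ n q) (U t); lra.
have [gSU SUs dSU] := HS U gU.
have SU t : J t -> S U t = U t.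
  move=> Jt; apply/eqP; rewrite -subr_eq0; apply/eqP.
  apply: (@half_pow_eq0 _ _ _ (4 * r)) => n.
  have : `|S (u_ n) t - S U t| <= 4 * r * 2^-1 ^+ n / 2.
    by apply: contr => // q Jq; exact: (HU q Jq).2.
  have := (HU t Jt).2 n.+1; rewrite exprS -[u_ n.+1]/(S (u_ n)).
  have := ler_distD (S (u_ n) t) (S U t) (U t); rewrite (distrC (S U t) (S (u_ n) t)); lra.
exists U; first by rewrite -SU.
move=> t Jt; apply: (eq_deriv_on Jt SU).
exact: dSU.
Qed.

End LocalExistence.

Section GlobalExistence.
Context {R : realType} {E : completeNormedModType R}.
Implicit Types (u v : R -> E).
Variable G : R -> E -> E.
Hypotheses (Gc : jcont G) (GL : loc_lipschitz G).
Local Notation sol := (sol G).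

Lemma sol_glue a b c u v : a <= b -> b <= c -> u b = v b ->
  sol [set t | a <= t <= b] u -> sol [set t | b <= t <= c] v ->
  sol [set t | a <= t <= c] (fun t => if t <= b then u t else v t).
Proof.
move=> ab bc ubv su sv; pose x (t : R) := if t <= b then u t else v t.
change (sol [set t | a <= t <= c] x).
have xl (t : R) : t <= b -> x t = u t by rewrite /x => ->.
have xr (t : R) : b <= t -> x t = v t.
  rewrite /x; have [tb|//] := leP t b => bt.
  have -> : t = b by lra.
  exact: ubv.
move=> t /= /andP[a_t tc]; apply: (@deriv_on_glue _ _ a b c); first by rewrite a_t.
- have [tb|bt] := leP t b; last by right.
  left; rewrite xl //; apply: (@eq_deriv_on _ _ _ u); rewrite /= ?a_t //.
    by move=> s /= /andP[_ sb]; rewrite xl.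
  by apply: su; rewrite /= a_t.
- have [bt|tb] := leP b t; last by right.
  left; rewrite xr //; apply: (@eq_deriv_on _ _ _ v); rewrite /= ?bt //.
    by move=> s /= /andP[bs _]; rewrite xr.
  by apply: sv; rewrite /= bt.
Qed.

(** By uniqueness the solutions on nested intervals agree, so the value at [t] may be taken from any
    of them that reaches [t]. The index set will be [[a, T[] inside the induction and [[a, +oo[] at
    the end. *)
Lemma sol_paste (a : R) (w : E) (I : set R) :
  (forall b, I b -> exists2 u, u a = w & sol [set t | a <= t <= b] u) ->
  (forall b, I b -> a <= b) ->
  (forall b, I b -> exists2 c, b < c & I c) -> I a ->
  exists2 u, u a = w & forall b, I b -> sol [set t | a <= t <= b] u.
Proof.
move=> ex Ia Inext aI.
have [U HU] : {U : R -> R -> E & forall b, I b -> U b a = w /\ sol [set t | a <= t <= b] (U b)}.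
  apply: (@choice _ _ (fun b u => I b -> u a = w /\ sol [set t | a <= t <= b] u)) => b.
  have [Ib|] := pselect (I b); last by exists (fun=> w).
  by have [u] := ex b Ib; exists u.
have UU b c t : I b -> I c -> a <= t -> t <= b -> t <= c -> U b t = U c t.
  move=> Ib Ic a_t tb tc.
  have [Ub sb] := HU b Ib; have [Uc sc] := HU c Ic.
  apply: (sol_unique GL (a := a) (b := t)) => //; rewrite ?a_t ?lexx ?Ub ?Uc //.
  - exact: sol_itvW sb.
  - exact: sol_itvW sc.
have [c Hc] : {c : R -> R & forall t, (exists2 b, t <= b & I b) -> t <= c t /\ I (c t)}.
  apply: (@choice _ _ (fun t c => (exists2 b, t <= b & I b) -> t <= c /\ I c)) => t.
  have [[b tb Ib]|] := pselect (exists2 b, t <= b & I b); last by exists 0.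
  by exists b.
exists (fun t => U (c t) t).
  have [ac Ic] := Hc a ltac:(by exists a).
  by have [] := HU _ Ic.
move=> b Ib; have [_ sb] := HU b Ib.
have cE t : a <= t -> t <= b -> U (c t) t = U b t.
  move=> a_t tb; have [tc Ic] := Hc t ltac:(by exists b).
  exact: UU.
move=> t /= /andP[a_t tb]; rewrite cE //.
apply: (@eq_deriv_on _ _ _ (U b)); rewrite /= ?a_t //.
  by move=> s /= /andP[as_ s_b]; rewrite cE.
by apply: sb; rewrite /= a_t.
Qed.

(* Since the length of the interval of existence is locally uniform in the
   initial data, a solution with bounded speed cannot stop at [T]. *)
Lemma ode_global (a : R) (w : E) :
  (forall T u, a < T -> u a = w -> (forall b, b < T -> sol [set t | a <= t <= b] u) ->
     exists M : R, forall t, a <= t < T -> `|G t (u t)| <= M) ->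
  exists2 u, u a = w & forall b, sol [set t | a <= t <= b] u.
Proof.
move=> bnd.
have step b u h : 0 < h -> a <= b -> u a = w -> sol [set t | a <= t <= b] u ->
    (exists2 v, v b = u b & sol [set t | b <= t <= b + h] v) ->
    exists2 v, v a = w & sol [set t | a <= t <= b + h] v.
  move=> h0 ab ua su [v vb sv].
  exists (fun t => if t <= b then u t else v t); first by rewrite ab.
  by apply: sol_glue => //; lra.
have ex b : a <= b -> exists2 u, u a = w & sol [set t | a <= t <= b] u.
  move=> ab.
  apply: (real_induction (P := fun b => exists2 u, u a = w & sol [set t | a <= t <= b] u)
    (a := a) (b := b)); rewrite ?ab ?lexx //.
  - exists (fun=> w) => // t /=; rewrite -eq_le => /eqP <- e e0.
    exists 1 => // s /=; rewrite -eq_le => /eqP <- _.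
    by rewrite !subrr scale0r subr0 !normr0 mulr0.
  - move=> t /andP[a_t tb] /(_ t); rewrite a_t lexx => /(_ erefl)[u ua su].
    have [h h0 Hh] := picard Gc GL t (u t).
    have [|v va sv] := step t u h h0 a_t ua su.
    + by apply: Hh; rewrite subrr normr0 ltW.
    + exists h => // s /andP[ts sh] sb; exists v => //.
      by apply: sol_itvW sv => //; rewrite ltW.
  - move=> T /andP[aT Tb] Ps.
    have [b0 /= /andP[ab0 b0T]|b0 /= /andP[]//|b0 /= /andP[ab0 b0T]|/=|u ua su] :=
        @sol_paste a w [set t | a <= t < T].
    + by apply: Ps; rewrite ab0.
    + by exists ((b0 + T) / 2); rewrite /=; lra.
    + by rewrite lexx.
    have su' b1 : b1 < T -> sol [set t | a <= t <= b1] u.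
      move=> b1T; apply: (sol_itvW (a := a) (b := Num.max a b1)); rewrite ?le_max ?lexx ?orbT //.
      by apply: su; rewrite /= le_max lexx gt_max aT.
    have [M HM] := bnd T u aT ua su'.
    have M0 : 0 <= M by apply: le_trans (HM a _) => //; rewrite lexx.
    have uM s t : a <= s -> s <= t -> t < T -> `|u t - u s| <= M * (t - s).
      move=> as_ st tT; apply: deriv_on_le => // q /andP[sq qt].
      exists (G q (u q)); last by apply: HM; lra.
      by apply: (deriv_onW _ (su' t tT q _)) => [p /=|/=]; lra.
    have [l Hl] := lipschitz_left_lim aT uM.
    have [h h0 Hh] := picard Gc GL T l.
    (* At a time [s] at most [d] before [T], both [s] and [u s] are within [h] of [T] and [l]; since
       [d < h], a step [h] from there passes [T]. *)
    pose d := Num.min (h / 2) (h / (M + 1)).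
    have d0 : 0 < d by rewrite lt_min !divr_gt0 //; lra.
    have dM : d * (M + 1) <= h by rewrite -ler_pdivlMr ?ge_min ?lexx ?orbT //; lra.
    have dh : d < h by apply: le_lt_trans (_ : d <= h / 2) _; [rewrite ge_min lexx|lra].
    pose s := Num.max a (T - d).
    have sl : T - d <= s by rewrite /s le_max lexx orbT.
    have s_a : a <= s by rewrite /s le_max lexx.
    have sT : s < T by rewrite /s gt_max aT; lra.
    have [|v va sv] := step s u h h0 s_a ua (su' s sT).
    + apply: Hh; first by rewrite ltr0_norm; lra.
      by apply: le_trans (Hl s s_a sT) _; nra.
    + by exists v => //; apply: sol_itvW sv => //; lra.
have [||b0|/=|u ua su] := @sol_paste a w [set b | a <= b].
- by move=> b; exact: ex.
- by [].
- by move=> ab0; exists (b0 + 1); rewrite /= ?ltrDl //; move: ab0 => /=; lra.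
- exact: lexx.
exists u => // b; have [ab|ba] := leP a b; first exact: su.
by move=> t /= /andP[]; lra.
Qed.

End GlobalExistence.

(** * Closed graphs and contractions *)

Section ClosedGraph.
Context {R : realType} {E F : completeNormedModType R}.
Variable T : E -> F.
Hypothesis T_linear : forall (a : R) x y, T (a *: x + y) = a *: T x + T y.
Hypothesis T_closed : forall (u : nat -> E) x y, u n @[n --> \oo] --> x ->
  T (u n) @[n --> \oo] --> y -> T x = y.

Let T0 : T 0 = 0.
Proof. exact: linear_fun0 (T_linear 1 0 0). Qed.

Let TB x y : T (x - y) = T x - T y.
Proof. by rewrite addrC -scaleN1r T_linear scaleN1r addrC. Qed.

Let TZ a x : T (a *: x) = a *: T x.
Proof. by rewrite -[a *: x]addr0 T_linear T0 addr0. Qed.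

(** By Baire's theorem the closure of some set [|T y| <= n] contains a ball around a point [x0].
    Subtracting approximations of [x0 + y] and of [x0] moves the ball to the origin and doubles
    [n]. *)
Let ball_approx : exists n : nat, exists2 r : R, 0 < r & forall (y : E) (e : R), `|y| < r -> 0 < e ->
  exists2 z, `|y - z| <= e & `|T z| <= n%:R.
Proof.
pose A n := [set y | `|T y| <= n%:R].
have [n ndn] : exists n, ~ dense (~` closure (A n)).
  apply: contrapT => /forallNP H.
  have dns : dense (\bigcap_i (~` closure (A i))).
    apply: Baire => i; split; last exact: contrapT (H i).
    by apply: closed_openC; exact: closed_closure.
  have [|y [_ Hy]] := dns setT _ openT; first by exists 0.
  apply: (Hy (Num.truncn `|T y|).+1 I); apply: subset_closure.
  by rewrite /A /= ltW // truncnS_gt.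
have [V [[x0 Ox0] OA]] := denseNE ndn.
have [/= r r0 Or] : exists2 r : R, 0 < r & ball x0 r `<=` V.
  by case: Ox0 => oO x0O; apply/nbhs_ballP; apply: open_nbhs_nbhs.
have OcA : V `<=` closure (A n).
  move=> y Oy; apply: contrapT => ncl.
  by have : (V `&` ~` closure (A n)) y by []; rewrite OA.
exists (n + n)%N, r => // y e yr e0.
have cl (x : E) : `|x0 - x| < r -> exists2 a, `|T a| <= n%:R & `|x - a| < e / 2.
  move=> xr; have : closure (A n) x.
    by apply: OcA; apply: Or; rewrite -ball_normE.
  have e2 : 0 < e / 2 by rewrite divr_gt0.
  by move=> /(_ _ (nbhsx_ballx x _ e2))[a [Aa]]; rewrite -ball_normE; exists a.
have [|a Ta ya] := cl (x0 + y); first by rewrite opprD addrA subrr sub0r normrN.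
have [|b Tb yb] := cl x0; first by rewrite subrr normr0.
exists (a - b); last by rewrite TB natrD; apply: le_trans (ler_normB _ _) _; exact: lerD.
rewrite (_ : y - (a - b) = (x0 + y - a) - (x0 - b)); last by module R.
by apply: le_trans (ler_normB _ _) _; lra.
Qed.

(** Approximating [y], then the remainder, and so on, writes [y] as a series whose images are
    summable; closedness identifies the sum of the images with [T y]. *)
Lemma closed_graph : exists2 M : R, 0 <= M & forall y, `|T y| <= M * `|y|.
Proof.
have [n [r r0 H]] := ball_approx.
(* Scaling by [r / (2 * |y|)] brings [y] to norm [r / 2]; an approximation there with error [r / 4]
   scales back to an error [|y| / 2] and an image of norm at most [C * |y|]. *)
pose C := n%:R * 2 / r.
have C0 : 0 <= C by rewrite /C divr_ge0 ?mulr_ge0 // ltW.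
have [S HS] : {S : E -> E & forall y, `|y - S y| <= `|y| / 2 /\ `|T (S y)| <= C * `|y|}.
  apply: (@choice _ _ (fun y z => `|y - z| <= `|y| / 2 /\ `|T z| <= C * `|y|)) => y.
  have [->|y0] := eqVneq y 0.
    by exists 0; rewrite T0 subrr !normr0 mulr0 mul0r.
  have ny : 0 < `|y| by rewrite normr_gt0.
  pose k := r / (2 * `|y|).
  have k0 : 0 < k by rewrite divr_gt0 // mulr_gt0.
  have ky : k * `|y| = r / 2 by rewrite /k; field; rewrite gt_eqF.
  have [||z Hz Tz] := H (k *: y) (r / 4).
  - by rewrite normrZ gtr0_norm // ky; lra.
  - by rewrite divr_gt0.
  exists (k^-1 *: z); split.
    rewrite (_ : y - _ = k^-1 *: (k *: y - z)); last first.
      by rewrite scalerBr scalerK // gt_eqF.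
    rewrite normrZ gtr0_norm ?invr_gt0 //.
    rewrite mulrC ler_pdivrMr //; apply: le_trans Hz _.
    by rewrite mulrAC [`|y| * k]mulrC ky; lra.
  rewrite TZ normrZ gtr0_norm ?invr_gt0 // mulrC ler_pdivrMr //.
  apply: le_trans Tz _; rewrite -mulrA [`|y| * k]mulrC ky /C.
  by rewrite le_eqVlt; apply/orP; left; apply/eqP; field; rewrite gt_eqF.
exists (2 * C); first by rewrite mulr_ge0.
move=> y.
pose f x := x - S x.
pose rr k := iter k f y.
have rk k : `|rr k| <= `|y| * 2^-1 ^+ k.
  elim: k => [|k IHk]; first by rewrite expr0 mulr1.
  apply: le_trans (HS (rr k)).1 _; rewrite exprSr mulrA.
  by apply: ler_wpM2r => //; rewrite invr_ge0.
have [k|x ux Hx] := @geometric_cvg _ _ (fun k => T (y - rr k)) (C * `|y|).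
  rewrite -TB (_ : _ - _ - (y - rr k) = S (rr k)); last first.
    by rewrite -[rr k.+1]/(rr k - S (rr k)); module R.
  by apply: le_trans (HS (rr k)).2 _; rewrite -(mulrA C); apply: ler_wpM2l => //; exact: rk.
have -> : T y = x.
  apply: T_closed ux; rewrite -[X in _ --> X]subr0; apply: cvgB; first exact: cvg_cst.
  apply/cvgr0Pnorm_le => e e0; have [N HN] := half_pow_small `|y| e0.
  exists N => // k /= Nk; apply: le_trans (rk k) _; apply: le_trans HN.
  by apply: ler_wpM2l => //; apply: ler_wiXn2l => //; lra.
have := Hx 0%N; rewrite subrr T0 sub0r normrN expr0; lra.
Qed.

End ClosedGraph.

Section FixedPoint.
Context {R : realType} {E : completeNormedModType R}.

(** The condition on [Phi z0] makes the ball invariant, because [k * r + (1 - k) * r = r]. The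
    closed set [Z] will be [D20], which is a set of vectors of [X] and not a space of its own. *)
Lemma fixed_point_ball (Z : set E) (z0 : E) (r k : R) (Phi : E -> E) :
  closed Z -> Z z0 -> 0 <= r -> 0 <= k -> k < 1 ->
  (forall z, Z z -> `|z - z0| <= r -> Z (Phi z)) ->
  (forall y z, Z y -> Z z -> `|y - z0| <= r -> `|z - z0| <= r ->
     `|Phi y - Phi z| <= k * `|y - z|) ->
  `|Phi z0 - z0| <= (1 - k) * r ->
  exists z, [/\ Z z, `|z - z0| <= r & Phi z = z].
Proof.
move=> cZ Zz0 r0 k0 k1 ZPhi contr Phi0.
pose B := Z `&` closed_ball_ Num.norm z0 r.
have BE z : B z = (Z z /\ `|z - z0| <= r) :> Prop.
  by rewrite /B /closed_ball_ /setI /= distrC.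
have fB : set_fun B B Phi.
  move=> z; rewrite !BE => -[Zz zr]; split; first exact: ZPhi.
  have := contr z z0 Zz Zz0 zr ltac:(by rewrite subrr normr0).
  have := ler_distD (Phi z0) (Phi z) z0; nra.
pose f : {fun B >-> B} := mkfun fB.
have [|||p Bp pE] := @banach_fixed_point R E B f.
- exists (NngNum k0); split=> //= -[y z] /= [].
  rewrite !BE => -[Zy yr] [Zz zr]; exact: contr.
- apply: closedI => //; exact: closed_closed_ball_.
- by exists z0; rewrite BE subrr normr0.
by move: Bp; rewrite BE => -[Zp pr]; exists p.
Qed.

End FixedPoint.

(** * Osgood's comparison lemma *)

Section LevelSets.
Context d (T : measurableType d) (R : realType) (mu : {measure set T -> \bar R}).
Local Open Scope ereal_scope.

Definition level (D : set T) (f : T -> R) (k : nat) : set T :=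
  D `&` f @^-1` `[k%:R, k.+1%:R[%classic.

(** On the level [k] one has [k + 1 <= f + 1], and the integral of [f + 1] is finite because [mu D]
    is. *)
Lemma level_sum_lty (D : set T) (f : T -> R) : measurable D -> mu D < +oo ->
  (forall x, D x -> (0 <= f x)%R) -> mu.-integrable D (EFin \o f) ->
  \sum_(0 <= k <oo) (k.+1%:R%:E * mu (level D f k)) < +oo.
Proof.
move=> mD muD f0 intf.
have mf : measurable_fun D f by apply/measurable_EFinP; exact: measurable_int intf.
have mE k : measurable (level D f k) by apply: mf => //; exact: measurable_itv.
have DE : \bigcup_k level D f k = D.
  apply/seteqP; split=> [x [k _ []//]|x Dx].
  exists (Num.truncn (f x)) => //; split=> //=.
  by rewrite in_itv /= truncn_itv // f0.
have tE : trivIset setT (level D f).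
  apply/trivIsetP => i j _ _ ij; rewrite -subset0 => x [[_ +] [_ +]] /=.
  rewrite /preimage /= !in_itv /= => /andP[h1 h2] /andP[h3 h4].
  have := le_lt_trans h1 h4; have := le_lt_trans h3 h2.
  rewrite !ltr_nat !ltnS => ji ij'; move: ij; have -> : i = j; last by rewrite eqxx.
  by apply/eqP; rewrite eqn_leq ij' ji.
pose g (x : T) : \bar R := (f x)%:E + (cst 1%R x)%:E.
have intf1 : mu.-integrable D g.
  apply: integrableD => //; apply: measurable_bounded_integrable => //.
  by exists 1%R; split=> // x x1 y _ /=; rewrite normr1 ltW.
have mf1 := measurable_int _ intf1.
have := integrable_lty mD intf1.
apply: le_lt_trans.
rewrite -{2}DE ge0_integral_bigcup ?DE //; last first.
  by move=> x Dx; rewrite adde_ge0 ?lee_fin ?ler01 //; exact: f0.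
apply: lee_nneseries => [k _ _|k _]; first by rewrite mule_ge0 ?lee_fin.
rewrite -integral_cst //; apply: ge0_le_integral => //.
- by move=> x _; rewrite lee_fin.
- by apply: measurable_funS mf1 => // x [].
- by move=> x [_] /=; rewrite in_itv /= => /andP[kf _]; rewrite /g /cst -EFinD lee_fin -natr1 lerD2r.
Qed.

End LevelSets.

Section IntegrableMajorant.
Context {R : realType}.
Local Notation cmu := (@completed_lebesgue_measure R).
Local Notation mu := (@lebesgue_measure R).

(* A Vitali-Caratheodory majorant: [phi] is the primitive of the function
   [sum_k (k + 1) 1_(V k)], with [V k] an open set which contains
   [k <= psi < k + 1] and has almost the same measure. *)
Lemma integrable_majorant (psi : R -> R) (a b : R) : a <= b ->
  (forall t, a <= t <= b -> 0 <= psi t) ->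
  cmu.-integrable `[a, b] (EFin \o psi) ->
  exists phi : R -> R,
    (forall s t, a <= s -> s <= t -> t <= b -> phi s <= phi t) /\
    forall t, a <= t < b -> exists2 d : R, 0 < d & forall s : R,
      t < s < t + d -> s <= b -> psi t * (s - t) <= phi s - phi t.
Proof.
move=> ab psi0 ipsi.
pose E k : set R := level `[a, b]%classic psi k.
have sumE : (\sum_(0 <= k <oo) (k.+1%:R%:E * cmu (E k)) < +oo)%E.
  apply: (@level_sum_lty _ _ _ cmu) => //.
  - by apply: sub_caratheodory; exact: measurable_itv.
  - change (mu `[a, b]%classic < +oo)%E.
    by rewrite lebesgue_measure_itv /=; case: ifP => _; rewrite ?ltry // -EFinB ltry.
(* The errors weighted by [k + 1] sum to 1, so replacing all [E k] by [V k] costs at most 1. *)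
pose e (k : nat) : R := ((2 ^ k.+1)%:R)^-1 / k.+1%:R.
have e0 k : 0 < e k by rewrite divr_gt0 // invr_gt0 ltr0n expn_gt0.
have [V HV] : {V : nat -> set R & forall k, [/\ open (V k), E k `<=` V k &
    (mu (V k) <= cmu (E k) + (e k)%:E)%E]}.
  apply: (@choice _ _ (fun k V => [/\ open V, E k `<=` V &
    (mu V <= cmu (E k) + (e k)%:E)%E])) => k.
  exact: outer_measure_open_le (e0 k).
have mV k : measurable (V k) by have [oV _ _] := HV k; exact: open_measurable.
pose c (t : R) (k : nat) : \bar R := (k.+1%:R%:E * mu (V k `&` `[a, t]))%E.
have mVt k t : measurable (V k `&` `[a, t]).
  by apply: measurableI => //; exact: measurable_itv.
have c0 t k : (0 <= c t k)%E by rewrite mule_ge0 // lee_fin.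
pose S t := (\sum_(0 <= k <oo) c t k)%E.
have cmono s t k : s <= t -> (c s k <= c t k)%E.
  move=> st; apply: lee_wpmul2l; first by rewrite lee_fin.
  apply: le_measure; [by rewrite inE; exact: mVt|by rewrite inE; exact: mVt|].
  apply: setIS => x /=.
  by rewrite !in_itv /= => /andP[-> /le_trans->].
have Smono s t : s <= t -> (S s <= S t)%E.
  by move=> st; apply: lee_nneseries => [k _ _|k _]; [exact: c0|exact: cmono].
have Sfin t : S t \is a fin_num.
  rewrite ge0_fin_numE; last by apply: nneseries_ge0 => k _ _; exact: c0.
  have : (\sum_(0 <= k <oo) (k.+1%:R%:E * cmu (E k)) + 1%:E < +oo)%E by rewrite lte_add_pinfty ?ltry.
  apply: le_lt_trans; apply: le_trans (epsilon_trick _ _ ler01).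
    apply: lee_nneseries => [k _ _|k _]; first exact: c0.
    have [_ _ VE] := HV k; rewrite /c.
    apply: le_trans (_ : _ <= k.+1%:R%:E * (cmu (E k) + (e k)%:E))%E _.
      apply: lee_wpmul2l; first by rewrite lee_fin.
      by apply: le_trans VE; apply: le_measure; [by rewrite inE; exact: mVt|by rewrite inE; exact: mV|exact: subIsetl].
    rewrite ge0_muleDr ?lee_fin ?(ltW (e0 k)) //.
    rewrite leeD2l // -EFinM lee_fin /e mul1r mulrC divfK // pnatr_eq0 //.
  by move=> k; rewrite mule_ge0 // ?lee_fin // outer_measure_ge0.
exists (fun t => fine (S t)); split.
  by move=> s t _ st _; apply: fine_le => //; exact: Smono.
move=> t /andP[at_ tb].
pose k := Num.truncn (psi t).
have atb : a <= t <= b by rewrite at_ ltW.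
have Et : E k t.
  by split; rewrite /= in_itv //= truncn_itv // psi0.
have [oV EV _] := HV k.
have /nbhs_ballP[d /= d0 Hd] : nbhs t (V k).
  by apply: open_nbhs_nbhs; split => //; exact: EV.
exists d => // s /andP[ts sd] sb.
have tsV x : t < x <= s -> V k x.
  by move=> /andP[tx xs]; apply: Hd; rewrite -ball_normE /= ltr0_norm; lra.
(* The interval []t, s]] lies in the open set [V k] and adds its length with weight [k + 1 > psi t];
   the other terms of the series can only grow. *)
have ck : (c t k + (k.+1%:R * (s - t))%:E <= c s k)%E.
  rewrite /c EFinM -ge0_muleDr ?lee_fin ?subr_ge0 ?(ltW ts) //.
  apply: lee_wpmul2l; first by rewrite lee_fin.
  have -> : (s - t)%:E = mu `]t, s]%classic.
    by rewrite lebesgue_measure_itv /= lte_fin ts EFinB.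
  rewrite -measureU; [|exact: mVt|exact: measurable_itv|]; last first.
    by rewrite -subset0 => x [[_] /=]; rewrite !in_itv /=; lra.
  apply: le_measure; [|by rewrite inE; exact: mVt|].
    by rewrite inE; apply: measurableU; [exact: mVt|exact: measurable_itv].
  move=> x [[Vx]|] /=; rewrite !in_itv /= => /andP[h1 h2]; split=> //.
  - lra.
  - by apply: tsV; rewrite h1.
  - lra.
have SS : (S t + (k.+1%:R * (s - t))%:E <= S s)%E.
  rewrite /S (nneseriesD1 (n := k)) // [leRHS](nneseriesD1 (n := k)) //.
  rewrite addeAC; apply: leeD => //; apply: lee_nneseries => // j _.
  by apply: cmono; exact: ltW.
have : fine (S t) + k.+1%:R * (s - t) <= fine (S s).
  by rewrite -lee_fin EFinD !fineK.
have : psi t < k.+1%:R by have /andP[] := truncn_itv (psi0 t atb).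
have : 0 < s - t by lra.
nra.
Qed.

End IntegrableMajorant.

Lemma clamp_le {R : realType} (s t : R) : `|Num.max s 0 - Num.max t 0| <= `|s - t|.
Proof.
have h1 := ler_norm (s - t); have h2 := ler_norm (t - s); rewrite distrC in h2.
have h3 := normr_ge0 (s - t).
by rewrite ler_norml; case: (leP s 0) => s0; case: (leP t 0) => t0; apply/andP; split; lra.
Qed.

Section ContOn.
Context {R : realType}.

Lemma within_continuous_cont_on (E : completeNormedModType R) (A : set R) (u : R -> E) (t : R) :
  {within A, continuous u} -> A t -> cont_on A u t.
Proof.
move=> /subspace_continuousP cu At e e0.
have /cvgrPdist_le /(_ e e0) := cu t At.
rewrite near_withinE => /nbhs_ballP[d d0 Hd]; exists d => // s As st.
by rewrite distrC; apply: Hd => //; rewrite -ball_normE /= distrC.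
Qed.

End ContOn.

Section Osgood.
Context {R : realType}.
Local Notation mu := (@lebesgue_measure R).
Variables (U : R -> R).
Hypotheses (U_cont : {within [set u : R | 0 <= u], continuous U})
  (U_ge0 : forall u : R, 0 <= u -> 0 <= U u)
  (U_div : tail_integral_inv_diverges U).

(** Constant extension of [U] to the left of [0], which is continuous on the whole line. *)
Let W (x : R) := U (Num.max x 0).

Let W_ge0 x : 0 <= W x.
Proof. by apply: U_ge0; rewrite le_max lexx orbT. Qed.

Let WE (x : R) : 0 <= x -> W x = U x.
Proof. by rewrite /W => x0; rewrite (max_idPl x0). Qed.

Let W_cont : continuous W.
Proof.
move=> x; apply/cvgrPdist_le => e e0.
have m0 (y : R) : [set u : R | 0 <= u] (Num.max y 0) by rewrite /= le_max lexx orbT.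
have [d d0 Hd] := within_continuous_cont_on (E := R^o) U_cont (m0 x) e0.
apply/nbhs_ballP; exists d => [//|y /= yx].
rewrite distrC; apply: Hd => //; apply: le_lt_trans (clamp_le _ _) _; rewrite distrC.
exact: yx.
Qed.

Let h e (x : R) := (W x + e)^-1.

Let h_gt0 (e x : R) : 0 < e -> 0 < h e x.
Proof. by move=> e0; rewrite invr_gt0; have := W_ge0 x; lra. Qed.

Let h_le (e x : R) : 0 < e -> h e x <= e^-1.
Proof. by move=> e0; rewrite lef_pV2 ?posrE //; have := W_ge0 x; lra. Qed.

Let h_cont (e : R) : 0 < e -> continuous (h e).
Proof.
move=> e0 x; apply: cvgV; first by rewrite gt_eqF //; have := W_ge0 x; lra.
by apply: cvgD; [exact: W_cont|exact: cvg_cst].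
Qed.

(** The functions [1 / (U + 1 / (n + 1))], cut off at [u0 + n], increase to [1 / U], with limit
    [+oo] at the zeros of [U]. By monotone convergence their integrals tend to [+oo]. *)
Let inverse_integral_large (u0 C : R) : 0 < u0 -> exists n : nat,
  (C%:E < \int[mu]_(x in `[u0, (u0 + n%:R)%R]) (h n.+1%:R^-1 x)%:E)%E.
Proof.
move=> u00; apply: contrapT => /forallNP Hn.
pose D : set R := `[u0, +oo[%classic.
pose g n (x : R) : \bar R :=
  if (x <= u0 + n%:R)%R then (h n.+1%:R^-1 x)%:E else 0%E.
have mD : measurable D by exact: measurable_itv.
have mg n : measurable_fun D (g n).
  apply: measurable_funTS; apply: measurable_fun_ifT => //.
  - by apply: measurable_fun_ler.
  - apply/measurable_EFinP; apply: continuous_measurable_fun.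
    by apply: h_cont; rewrite invr_gt0.
have g0 n x : D x -> (0 <= g n x)%E.
  by move=> _; rewrite /g; case: ifP => // _; rewrite lee_fin ltW // h_gt0 ?invr_gt0.
have gnd x : D x -> {homo g^~ x : n m / (n <= m)%N >-> (n <= m)%E}.
  move=> Dx n m nm; rewrite /g; case: ifP => xn; last by exact: g0.
  have -> : x <= u0 + m%:R by apply: le_trans xn _; rewrite lerD2l ler_nat.
  have nm1 : m.+1%:R^-1 <= n.+1%:R^-1 :> R by rewrite lef_pV2 ?posrE // ler_nat.
  have m1 : 0 < m.+1%:R^-1 :> R by rewrite invr_gt0.
  have Wx := W_ge0 x; have n1 := lt_le_trans m1 nm1.
  by rewrite lee_fin /h lef_pV2 ?lerD2l // posrE ltr_wpDl.
have glim x : D x -> g n x @[n --> \oo] --> ((U x)%:E^-1)%E.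
  rewrite /D /= in_itv /= andbT => ux.
  have x0 : 0 <= x by lra.
  have geq : \forall n \near \oo, (h n.+1%:R^-1 x)%:E = g n x.
    exists (Num.truncn (x - u0)).+1 => // n /= xn.
    have : x - u0 < n%:R by apply: lt_le_trans (truncnS_gt _) _; rewrite ler_nat.
    by rewrite /g => xn'; have -> : x <= u0 + n%:R by lra.
  apply: cvg_trans (near_eq_cvg geq) _.
  have [Ux|Ux] := eqVneq (U x) 0.
    rewrite Ux /inve eqxx; apply/cvgeyPge => A.
    exists (Num.truncn A).+1 => // n /= An.
    rewrite lee_fin /h WE // Ux add0r invrK ltW //.
    by apply: lt_le_trans (truncnS_gt _) _; rewrite ler_nat; exact: leqW.
  rewrite /inve (negbTE Ux); apply: cvg_EFin; first exact: nearW.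
  rewrite [X in X @ _ --> _](_ : _ = (fun n : nat => (U x + n.+1%:R^-1)^-1)); last first.
    by apply/funext => n /=; rewrite /h WE.
  apply: cvgV => //.
  by rewrite -[X in _ --> X]addr0; apply: cvgD; [exact: cvg_cst|exact: cvg_harmonic].
have := @cvg_monotone_convergence _ _ _ mu D mD g mg g0 gnd.
have -> : (\int[mu]_(x in D) limn (g^~ x) = +oo)%E.
  rewrite -(U_div u00); apply: eq_integral => x /set_mem Dx.
  by apply/cvg_lim => //; exact: glim.
move=> /cvgeyPge /(_ (C + 1)) [n _ /(_ n (leqnn n))] /=.
have -> : (\int[mu]_(x in D) g n x =
    \int[mu]_(x in `[u0, (u0 + n%:R)%R]) (h n.+1%:R^-1 x)%:E)%E.
  rewrite (_ : `[u0, (u0 + n%:R)%R]%classic = D `&` `[u0, (u0 + n%:R)%R]%classic); last first.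
    apply/seteqP; split=> x; rewrite /D /= !in_itv /= andbT; last by case.
    by move=> ux; split=> //; case/andP: ux.
  rewrite integral_mkcondr; apply: eq_integral => x /set_mem.
  rewrite /D /= in_itv /= andbT => ux; rewrite /g /patch; case: ifPn => xn.
    by rewrite mem_set //= in_itv /= ux.
  by rewrite memNset //= in_itv /= ux /= => xn'; rewrite xn' in xn.
move=> Cn; apply: (Hn n); apply: lt_le_trans Cn; rewrite lte_fin; lra.
Qed.

Let h_int (e a b : R) : 0 < e -> mu.-integrable `[a, b] (EFin \o h e).
Proof.
move=> e0; apply: continuous_compact_integrable; first exact: segment_compact.
by apply: continuous_subspaceT; exact: h_cont.
Qed.

(* [H] is the primitive of [1 / (U + e)]: the regularization by [e] allows
   zeros of [U]. *)
Lemma osgood_potential (u0 C : R) : 0 < u0 -> exists (H : R -> R) (e u1 : R),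
  [/\ 0 < e, u0 <= u1, C < H u1 - H u0,
    forall s t : R, 0 <= s -> s <= t -> 0 <= H t - H s <= e^-1 * (t - s)
  & forall u : R, 0 <= u -> forall e1 : R, 0 < e1 -> exists2 d : R, 0 < d &
      forall s : R, u <= s -> s < u + d ->
      H s - H u <= ((U u + e)^-1 + e1) * (s - u)].
Proof.
move=> u00; have [n Hn] := inverse_integral_large C u00.
pose e : R := n.+1%:R^-1; have e0 : 0 < e by rewrite invr_gt0.
pose H (u : R) := (\int[mu]_(x in `[0%R, u]) h e x)%R.
have HB (s t : R) : 0 <= s -> s <= t -> H t - H s = (\int[mu]_(x in `]s, t]) h e x)%R.
  by move=> s0 st; apply: Rintegral_itvB; rewrite ?bnd_simp //; exact: h_int.
have io (s t : R) : mu.-integrable `]s, t] (EFin \o h e).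
  apply: integrableS (h_int s t e0); [exact: measurable_itv|exact: measurable_itv|].
  by move=> x /=; rewrite !in_itv /= => /andP[/ltW -> ->].
have Hge (s t : R) : 0 <= s -> s <= t -> 0 <= H t - H s.
  by move=> s0 st; rewrite HB //; apply: Rintegral_ge0 => x _; exact/ltW/h_gt0.
have Hle (s t k : R) : 0 <= s -> s <= t -> (forall x, s < x <= t -> h e x <= k) ->
    H t - H s <= k * (t - s).
  move=> s0 st hk; rewrite HB //.
  have -> : k * (t - s) = (\int[mu]_(x in `]s, t]) (cst k x))%R.
    rewrite Rintegral_cst; last exact: measurable_itv.
    change (k * (t - s) = k * fine (lebesgue_measure `]s, t]%classic)).
    rewrite lebesgue_measure_itv /= lte_fin; case: ltP => [_ //|ts].
    have -> : t = s by apply/eqP; rewrite eq_le ts st.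
    by rewrite subrr.
  apply: le_Rintegral => //.
  - apply: integrableS (_ : mu.-integrable `[s, t] _); [exact: measurable_itv|exact: measurable_itv| |].
      by move=> x /=; rewrite !in_itv /= => /andP[/ltW -> ->].
    apply: continuous_compact_integrable; first exact: segment_compact.
    by apply: continuous_subspaceT => x; exact: cvg_cst.
exists H, e, (u0 + n%:R); split=> //.
- by rewrite lerDl.
- rewrite HB ?lerDl // 1?ltW // Rintegral_itv_obnd_cbnd; last exact: io.
  by rewrite -lte_fin fineK //; apply: integrable_fin_num; [exact: measurable_itv|exact: h_int].
- move=> s t s0 st; rewrite Hge //=; apply: Hle => // x _; exact: h_le.
move=> u u_ge0 e1 e10; have := h_cont e0 (x := u) => /cvgrPdist_le /(_ e1 e10).
move=> /nbhs_ballP[d /= d0 Hd]; exists d => // s us sd; apply: Hle => // x /andP[ux xs].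
have := Hd x ltac:(rewrite -ball_normE /= ltr0_norm; lra); rewrite distrC => /(le_trans (ler_norm _)).
rewrite {2}/h WE //; lra.
Qed.

End Osgood.

Section Comparison.
Context {R : realType}.
Variables (U psi : R -> R).
Hypotheses (U_cont : {within [set u : R | 0 <= u], continuous U})
  (U_ge0 : forall u : R, 0 <= u -> 0 <= U u)
  (U_div : tail_integral_inv_diverges U)
  (psi_ge0 : forall t : R, 0 <= t -> 0 <= psi t)
  (psi_int : integrable_on_finite_intervals psi).

(** With [H] a primitive of [1 / (U + e)], the function [H (v t)] has upper right derivative at most
    [psi], so it grows by at most [phi T - phi a]. The level [u1] is placed so high that reaching it
    would cost more. *)
Lemma dini_bound (a T : R) (v : R -> R) : 0 <= a -> a < T ->
  (forall t, a <= t < T -> 0 <= v t) ->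
  (forall t, a <= t < T -> forall e : R, 0 < e -> exists2 d : R, 0 < d &
     forall s : R, a <= s < T -> `|s - t| < d -> `|v s - v t| <= e) ->
  (forall t, a <= t < T -> forall e : R, 0 < e -> exists2 d : R, 0 < d &
     forall s : R, t < s < t + d -> s < T ->
     v s <= v t + (U (v t) * psi t + e) * (s - t)) ->
  exists C : R, forall t, a <= t < T -> v t <= C.
Proof.
move=> a0 aT v0 vc vD.
have [phi [phimono Hphi]] : exists phi : R -> R,
    (forall s t, a <= s -> s <= t -> t <= T -> phi s <= phi t) /\
    forall t, a <= t < T -> exists2 d : R, 0 < d & forall s : R,
      t < s < t + d -> s <= T -> psi t * (s - t) <= phi s - phi t.
  apply: integrable_majorant; first exact: ltW.
    by move=> t /andP[a_t _]; apply: psi_ge0; lra.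
  by apply: psi_int; rewrite a0 ltW.
have va0 : 0 <= v a by apply: v0; rewrite lexx.
(* The base point has to be positive, hence [v a + 1]; monotonicity of [H] absorbs the shift. *)
have [H [e [u1 [e0 u01 Hu1 HL HD]]]] :=
  osgood_potential U_cont U_ge0 U_div (phi T - phi a) (u0 := v a + 1) ltac:(lra).
exists u1 => t /andP[a_t tT]; rewrite leNgt; apply/negP => vt.
have ei : 0 < e^-1 by rewrite invr_gt0.
have Hmono (p q : R) : 0 <= p -> p <= q -> H p <= H q.
  by move=> p0 pq; have /andP[] := HL p q p0 pq; lra.
have vp (r : R) : a <= r <= t -> 0 <= v r by move=> /andP[ar rt]; apply: v0; lra.
suff : H (v t) - H (v a) <= phi t - phi a.
  have := phimono t T a_t (ltW tT) (lexx _).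
  have := Hmono (v a) (v a + 1) va0 ltac:(lra).
  have := Hmono u1 (v t) ltac:(lra) (ltW vt); lra.
apply: (increment_le (rho := fun s r => H (v r) - H (v s))) => //.
- by rewrite subrr.
- by move=> p q r _ _ _ _; lra.
- by move=> p q ap pq qt; apply: phimono => //; lra.
- move=> r /andP[ar rt] eta eta0.
  have vr0 := vp r ltac:(lra).
  have Ur := U_ge0 vr0.
  have pr := psi_ge0 (t := r) ltac:(lra).
  have UP := mulr_ge0 Ur pr.
  (* The product of the slopes [(U + e)^-1 + e2] and [U * psi + e1] must stay below [psi + eta]:
     [e1 / e] and [e2 * K] contribute [eta / 2] each. *)
  pose e1 := e * eta / 2.
  have e10 : 0 < e1 by rewrite /e1 divr_gt0 // mulr_gt0.
  pose K := U (v r) * psi r + e1.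
  have K0 : 0 < K by rewrite /K; lra.
  pose e2 := eta / (2 * K).
  have e20 : 0 < e2 by rewrite divr_gt0 // mulr_gt0.
  have [d1 d10 H1] := HD (v r) vr0 e2 e20.
  have [d2 d20 H2] := vD r ltac:(lra) e1 e10.
  have [d3 d30 H3] := Hphi r ltac:(lra).
  pose d := Num.min (Num.min d2 d3) (d1 / K).
  have d0 : 0 < d by rewrite !lt_min d20 d30 divr_gt0.
  have [dd2 dd3 dK] : [/\ d <= d2, d <= d3 & d * K <= d1].
    split; [by rewrite /d !ge_min lexx|by rewrite /d !ge_min lexx !orbT|].
    by rewrite -ler_pdivlMr // /d ge_min lexx orbT.
  exists d => // s /andP[rs sd] st.
  have sr0 : 0 < s - r by lra.
  have h2 := H2 s ltac:(lra) ltac:(lra).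
  have h3 := H3 s ltac:(lra) ltac:(lra).
  have vs0 := vp s ltac:(lra).
  have Ksr : 0 <= K * (s - r) by rewrite mulr_ge0 // ltW.
  have h4 : H (v s) <= H (v r + K * (s - r)) by apply: Hmono => //; rewrite /K; lra.
  have h5 := H1 (v r + K * (s - r)) ltac:(lra) ltac:(nra).
  have h6 : ((U (v r) + e)^-1 + e2) * K <= psi r + eta.
    have e2K : e2 * K = eta / 2 by rewrite /e2; field; rewrite gt_eqF.
    have Ue : 0 < U (v r) + e by lra.
    have : (U (v r) + e)^-1 * K <= psi r + eta / 2.
      rewrite mulrC ler_pdivrMr // /K /e1.
      have := mulr_ge0 pr (ltW e0); have := mulr_ge0 Ur (ltW eta0); nra.
    by rewrite mulrDl e2K; lra.
  have := ler_wpM2r (ltW sr0) h6; nra.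
- move=> r /andP[ar rt] eta eta0.
  have [d d0 Hd] := vc r ltac:(lra) (e * eta) (mulr_gt0 e0 eta0).
  exists d => // s /andP[sd sr] as_.
  have := Hd s ltac:(lra) ltac:(rewrite ltr0_norm; lra).
  rewrite distrC => /(le_trans (ler_norm _)) h.
  have vs0 := vp s ltac:(lra); have vr0 := vp r ltac:(lra).
  have [vsr|vrs] := leP (v s) (v r); last by have := Hmono _ _ vr0 (ltW vrs); lra.
  have /andP[_] := HL _ _ vs0 vsr; move/le_trans; apply.
  by rewrite mulrC ler_pdivrMr // mulrC.
Qed.

End Comparison.

(** * Restriction of scalars *)

Section Scalars.
Context {R : realType} {c : bool}.
Local Notation K := (scal R c).

Lemma ofR0 : ofR c 0 = 0 :> K. Proof. by case: c. Qed.
Lemma ofR1 : ofR c 1 = 1 :> K. Proof. by case: c. Qed.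
Lemma ofRD (a b : R) : ofR c (a + b) = ofR c a + ofR c b.
Proof. by case: c => //=; rewrite -raddfD. Qed.
Lemma ofRN (a : R) : ofR c (- a) = - ofR c a.
Proof. by case: c => //=; rewrite -raddfN. Qed.
Lemma ofRM (a b : R) : ofR c (a * b) = ofR c a * ofR c b.
Proof. by case: c => //=; rewrite -rmorphM. Qed.
Lemma ofRK (a : R) : toR (ofR c a) = a.
Proof. by case: c. Qed.
Lemma ofR_lt (a b : R) : (ofR c a < ofR c b) = (a < b).
Proof. by case: c => //=; rewrite ltcR. Qed.
Lemma ofR_le (a b : R) : (ofR c a <= ofR c b) = (a <= b).
Proof. by case: c => //=; rewrite lecR. Qed.
Lemma ofR_norm (a : R) : `|ofR c a| = ofR c `|a|.
Proof. by case: c => //=; rewrite normc_def /= expr0n /= addr0 sqrtr_sqr. Qed.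
Lemma toRK (z : K) : 0 <= z -> ofR c (toR z) = z.
Proof. by case: c z => //= -[x y]; rewrite lecE /= => /andP[/eqP -> _]. Qed.

Variable E : normedModType K.

Lemma nrmE (x : E) : ofR c (nrm x) = `|x|.
Proof. by rewrite /nrm toRK. Qed.

Lemma nrm_lt (x : E) (e : R) : (nrm x < e) = (`|x| < ofR c e).
Proof. by rewrite -ofR_lt nrmE. Qed.

Lemma nrmD (x y : E) : nrm (x + y) <= nrm x + nrm y.
Proof. by rewrite -ofR_le ofRD !nrmE ler_normD. Qed.

Lemma nrmZ (a : R) (x : E) : nrm (ofR c a *: x) = `|a| * nrm x.
Proof. by rewrite -[RHS]ofRK ofRM -ofR_norm nrmE -normrZ. Qed.

Lemma nrmZK (a : K) (x : E) : nrm (a *: x) = toR `|a| * nrm x.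
Proof. by rewrite -[RHS]ofRK ofRM toRK // nrmE -normrZ. Qed.

Lemma nrm_eq0 (x : E) : nrm x = 0 -> x = 0.
Proof. by move=> /(congr1 (ofR c)); rewrite nrmE ofR0 => /normr0_eq0. Qed.

Lemma nbhs_nrmP (x : E) (A : set E) : nbhs x A <->
  exists2 d : R, 0 < d & forall y, nrm (y - x) < d -> A y.
Proof.
split=> [/nbhs_ballP[e /= e0 He]|[d d0 Hd]].
  have eE : ofR c (toR e) = e by rewrite toRK // ltW.
  exists (toR e); first by rewrite -ofR_lt eE ofR0.
  by move=> y; rewrite nrm_lt eE => yx; apply: He; rewrite -ball_normE /= distrC.
apply/nbhs_ballP; exists (ofR c d); first by rewrite /= -ofR0 ofR_lt.
by move=> y; rewrite -ball_normE /= distrC -nrm_lt; exact: Hd.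
Qed.

End Scalars.

Section Realification.
Context {R : realType} {c : bool}.

(* [V] with scalars restricted to [R] and the [R]-valued norm [nrm]. *)
Definition rl (V : Type) : Type := V.

Variable V : normedModType (scal R c).

HB.instance Definition _ := GRing.Zmodule.copy (rl V) V.

Definition rl_scale (a : R) (x : rl V) : rl V := ofR c a *: (x : V).

Fact rl_scaleA a b x : rl_scale a (rl_scale b x) = rl_scale (a * b) x.
Proof. by rewrite /rl_scale scalerA ofRM. Qed.
Fact rl_scale1 : left_id 1 rl_scale.
Proof. by move=> x; rewrite /rl_scale ofR1 scale1r. Qed.
Fact rl_scaleDr : right_distributive rl_scale +%R.
Proof. by move=> a x y; rewrite /rl_scale scalerDr. Qed.
Fact rl_scaleDl x : {morph rl_scale^~ x : a b / a + b}.
Proof. by move=> a b; rewrite /rl_scale ofRD scalerDl. Qed.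

HB.instance Definition _ := GRing.Zmodule_isLmodule.Build R (rl V)
  rl_scaleA rl_scale1 rl_scaleDr rl_scaleDl.

HB.instance Definition _ := Lmodule_isNormed.Build R (rl V)
  (@nrmD R c V) (@nrmZ R c V) (@nrm_eq0 R c V).

Lemma rl_normE (x : V) : `|(x : rl V)| = nrm x.
Proof. by []. Qed.

Lemma rl_nbhsE (x : V) : nbhs (x : rl V) = nbhs x.
Proof.
apply/funext => A; apply/propext; rewrite nbhs_nrmP; split.
  move=> /nbhs_ballP[d /= d0 Hd]; exists d => // y yx; apply: Hd.
  by rewrite -ball_normE /= distrC.
move=> [d d0 Hd]; apply/nbhs_ballP; exists d => // y.
by rewrite -ball_normE /= distrC; exact: Hd.
Qed.

End Realification.

Section RealificationComplete.
Context {R : realType} {c : bool}.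
Variable V : completeNormedModType (scal R c).

Fact rl_complete (F : set_system (rl V)) : ProperFilter F -> cauchy F -> cvg F.
Proof.
move=> FF Fc.
have : cauchy (F : set_system V).
  apply/cauchy_ballP => e e0; have eE : ofR c (toR e) = e by rewrite toRK // ltW.
  have te0 : 0 < toR e by rewrite -(ofR_lt (c := c)) eE ofR0.
  move/cauchy_ballP : Fc => /(_ _ te0); apply: filterS => -[x y] /=.
  rewrite -ball_normE /= => xy; rewrite -[X in X x e y]ball_normE /= -eE -nrm_lt.
  exact: xy.
move=> /cauchy_cvg Fl; apply/cvg_ex; exists (lim (F : set_system V)).
by move=> A; rewrite rl_nbhsE; exact: Fl.
Qed.

HB.instance Definition _ := Uniform_isComplete.Build (rl V) rl_complete.
End RealificationComplete.

(** * The pencil near the origin *)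

Section GraphNorm.
Context {R : realType} {X Y : completeNormedModType R}.
Variables (D DB : set X) (A B : X -> Y) (mu : R) (G : Y -> X).
Hypotheses (D_B : D `<=` DB)
  (A_lin : forall (a : R) u v, D u -> D v -> A (a *: u + v) = a *: A u + A v)
  (B_lin : forall (a : R) u v, DB u -> DB v -> B (a *: u + v) = a *: B u + B v)
  (A_closed : closed [set p : X * Y | D p.1 /\ p.2 = A p.1])
  (B_closed : closed [set p : X * Y | DB p.1 /\ p.2 = B p.1])
  (G_lin : forall (a : R) u v, G (a *: u + v) = a *: G u + G v)
  (DG : forall y, D (G y))
  (GK : forall y, A (G y) + mu *: B (G y) = y)
  (GK' : forall x, D x -> G (A x + mu *: B x) = x).

(* [Y] with the graph norm of [A] transported along the bijection [G] of [Y]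
   onto [D], which is then a Banach space. *)
Definition graph_space : Type := Y.
HB.instance Definition _ := GRing.Lmodule.copy graph_space Y.

Let N (y : graph_space) : R := `|G y| + `|A (G y)|.

Let G0 : G 0 = 0.
Proof. exact: linear_fun0 (G_lin 1 0 0). Qed.

Let GZ (a : R) y : G (a *: y) = a *: G y.
Proof. by rewrite -[a *: y]addr0 G_lin G0 addr0. Qed.

Let GD y z : G (y + z) = G y + G z.
Proof. by rewrite -{1}[y]scale1r G_lin scale1r. Qed.

Let A0 : A 0 = 0.
Proof.
have D0 : D 0 by rewrite -G0.
exact: linear_fun0 (A_lin 1 D0 D0).
Qed.

Let AGZ (a : R) y : A (G (a *: y)) = a *: A (G y).
Proof.
have D0 : D 0 by rewrite -G0.
by rewrite GZ -[a *: G y]addr0 A_lin // A0 addr0.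
Qed.

Let AGD y z : A (G (y + z)) = A (G y) + A (G z).
Proof. by rewrite GD -{1}[G y]scale1r A_lin // scale1r. Qed.

Fact graph_normD (x y : graph_space) : N (x + y) <= N x + N y.
Proof.
rewrite /N AGD GD; have := ler_normD (G x) (G y).
by have := ler_normD (A (G x)) (A (G y)); lra.
Qed.

Fact graph_normZ (a : R) (x : graph_space) : N (a *: x) = `|a| * N x.
Proof. by rewrite /N AGZ GZ !normrZ mulrDr. Qed.

Fact graph_norm_eq0 (x : graph_space) : N x = 0 -> x = 0.
Proof.
move=> Nx; have : `|G x| <= 0 by rewrite -Nx lerDl.
rewrite normr_le0 => /eqP Gx; rewrite -[x]GK Gx A0 add0r.
have DB0 : DB 0 by apply: D_B; rewrite -G0.
suff -> : B 0 = 0 by rewrite scaler0.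
exact: linear_fun0 (B_lin 1 DB0 DB0).
Qed.

HB.instance Definition _ := Lmodule_isNormed.Build R graph_space
  graph_normD graph_normZ graph_norm_eq0.

Let normE (y : graph_space) : `|y| = `|G y| + `|A (G y)|.
Proof. by []. Qed.

Let GB y z : G (y - z) = G y - G z.
Proof. by rewrite GD -scaleN1r GZ scaleN1r. Qed.

Let AGB y z : A (G (y - z)) = A (G y) - A (G z).
Proof. by rewrite AGD -scaleN1r AGZ scaleN1r. Qed.

(** Along a Cauchy filter [G y] and [A (G y)] converge, say to [x] and [w], and closedness of [A]
    gives [w = A x]. The limit is [A x + mu *: B x]; the norm only sees [x] and [A x], so continuity
    of [B] does not enter. *)
Fact graph_space_complete (F : set_system graph_space) :
  ProperFilter F -> cauchy F -> cvg F.
Proof.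
move=> FF /cauchyP Fc; have {}Fc (e : R) : 0 < e -> exists y : graph_space, F (ball y e) by exact: Fc.
have Gnorm y z : `|G y - G z| <= `|(y - z : graph_space)|.
  by rewrite normE GB lerDl.
have AGnorm y z : `|A (G y) - A (G z)| <= `|(y - z : graph_space)|.
  by rewrite normE AGB lerDr.
have /cvg_ex[/= x Gx] : cvg (G @ F).
  apply: cauchy_cvg; apply/cauchyP => e e0; have [y Fy] := Fc e e0; exists (G (y : graph_space)).
  apply: (@filterS _ F _ (ball y e)) Fy => z yz.
  change (ball (G y) e (G z)); move: yz; rewrite -!ball_normE /=.
  exact: le_lt_trans (Gnorm _ _).
have /cvg_ex[/= w Aw] : cvg ((A \o G) @ F).
  apply: cauchy_cvg; apply/cauchyP => e e0; have [y Fy] := Fc e e0; exists (A (G (y : graph_space))).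
  apply: (@filterS _ F _ (ball y e)) Fy => z yz.
  change (ball (A (G y)) e (A (G z))); move: yz; rewrite -!ball_normE /=.
  exact: le_lt_trans (AGnorm _ _).
have [/= Dx wE] : [set p : X * Y | D p.1 /\ p.2 = A p.1] (x, w).
  apply: (closed_cvg (F := F) (u_ := fun y => (G y, A (G y))) _ A_closed); last exact: cvg_pair.
  by apply: nearW => y; split; [exact: DG|].
apply/cvg_ex; exists (A x + mu *: B x).
apply/cvgrPdist_le => e e0.
have e2 : 0 < e / 2 by rewrite divr_gt0.
have /cvgrPdist_le /(_ _ e2) h1 := Gx.
have /cvgrPdist_le /(_ _ e2) h2 := Aw.
near=> y; rewrite normE AGB GB GK' // -wE.
have : `|x - G y| <= e / 2 by near: y.
have : `|w - A (G y)| <= e / 2 by near: y.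
lra.
Unshelve. all: by end_near. Qed.

HB.instance Definition _ := Uniform_isComplete.Build graph_space graph_space_complete.

(** The composite of [B] and [G] is a closed map defined on the whole Banach space [graph_space],
    hence bounded. *)
Lemma graph_bounded : exists2 b : R, 0 <= b & forall x, D x -> `|B x| <= b * (`|A x| + `|x|).
Proof.
have Gc (u : nat -> graph_space) (y : graph_space) : u n @[n --> \oo] --> y -> G (u n) @[n --> \oo] --> G y.
  move=> uy; apply/cvgrPdist_le => e e0.
  have /cvgrPdist_le /(_ _ e0) := uy; apply: filterS => n; apply: le_trans.
  by rewrite normE GB lerDl.
have [|u y z uy Buz|M M0 HM] := @closed_graph R graph_space Y (fun y => B (G y)).
- by move=> a y z; rewrite G_lin B_lin //; exact: D_B.
- have [] // : [set p : X * Y | DB p.1 /\ p.2 = B p.1] (G y, z).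
  apply: (closed_cvg (F := \oo) (u_ := fun n => (G (u n), B (G (u n)))) _ B_closed).
    by apply: nearW => n; split => //; apply: D_B; exact: DG.
  by apply: cvg_pair => //; exact: Gc.
exists M => // x Dx; have := HM (A x + mu *: B x : graph_space).
by rewrite normE GK' // addrC.
Qed.

End GraphNorm.

Lemma normrZ_gt0 (R : realType) (E : normedModType R) (a : R) (v : E) :
  0 < a -> `|a *: v| = a * `|v|.
Proof. by move=> a0; rewrite normrZ gtr0_norm. Qed.

Section Laurent.
Context {R : realType} {X Y : completeNormedModType R}.
Variables (D : set X) (A B : X -> Y) (b : R).
Hypotheses (D0 : D 0)
  (DD : forall (a : R) u v, D u -> D v -> D (a *: u + v))
  (A_lin : forall (a : R) u v, D u -> D v -> A (a *: u + v) = a *: A u + A v)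
  (B_lin : forall (a : R) u v, D u -> D v -> B (a *: u + v) = a *: B u + B v)
  (A_closed : closed [set p : X * Y | D p.1 /\ p.2 = A p.1])
  (b_ge0 : 0 <= b)
  (B_bounded : forall x, D x -> `|B x| <= b * (`|A x| + `|x|)).

(** Once [mu * b <= 1 / 2], the relative bound lets [mu *: B x] be absorbed into [A x]. So [A x] and
    [B x] are bounded, [mu *: B x] tends to [0], and closedness of [A] applies. *)
Lemma pencil_limit (mu : nat -> R) (x : nat -> X) (l : X) (L : Y) :
  (forall n, 0 < mu n) -> mu n @[n --> \oo] --> (0 : R) -> (forall n, D (x n)) ->
  x n @[n --> \oo] --> l -> (A (x n) + mu n *: B (x n)) @[n --> \oo] --> L ->
  D l /\ A l = L.
Proof.
move=> mu0 mul Dx xl Ll; have b0 := b_ge0.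
have bnd (V : completeNormedModType R) (u : nat -> V) (v : V) : u n @[n --> \oo] --> v ->
    exists2 C : R, 0 <= C & forall n, `|u n| <= C.
  move=> uv; have uc : cvgn u by apply/cvg_ex; exists v.
  have [M [_ HM]] := cvg_seq_bounded uc.
  have {}HM n : `|u n| <= M + 1 by apply: (HM (M + 1)); rewrite ?ltrDl.
  by exists (M + 1) => //; exact: le_trans (HM 0%N).
have [c1 c10 H1] := bnd _ _ _ xl.
have [c2 c20 H2] := bnd _ _ _ Ll.
(* Absorbing gives [|A x| <= 2 * c2 + c1], and [|x| <= c1]. *)
pose c3 := b * (2 * c2 + 2 * c1).
have c30 : 0 <= c3 by rewrite mulr_ge0 //; lra.
have near_mu (e : R) : 0 < e -> \forall n \near \oo, mu n <= e.
  move=> e0; have /cvgrPdist_le /(_ e e0) := mul; apply: filterS => n.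
  by rewrite sub0r normrN gtr0_norm.
have Bx : \forall n \near \oo, `|B (x n)| <= c3.
  have : \forall n \near \oo, mu n <= (2 * (b + 1))^-1.
    apply: near_mu; rewrite invr_gt0; lra.
  apply: filterS => n mub.
  have {}mub : mu n * (2 * (b + 1)) <= 1 by rewrite -ler_pdivlMr ?div1r //; lra.
  have hB := B_bounded (Dx n); have h1 := H1 n; have h2 := H2 n.
  have := ler_normB (A (x n) + mu n *: B (x n)) (mu n *: B (x n)).
  rewrite addrK normrZ gtr0_norm // => hA.
  have mb : mu n * b <= 2^-1 by have := mu0 n; nra.
  have hmB : mu n * `|B (x n)| <= 2^-1 * (`|A (x n)| + `|x n|).
    apply: le_trans (_ : mu n * (b * (`|A (x n)| + `|x n|)) <= _).
      by apply: ler_wpM2l => //; exact: ltW.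
    by rewrite mulrA; apply: ler_wpM2r => //; exact: addr_ge0.
  apply: le_trans hB _; apply: ler_wpM2l => //; lra.
have mB : (mu n *: B (x n)) @[n --> \oo] --> (0 : Y).
  apply/cvgr0Pnorm_le => e e0; near=> n.
  rewrite normrZ gtr0_norm //.
  have h1 : `|B (x n)| <= c3 by near: n.
  have h2 : mu n <= e / (c3 + 1).
    by near: n; apply: near_mu; rewrite divr_gt0 //; lra.
  move: h2; rewrite ler_pdivlMr; last lra.
  by have := mu0 n; nra.
have Al : A (x n) @[n --> \oo] --> L.
  rewrite -[L]subr0 [X in X @ _ --> _](_ : _ =
    (fun n => (A (x n) + mu n *: B (x n)) - mu n *: B (x n))).
    exact: cvgB.
  by apply/funext => n; rewrite addrK.
have [] // : [set p : X * Y | D p.1 /\ p.2 = A p.1] (l, L).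
  apply: (closed_cvg (F := \oo) (u_ := fun n => (x n, A (x n))) _ A_closed).
    by apply: nearW => n; split; [exact: Dx|].
  exact: cvg_pair.
Unshelve. all: by end_near. Qed.

Variables (C : nat -> Y -> X) (G : R -> Y -> X) (r : R) (nu : nat).
Hypotheses (r_gt0 : 0 < r)
  (DG : forall mu y, 0 < mu < r -> D (G mu y))
  (GK : forall mu y, 0 < mu < r -> A (G mu y) + mu *: B (G mu y) = y)
  (G_series : forall mu, 0 < mu < r -> forall e : R, 0 < e -> exists N : nat,
     forall n y, (N <= n)%N ->
     `|G mu y - \sum_(k < n) (mu ^+ k / mu ^+ nu) *: C k y| <= e * `|y|).

Let S (y : Y) (mu : R) j := \sum_(k < j) mu ^+ k *: C k y.

Let S_scale y mu j : 0 < mu ->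
  \sum_(k < j) (mu ^+ k / mu ^+ nu) *: C k y = (mu ^+ nu)^-1 *: S y mu j.
Proof.
by move=> mu0; rewrite scaler_sumr; apply: eq_bigr => k _; rewrite scalerA mulrC.
Qed.

(** At the radius [r / 2] the terms of the convergent series are bounded; for [mu <= r / 4] the tail
    is then dominated by a geometric series of ratio at most 1/2. *)
Let tail_bound y : exists2 K : R, 0 <= K & forall mu j, 0 < mu <= r / 4 ->
  `|mu ^+ nu *: G mu y - S y mu j| <= K * (mu / (r / 2)) ^+ j.
Proof.
pose m1 := r / 2; have r0 := r_gt0.
have m10 : 0 < m1 by rewrite divr_gt0.
have m1r : 0 < m1 < r by rewrite m10 /m1; lra.
have [K K0 HK] : exists2 K : R, 0 <= K & forall k, `|m1 ^+ k *: C k y| <= K.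
  have [N HN] := G_series m1r (e := (m1 ^+ nu)^-1) ltac:(by rewrite invr_gt0 exprn_gt0).
  have late k : (N <= k)%N -> `|m1 ^+ k *: C k y| <= 2 * `|y|.
    move=> Nk; have := HN k y Nk; have := HN k.+1 y (leqW Nk).
    rewrite !S_scale //; set p := (m1 ^+ nu)^-1.
    have p0 : 0 < p by rewrite invr_gt0 exprn_gt0.
    move=> h1 h2; rewrite -(ler_pM2l p0) -(normrZ_gt0 _ p0).
    have -> : p *: (m1 ^+ k *: C k y) = (G m1 y - p *: S y m1 k) - (G m1 y - p *: S y m1 k.+1).
      rewrite [S y m1 k.+1]big_ord_recr /= -/(S y m1 k); module R.
    by apply: le_trans (ler_normB _ _) _; lra.
  exists (2 * `|y| + \sum_(k < N) `|m1 ^+ k *: C k y|).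
    by rewrite addr_ge0 ?mulr_ge0 // sumr_ge0.
  move=> k; have [Nk|kN] := leqP N k.
    by apply: le_trans (late k Nk) _; rewrite lerDl sumr_ge0.
  rewrite (bigD1 (Ordinal kN)) //=; have := normr_ge0 y.
  have : 0 <= \sum_(i < N | i != Ordinal kN) `|m1 ^+ i *: C i y| by rewrite sumr_ge0.
  lra.
exists (2 * K) => [|mu j /andP[mu0 mur]]; first by rewrite mulr_ge0.
have mur' : 0 < mu < r by rewrite mu0; lra.
pose q := mu / m1.
have q0 : 0 < q by rewrite divr_gt0.
have q2 : q <= 2^-1 by rewrite ler_pdivrMr // /m1; lra.
have qj k : 0 < q ^+ k by rewrite exprn_gt0.
have termK k : `|mu ^+ k *: C k y| <= K * q ^+ k.
  have -> : mu ^+ k *: C k y = q ^+ k *: (m1 ^+ k *: C k y).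
    by rewrite scalerA -exprMn /q divfK // gt_eqF.
  by rewrite normrZ gtr0_norm // mulrC; apply: ler_wpM2r => //; exact: ltW.
have SB n : `|S y mu (j + n) - S y mu j| <= 2 * K * q ^+ j * (1 - q ^+ n).
  elim: n => [|n IHn]; first by rewrite addn0 expr0 !subrr mulr0 normr0.
  rewrite addnS [S y mu (j + n).+1]big_ord_recr /= -/(S y mu (j + n)).
  rewrite (_ : _ + _ - _ = (S y mu (j + n) - S y mu j) + mu ^+ (j + n) *: C (j + n)%N y); last by module R.
  apply: le_trans (ler_normD _ _) _.
  apply: le_trans (lerD IHn (termK (j + n)%N)) _; rewrite exprD exprS.
  have KJ : 0 <= K * q ^+ j * q ^+ n by rewrite !mulr_ge0 // ltW.
  have := ler_wpM2l KJ q2; nra.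
apply/ler_addgt0Pr => e e0.
pose p := mu ^+ nu; have p0 : 0 < p by rewrite exprn_gt0.
have y1 : 0 < `|y| + 1 by rewrite ltr_wpDl.
have [N HN] := G_series mur' (e := e / (p * (`|y| + 1))) ltac:(by rewrite divr_gt0 // mulr_gt0).
have := HN (j + N)%N y (leq_addl _ _); rewrite S_scale // -/p.
rewrite -(ler_pM2l p0) -(normrZ_gt0 _ p0) scalerBr scalerA divff ?gt_eqF //.
rewrite scale1r => h.
have h' : p * (e / (p * (`|y| + 1)) * `|y|) <= e.
  rewrite (_ : p * _ = e * (`|y| / (`|y| + 1))); last by field; rewrite !gt_eqF.
  by rewrite ler_piMr ?(ltW e0) // ler_pdivrMr // mul1r lerDl.
rewrite (_ : _ - _ = (p *: G mu y - S y mu (j + N)) + (S y mu (j + N) - S y mu j)); last by module R.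
apply: le_trans (ler_normD _ _) _; have := SB N.
have KJ : 0 <= 2 * K * q ^+ j * q ^+ N by rewrite !mulr_ge0 // ltW.
rewrite -/m1 -/q; lra.
Qed.

Let prevB y j := if j is i.+1 then B (C i y) else 0.

Let lin0 (F : X -> Y) : (forall (a : R) u v, D u -> D v -> F (a *: u + v) = a *: F u + F v) ->
  F 0 = 0.
Proof.
move=> F_lin; exact: linear_fun0 (F_lin 1 0 0 D0 D0).
Qed.

(* Identification of the coefficients in [(A + mu B) (sum_k mu^(k - nu) C_k) = I]:
   as [A] and [B] are not bounded, this is done inductively by dividing the
   remainder of order [j] by [mu^j] and letting [mu] tend to [0]. *)
Lemma laurent_coef y j : (j <= nu)%N ->
  D (C j y) /\ A (C j y) = (if j == nu then y else 0) - prevB y j.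
Proof.
elim/ltn_ind: j => j IH jnu.
(* By the induction hypothesis the pencil applied to a partial sum telescopes to its last term. *)
have DS mu i : (i <= j)%N -> D (S y mu i) /\
    A (S y mu i) + mu *: B (S y mu i) = mu ^+ i *: prevB y i.
  elim: i => [|i IHi] ij.
    by rewrite /S big_ord0 !lin0 // scaler0 addr0 scaler0.
  have [DSi ASi] := IHi (ltnW ij).
  have [DC AC] := IH i ij (leq_trans (ltnW ij) jnu).
  have inu : (i == nu) = false by rewrite ltn_eqF // (leq_trans ij).
  rewrite inu sub0r in AC.
  have -> : S y mu i.+1 = mu ^+ i *: C i y + S y mu i.
    by rewrite /S big_ord_recr addrC.
  split; first exact: DD.
  rewrite A_lin // B_lin // AC exprS /=.
  rewrite (_ : _ + _ = (A (S y mu i) + mu *: B (S y mu i)) - mu ^+ i *: prevB y i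
     + (mu * mu ^+ i) *: B (C i y)); last by module R.
  by rewrite ASi subrr add0r.
have [K K0 HK] := tail_bound y; have r0 := r_gt0.
pose mu n := r / 4 * 2^-1 ^+ n.
have mu0 n : 0 < mu n by rewrite mulr_gt0 ?exprn_gt0 // divr_gt0.
have mur n : mu n <= r / 4.
  rewrite ler_piMr ?divr_ge0 ?(ltW r_gt0) //; apply: exprn_ile1; lra.
have mur' n : 0 < mu n < r by rewrite mu0; have := mur n; lra.
have mul : mu n @[n --> \oo] --> (0 : R).
  rewrite -[X in _ --> X](mulr0 (r / 4)); apply: cvgM; first exact: cvg_cst.
  by apply: cvg_expr; rewrite gtr0_norm; lra.
pose x n := (mu n ^+ j)^-1 *: (mu n ^+ nu *: G (mu n) y - S y (mu n) j).
have muj n : 0 < mu n ^+ j by rewrite exprn_gt0.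
have DB u v (a : R) : D u -> D v -> D (a *: (u - v)).
  move=> Du Dv; rewrite -[a *: _]addr0; apply: DD => //.
  by rewrite addrC -scaleN1r; exact: DD.
have Dmu n : D (mu n ^+ nu *: G (mu n) y).
  by rewrite -[_ *: _]addr0; apply: DD => //; exact: DG.
have Dx n : D (x n) by apply: DB => //; exact: (DS (mu n) j (leqnn j)).1.
have xl : x n @[n --> \oo] --> C j y.
  apply/cvgrPdist_le => e e0.
  (* The tail estimate of order [j + 1], divided by [mu^j], leaves [c * mu]. *)
  pose c := K / (r / 2) ^+ j.+1.
  have c0 : 0 <= c by rewrite divr_ge0 // exprn_ge0 // divr_ge0 // ltW.
  have /cvgrPdist_le /(_ (e / (c + 1)) ltac:(rewrite divr_gt0 //; lra)) := mul.
  apply: filterS => n; rewrite sub0r normrN gtr0_norm // ler_pdivlMr; last lra.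
  move=> mue; have := HK (mu n) j.+1 ltac:(by rewrite mu0 mur).
  rewrite [S y (mu n) j.+1]big_ord_recr /= -/(S y (mu n) j) => h.
  rewrite -(ler_pM2l (muj n)) -(normrZ_gt0 _ (muj n)) scalerBr.
  rewrite /x scalerA divff ?gt_eqF // scale1r distrC.
  rewrite (_ : _ - _ - _ = mu n ^+ nu *: G (mu n) y - (S y (mu n) j + mu n ^+ j *: C j y)); last by module R.
  apply: le_trans h _.
  have -> : K * (mu n / (r / 2)) ^+ j.+1 = mu n ^+ j * (c * mu n).
    by rewrite expr_div_n (exprS (mu n)) /c; ring.
  by rewrite ler_pM2l //; have := mu0 n; nra.
apply: (pencil_limit mu0 mul Dx xl).
have E n : A (x n) + mu n *: B (x n) = mu n ^+ (nu - j) *: y - prevB y j.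
  have [DSj ASj] := DS (mu n) j (leqnn j).
  have lin (F : X -> Y) : (forall (a : R) u v, D u -> D v -> F (a *: u + v) = a *: F u + F v) ->
      F (x n) = (mu n ^+ j)^-1 *: (mu n ^+ nu *: F (G (mu n) y) - F (S y (mu n) j)).
    move=> F_lin; have F0 := lin0 F_lin.
    have FZ (a : R) u : D u -> F (a *: u) = a *: F u.
      by move=> Du; rewrite -[a *: u]addr0 F_lin // F0 addr0.
    have Du : D (mu n ^+ nu *: G (mu n) y - S y (mu n) j).
      by have := DB _ _ 1 (Dmu n) DSj; rewrite scale1r.
    rewrite /x FZ //; congr (_ *: _); rewrite addrC -scaleN1r F_lin //.
    by rewrite FZ ?scaleN1r 1?addrC //; exact: DG.
  rewrite (lin A) // (lin B) //.
  rewrite (_ : _ + _ = (mu n ^+ j)^-1 *: (mu n ^+ nu *: (A (G (mu n) y) + mu n *: B (G (mu n) y))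
      - (A (S y (mu n) j) + mu n *: B (S y (mu n) j)))); last by module R.
  rewrite ASj GK // scalerBr !scalerA mulVf ?gt_eqF // scale1r.
  by congr (_ *: _ - _); rewrite expfB_cond ?gt_eqF //= ?jnu // mulrC.
rewrite (_ : (fun n => _) = (fun n => mu n ^+ (nu - j) *: y - prevB y j)); last exact/funext.
apply: cvgB; last exact: cvg_cst.
have [->|jn] := eqVneq j nu.
  by rewrite subnn; under eq_fun do rewrite expr0 scale1r; exact: cvg_cst.
rewrite -[X in _ --> X](scale0r y); apply: cvgZ; last exact: cvg_cst.
have -> : (0 : R) = 0 ^+ (nu - j) by rewrite expr0n subn_eq0 leqNgt ltn_neqAle jn jnu.
exact: (cvg_comp _ _ mul (@exprn_continuous _ (nu - j) 0)).
Qed.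

End Laurent.

Section RealPencil.
Context {R : realType}.

(** Only small positive parameters are kept: they suffice for limits at [0], and they make sense
    over both scalar fields. *)
Definition real_pencil (c : bool) (X Y : normedModType (scal R c)) (A B : linop X Y)
    (nu : nat) (C : nat -> Y -> X) (G : R -> Y -> X) (r : R) : Prop :=
  [/\ 0 < r,
    forall (mu : R) y, 0 < mu < r -> Dset A B (G mu y) /\
      A (G mu y) + ofR c mu *: B (G mu y) = y,
    forall (mu : R) x, 0 < mu < r -> Dset A B x -> G mu (A x + ofR c mu *: B x) = x,
    forall (mu a : R) u v, 0 < mu < r ->
      G mu (ofR c a *: u + v) = ofR c a *: G mu u + G mu v
  & forall mu : R, 0 < mu < r -> forall e : R, 0 < e -> exists N : nat,
      forall n y, (N <= n)%N ->
      nrm (G mu y - \sum_(k < n) ofR c (mu ^+ k / mu ^+ nu) *: C k y) <= e * nrm y].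

Let pencil_family (E F : lmodType R[i]) (nE : E -> R) (nF : F -> R) (D : set E)
    (A B : E -> F) (C : nat -> F -> E) (r : R) (nu : nat) :
  (forall mu : R[i], 0 < `|mu| < r%:C%C ->
     exists2 G, cinverse nE nF D (fun x => A x + mu *: B x) G &
     forall e : R, 0 < e -> exists N : nat, forall n, (N <= n)%N -> forall y,
       nE (G y - \sum_(k < n) (mu ^+ k / mu ^+ nu) *: C k y) <= e * nF y) ->
  exists G : R -> F -> E, forall mu : R, 0 < mu < r ->
    cinverse nE nF D (fun x => A x + mu%:C%C *: B x) (G mu) /\
    forall e : R, 0 < e -> exists N : nat, forall n, (N <= n)%N -> forall y,
      nE (G mu y - \sum_(k < n) (mu%:C%C ^+ k / mu%:C%C ^+ nu) *: C k y) <= e * nF y.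
Proof.
move=> H; pose P (mu : R) G := 0 < mu < r ->
  cinverse nE nF D (fun x => A x + mu%:C%C *: B x) G /\
  forall e : R, 0 < e -> exists N : nat, forall n, (N <= n)%N -> forall y,
    nE (G y - \sum_(k < n) (mu%:C%C ^+ k / mu%:C%C ^+ nu) *: C k y) <= e * nF y.
suff [G HG] : {G : R -> F -> E & forall mu, P mu (G mu)} by exists G.
apply: (@choice _ _ P) => mu; have [mur|murN] := boolP (0 < mu < r); last first.
  by exists (fun=> 0) => mur; rewrite mur in murN.
have [|G G1 G2] := H mu%:C%C; last by exists G.
by have /andP[mu0 mur'] := mur; rewrite ger0_norm ?lecR ?ltW // !ltcR mu0 mur'.
Qed.

(** For real spaces, vectors are embedded as [(y, 0)] and the first component of the result is kept.
    This respects the pencil because a real parameter acts on the two components separately. *)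
Lemma real_pencil_exists (c : bool) (X Y : normedModType (scal R c)) (A B : linop X Y)
    (nu : nat) : regular_pencil A B nu ->
  (0 < nu)%N /\ exists C G r, real_pencil A B nu C G r.
Proof.
case: c X Y A B => /= X Y A B [nu0 _ [C [r [_ _ r0 H]]]]; split=> //.
- have [G HG] := pencil_family H.
  exists C, G, r; split=> //.
  + move=> mu y /HG[[_ [_ DG _ GK]] _]; split; [exact: DG|exact: GK].
  + by move=> mu x /HG[[_ [_ _ GK _]] _] Dx; exact: GK.
  + by move=> mu a u v /HG[[[G_lin _] _] _]; exact: G_lin.
  + move=> mu /HG[_ Hs] e e0; have [N HN] := Hs e e0; exists N => n y Nn.
    rewrite (eq_bigr (fun k : 'I_n => (mu%:C%C ^+ k / mu%:C%C ^+ nu) *: C k y)); first exact: HN.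
    by move=> k _; rewrite -!rmorphXn -fmorphV -rmorphM.
pose nX (v : cplx X) : R := @nrm R false X v.1 + @nrm R false X v.2.
pose nY (v : cplx Y) : R := @nrm R false Y v.1 + @nrm R false Y v.2.
pose D2 : set (cplx X) := [set v | (dom A `&` dom B) v.1 /\ (dom A `&` dom B) v.2].
pose T (mu : R) (x : cplx X) : cplx Y :=
  ((A x.1, A x.2) : cplx Y) + mu%:C%C *: ((B x.1, B x.2) : cplx Y).
have [G HG] := pencil_family (nE := nX) (nF := nY) H.
pose re (y : Y) : cplx Y := (y, 0).
have scale1E (V : lmodType R) (a : R) (v : cplx V) : (a%:C%C *: v).1 = a *: v.1.
  by rewrite /GRing.scale /= /cplx_scale /= scale0r subr0.
have scale2E (V : lmodType R) (a : R) (v : cplx V) : (a%:C%C *: v).2 = a *: v.2.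
  by rewrite /GRing.scale /= /cplx_scale /= scale0r addr0.
have nrm0 (V : normedModType R) : @nrm R false V 0 = 0 by rewrite /nrm normr0.
have lin0 (F : X -> Y) (S : set X) : linear_on (c := false) S F -> S 0 -> F 0 = 0.
  move=> F_lin S0; exact: linear_fun0 (F_lin 1 0 0 S0 S0).
have A0 : A 0 = 0 by apply: (lin0 _ _ (@fn_linear _ _ _ _ A)); exact: (dom_subspace A).1.
have B0 : B 0 = 0 by apply: (lin0 _ _ (@fn_linear _ _ _ _ B)); exact: (dom_subspace B).1.
exists (fun k y => (C k (re y)).1), (fun mu y => (G mu (re y)).1), r; split=> //.
- move=> mu y /HG[[_ [_ DG _ GK]] _]; split; first exact: (DG (re y) I).1.
  transitivity (T mu (G mu (re y))).1; last exact: (congr1 (fun v : cplx Y => v.1) (GK (re y) I)).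
  rewrite -[RHS]/(A (G mu (re y)).1 + (mu%:C%C *: ((B (G mu (re y)).1, B (G mu (re y)).2) : cplx Y)).1).
  by rewrite scale1E.
- move=> mu x /HG[[_ [_ _ GK _]] _] Dx.
  have D2x : D2 (x, 0) by split => //; split; [exact: (dom_subspace A).1|exact: (dom_subspace B).1].
  transitivity (G mu (T mu (x, 0))).1; last exact: (congr1 (fun v : cplx X => v.1) (GK (x, 0) D2x)).
  congr (G mu _).1.
  apply: injective_projections; rewrite /T /re /=.
    by rewrite -[RHS]/(A x + (mu%:C%C *: ((B x, B 0) : cplx Y)).1) scale1E.
  by rewrite -[RHS]/(A 0 + (mu%:C%C *: ((B x, B 0) : cplx Y)).2) scale2E /= A0 B0 scaler0 addr0.
- move=> mu a u v /HG[[[G_lin _] _] _].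
  have -> : re (a *: u + v) = a%:C%C *: re u + re v.
    apply: injective_projections => /=; first by rewrite -[X in _ = X + _]/((a%:C%C *: re u).1) scale1E.
    by rewrite -[RHS]/((a%:C%C *: re u).2 + 0) scale2E /= scaler0 addr0.
  by rewrite G_lin -[LHS]/((a%:C%C *: G mu (re u)).1 + _) scale1E.
- move=> mu /HG[_ Hs] e e0; have [N HN] := Hs e e0; exists N => n y Nn.
  have nYre : nY (re y) = @nrm R false Y y.
    by rewrite /nY -[(re y).2]/(0 : Y) nrm0 addr0.
  have := HN n Nn (re y); rewrite nYre; apply: le_trans.
  have -> : (G mu (re y)).1 - \sum_(k < n) ofR false (mu ^+ k / mu ^+ nu) *: (C k (re y)).1 =
      (G mu (re y) - \sum_(k < n) (mu%:C%C ^+ k / mu%:C%C ^+ nu) *: C k (re y)).1.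
    rewrite -[RHS]/((G mu (re y)).1 - (\sum_(k < n) _).1); congr (_ - _).
    rewrite (big_morph (fun v : cplx X => v.1) (id1 := 0) (op1 := +%R)) //.
    by apply: eq_bigr => k _; rewrite -!rmorphXn -fmorphV -rmorphM scale1E.
  by rewrite /nX lerDl /nrm /=.
Qed.

End RealPencil.

(** * Root vectors and projectors *)

Section BoundedMaps.
Context {R : realType} {c : bool}.
Local Notation K := (scal R c).
Implicit Types E F H : normedModType K.

Definition bdd E F (T : E -> F) : Prop :=
  (forall (a : K) u v, T (a *: u + v) = a *: T u + T v) /\
  exists2 M : R, 0 <= M & forall x, nrm (T x) <= M * nrm x.

Lemma nrm_ge0 E (x : E) : 0 <= nrm x.
Proof. by rewrite -(@ofR_le R c) nrmE ofR0. Qed.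

Lemma nrm0 E : nrm (0 : E) = 0.
Proof. by rewrite /nrm normr0 -ofR0 ofRK. Qed.

Lemma nrmN E (x : E) : nrm (- x) = nrm x.
Proof. by rewrite /nrm normrN. Qed.

Lemma nrm_distC E (x y : E) : nrm (x - y) = nrm (y - x).
Proof. by rewrite -nrmN opprB. Qed.

Lemma nrmB E (x y : E) : nrm (x - y) <= nrm x + nrm y.
Proof. by rewrite -(nrmN y) nrmD. Qed.

Lemma functional_bdd E (q : E -> K) : functional q -> bdd (q : E -> K^o).
Proof.
move=> [_ q_lin [M HM]]; split; first by move=> a u v; exact: q_lin.
exists `|M| => // x; apply: le_trans (HM x I) _.
by apply: ler_wpM2r; [exact: nrm_ge0|exact: ler_norm].
Qed.

Lemma bdd0 E F (T : E -> F) : bdd T -> T 0 = 0.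
Proof.
move=> [T_lin _]; exact: linear_fun0 (T_lin 1 0 0).
Qed.

Lemma bddD E F (T : E -> F) u v : bdd T -> T (u + v) = T u + T v.
Proof. by move=> [T_lin _]; rewrite -{1}[u]scale1r T_lin scale1r. Qed.

Lemma bddZ E F (T : E -> F) a u : bdd T -> T (a *: u) = a *: T u.
Proof. by move=> bT; rewrite -[a *: u]addr0 bT.1 (bdd0 bT) addr0. Qed.

Lemma bddN E F (T : E -> F) u : bdd T -> T (- u) = - T u.
Proof. by move=> bT; rewrite -scaleN1r bddZ // scaleN1r. Qed.

Lemma bddB E F (T : E -> F) u v : bdd T -> T (u - v) = T u - T v.
Proof. by move=> bT; rewrite bddD // bddN. Qed.

Lemma bdd_sum E F (T : E -> F) (I : Type) (r : seq I) (P : pred I) (u : I -> E) : bdd T ->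
  T (\sum_(i <- r | P i) u i) = \sum_(i <- r | P i) T (u i).
Proof.
by move=> bT; apply: (big_morph T (fun x y => bddD x y bT) (bdd0 bT)).
Qed.

Lemma bdd_cst0 E F : bdd (fun _ : E => 0 : F).
Proof.
split; first by move=> a u v; rewrite scaler0 addr0.
by exists 0 => // x; rewrite nrm0 mul0r.
Qed.

Lemma bdd_id E : bdd (fun x : E => x).
Proof. by split=> //; exists 1 => // x; rewrite mul1r. Qed.

Lemma bdd_add E F (T S : E -> F) : bdd T -> bdd S -> bdd (fun x => T x + S x).
Proof.
move=> [T_lin [M M0 HM]] [S_lin [N N0 HN]]; split=> [a u v|].
  by rewrite T_lin S_lin scalerDr addrACA.
exists (M + N) => [|x]; first exact: addr_ge0.
by rewrite mulrDl; apply: le_trans (nrmD _ _) (lerD (HM x) (HN x)).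
Qed.

Lemma bdd_opp E F (T : E -> F) : bdd T -> bdd (fun x => - T x).
Proof.
move=> [T_lin [M M0 HM]]; split=> [a u v|]; first by rewrite T_lin opprD scalerN.
by exists M => // x; rewrite nrmN.
Qed.

Lemma bdd_bigsum E F (I : Type) (r : seq I) (P : pred I) (T : I -> E -> F) :
  (forall i, P i -> bdd (T i)) -> bdd (fun x => \sum_(i <- r | P i) T i x).
Proof.
move=> bT; elim: r => [|i r IHr].
  rewrite (_ : (fun _ => _) = (fun=> 0)); first exact: bdd_cst0.
  by apply/funext => x; rewrite big_nil.
rewrite (_ : (fun _ => _) =
  (fun x => (if P i then T i x else 0) + \sum_(j <- r | P j) T j x)).
  by apply: bdd_add => //; case: (P i) (bT i) => bTi; [exact: bTi|exact: bdd_cst0].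
by apply/funext => x; rewrite big_cons; case: ifP => // _; rewrite add0r.
Qed.

Lemma bdd_rank1 E F (p : E -> K) (v : F) : bdd (p : E -> K^o) -> bdd (fun x => p x *: v).
Proof.
move=> [p_lin [M M0 HM]]; split=> [a x y|]; first by rewrite p_lin scalerDl scalerA.
exists (M * nrm v) => [|x]; first by rewrite mulr_ge0 // nrm_ge0.
by rewrite nrmZK mulrAC; apply: ler_wpM2r; [exact: nrm_ge0|exact: HM].
Qed.

End BoundedMaps.

Section RootSystem.
Context {R : realType} {c : bool} {X Y : normedModType (scal R c)}.
Local Notation K := (scal R c).
Context {A B : linop X Y} {n nu : nat} (rs : root_system A B n nu).
Local Notation phi := (phi rs).
Local Notation q := (qf rs).
Local Notation m := (mult rs).
Local Notation D := (Dset A B).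
Local Notation beta i j := (adjoint B (q i j)).

Lemma Dset_scaleD (a : K) u v : D u -> D v -> D (a *: u + v).
Proof.
by move=> [uA uB] [vA vB]; split; [exact: (dom_subspace A).2|exact: (dom_subspace B).2].
Qed.

Lemma Dset0 : D 0.
Proof. by split; [exact: (dom_subspace A).1|exact: (dom_subspace B).1]. Qed.

Lemma DsetZ (a : K) u : D u -> D (a *: u).
Proof. by move=> Du; rewrite -[_ *: _]addr0; apply: Dset_scaleD => //; exact: Dset0. Qed.

Lemma DsetD u v : D u -> D v -> D (u + v).
Proof. by move=> Du Dv; rewrite -[u]scale1r; exact: Dset_scaleD. Qed.

Lemma DsetB u v : D u -> D v -> D (u - v).
Proof. by move=> Du Dv; rewrite addrC -scaleN1r; exact: Dset_scaleD. Qed.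

Lemma Dset_sum (I : Type) (r : seq I) (P : pred I) (u : I -> X) :
  (forall i, P i -> D (u i)) -> D (\sum_(i <- r | P i) u i).
Proof. by move=> Du; apply: big_ind => //; [exact: Dset0|exact: DsetD]. Qed.

Section Linear.
Variable T : linop X Y.
Hypothesis D_T : D `<=` dom T.

Lemma linop_scaleD (a : K) u v : D u -> D v -> T (a *: u + v) = a *: T u + T v.
Proof. by move=> /D_T Du /D_T Dv; exact: fn_linear. Qed.

Lemma linop0 : T 0 = 0.
Proof. exact: linear_fun0 (linop_scaleD 1 Dset0 Dset0). Qed.

Lemma linopD u v : D u -> D v -> T (u + v) = T u + T v.
Proof. by move=> Du Dv; rewrite -{1}[u]scale1r linop_scaleD // scale1r. Qed.

Lemma linopZ (a : K) u : D u -> T (a *: u) = a *: T u.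
Proof.
by move=> Du; rewrite -[a *: u]addr0 linop_scaleD ?linop0 ?addr0 //; exact: Dset0.
Qed.

Lemma linopB u v : D u -> D v -> T (u - v) = T u - T v.
Proof.
by move=> Du Dv; rewrite addrC -scaleN1r linop_scaleD // scaleN1r addrC.
Qed.

Lemma linop_sum (I : Type) (r : seq I) (P : pred I) (u : I -> X) :
  (forall i, P i -> D (u i)) ->
  T (\sum_(i <- r | P i) u i) = \sum_(i <- r | P i) T (u i).
Proof.
move=> Du; suff [] : D (\sum_(i <- r | P i) u i) /\
  T (\sum_(i <- r | P i) u i) = \sum_(i <- r | P i) T (u i) by [].
apply: (big_rec2 (fun x y => D x /\ T x = y)); first by split; [exact: Dset0|exact: linop0].
move=> i y x Pi [Dx <-]; split; first by apply: DsetD => //; exact: Du.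
by rewrite linopD //; exact: Du.
Qed.
End Linear.

Lemma Dset_domA : D `<=` dom A. Proof. by move=> x []. Qed.
Lemma Dset_domB : D `<=` dom B. Proof. by move=> x []. Qed.

Lemma mult_gt0 i : (1 <= m i)%N.
Proof. by have /andP[] := mult_bounds rs i. Qed.

Lemma adjointP (T : linop X Y) p : adjoint_dom T p -> adjoint_rel T p (adjoint T p).
Proof. by move=> [_ [p' Hp]]; exact: (xgetPex (fun=> 0) (ex_intro _ p' Hp)). Qed.

Lemma beta_bdd i j : (1 <= j <= m i)%N -> bdd (beta i j : X -> K^o).
Proof. by move=> ij; have [/functional_bdd] := adjointP (qf_dom ij).2. Qed.

Lemma betaE i j x : (1 <= j <= m i)%N -> D x -> beta i j x = q i j (B x).
Proof. by move=> ij [_ xB]; have [_ /(_ x xB) <-] := adjointP (qf_dom ij).2. Qed.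

Lemma q_bdd i j : (1 <= j <= m i)%N -> bdd (q i j : Y -> K^o).
Proof. by move=> ij; apply: functional_bdd; have [[]] := qf_dom ij. Qed.

Lemma q_endA i x : D x -> q i (m i) (A x) = 0.
Proof.
move=> [xA _]; have ij : (1 <= m i <= m i)%N by rewrite mult_gt0 leqnn.
by have [_ ->] := adjointP (qf_dom ij).1; rewrite ?qf_end.
Qed.

Lemma beta_phi i j k l : (1 <= j <= m i)%N -> (1 <= l <= m k)%N ->
  beta k l (phi i j) = ((i == k) && (j == l))%:R.
Proof.
by move=> ij kl; rewrite betaE ?qf_biorth //; exact: phi_dom.
Qed.

Lemma range1 i : (1 <= 1 <= m i)%N. Proof. by rewrite mult_gt0. Qed.
Lemma rangem i : (1 <= m i <= m i)%N. Proof. by rewrite mult_gt0 leqnn. Qed.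
Hint Resolve range1 rangem : core.

Lemma beta1_phi1 i k : beta k 1 (phi i 1) = (i == k)%:R.
Proof. by rewrite beta_phi // eqxx andbT. Qed.

Lemma qm_Bphi i k : q k (m k) (B (phi i (m i))) = (i == k)%:R.
Proof.
rewrite qf_biorth //; case: eqP => //= ->.
by rewrite eqxx.
Qed.

Lemma sum_delta (V : lmodType K) (k : 'I_n) (u : 'I_n -> V) :
  \sum_(i < n) (i == k)%:R *: u i = u k.
Proof.
rewrite (bigD1 k) //= eqxx scale1r big1 ?addr0 // => i /negbTE ->.
by rewrite scale0r.
Qed.

Lemma P20_bdd : bdd (P20 rs).
Proof. by apply: bdd_bigsum => i _; apply: bdd_rank1; exact: beta_bdd. Qed.

Lemma phi1_ker i : D (phi i 1) /\ A (phi i 1) = 0.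
Proof. exact: (phi_basis rs).1. Qed.

Lemma P20_D x : D (P20 rs x).
Proof. by apply: Dset_sum => i _; apply: DsetZ; exact: (phi1_ker i).1. Qed.

Lemma A_P20 x : A (P20 rs x) = 0.
Proof.
rewrite linop_sum; last 2 first.
- exact: Dset_domA.
- by move=> i _; apply: DsetZ; exact: (phi1_ker i).1.
apply: big1 => i _; rewrite linopZ; [|exact: Dset_domA|exact: (phi1_ker i).1].
by rewrite (phi1_ker i).2 scaler0.
Qed.

Lemma beta1_P20 k x : beta k 1 (P20 rs x) = beta k 1 x.
Proof.
rewrite (bdd_sum _ _ _ (beta_bdd (range1 k))).
rewrite (eq_bigr (fun i => (i == k)%:R *: (beta i 1 x : K^o))) ?sum_delta //.
move=> i _; rewrite (bddZ _ _ (beta_bdd (range1 k))) beta1_phi1.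
by rewrite /GRing.scale /= mulrC.
Qed.

Lemma P20_P20 x : P20 rs (P20 rs x) = P20 rs x.
Proof. by apply: eq_bigr => k _; rewrite beta1_P20. Qed.

Lemma ker_P20 x : D x -> A x = 0 -> P20 rs x = x.
Proof.
move=> Dx Ax; have [a [-> _]] := (phi_basis rs).2 x (conj Dx Ax).
apply: eq_bigr => k _; congr (_ *: _).
rewrite (bdd_sum _ _ _ (beta_bdd (range1 k))).
rewrite (eq_bigr (fun i => (i == k)%:R *: (a i : K^o))) ?sum_delta //.
move=> i _; rewrite (bddZ _ _ (beta_bdd (range1 k))) beta1_phi1.
by rewrite /GRing.scale /= mulrC.
Qed.

Lemma Q2s_bdd : bdd (Q2s rs).
Proof. by apply: bdd_bigsum => i _; apply: bdd_rank1; exact: q_bdd. Qed.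

Lemma Q2s_A x : D x -> Q2s rs (A x) = 0.
Proof. by move=> Dx; apply: big1 => i _; rewrite q_endA // scale0r. Qed.

Lemma qm_Q2s k y : q k (m k) (Q2s rs y) = q k (m k) y.
Proof.
rewrite (bdd_sum _ _ _ (q_bdd (rangem k))).
rewrite (eq_bigr (fun i => (i == k)%:R *: (q i (m i) y : K^o))) ?sum_delta //.
move=> i _; rewrite (bddZ _ _ (q_bdd (rangem k))) qm_Bphi.
by rewrite /GRing.scale /= mulrC.
Qed.

Lemma Q2s_Q2s y : Q2s rs (Q2s rs y) = Q2s rs y.
Proof. by apply: eq_bigr => k _; rewrite qm_Q2s. Qed.

Lemma qm_eq0 y : Q2s rs y = 0 -> forall k, q k (m k) y = 0.
Proof. by move=> Qy k; rewrite -qm_Q2s Qy (bdd0 (q_bdd (rangem k))). Qed.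

Lemma P2E x : P2 rs x = P20 rs x + P2S rs x.
Proof.
rewrite /P2 /P2S [X in _ = _ + X]big_mkcond -big_split; apply: eq_bigr => i _.
rewrite big_ltn ?ltnS ?mult_gt0 //; congr (_ + _).
by case: eqP => //= ->; rewrite big_geq.
Qed.

Lemma Q2E y : Q2 rs y = Q2S rs y + Q2s rs y.
Proof.
rewrite /Q2 /Q2S [X in _ = X + _]big_mkcond -big_split; apply: eq_bigr => i _.
rewrite big_nat_recr ?mult_gt0 //; congr (_ + _).
by case: eqP => //= ->; rewrite big_geq.
Qed.

Lemma P1_P2S x : P1 rs x + P2S rs x = x - P20 rs x.
Proof. by rewrite /P1 P2E opprD addrA subrK. Qed.

Lemma Q1_Q2S y : Q1 rs y + Q2S rs y = y - Q2s rs y.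
Proof. by rewrite /Q1 Q2E opprD addrA addrAC subrK. Qed.

Lemma P2S_bdd : bdd (P2S rs).
Proof.
apply: bdd_bigsum => i _.
rewrite (_ : (fun _ => _) = (fun x => \sum_(2 <= j < (m i).+1 | (2 <= j < (m i).+1)%N)
    beta i j x *: phi i j)); last first.
  by apply/funext => x; rewrite big_nat_cond; apply: eq_bigl => j; rewrite andbT.
by apply: bdd_bigsum => j /andP[j2 jm]; apply: bdd_rank1; apply: beta_bdd; rewrite (ltnW j2).
Qed.

Lemma P2S_D x : D (P2S rs x).
Proof.
apply: Dset_sum => i _; rewrite big_nat_cond; apply: Dset_sum => j.
by rewrite andbT => /andP[j2 jm]; apply: DsetZ; apply: phi_dom; rewrite (ltnW j2).
Qed.

Lemma P2S_P20 x : P2S rs (P20 rs x) = 0.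
Proof.
apply: big1 => k _; rewrite big_nat_cond; apply: big1 => l.
rewrite andbT => /andP[l2 lm].
have kl : (1 <= l <= m k)%N by rewrite (ltnW l2).
rewrite (bdd_sum _ _ _ (beta_bdd kl)) big1 ?scale0r // => i _.
rewrite (bddZ _ _ (beta_bdd kl)) beta_phi // (ltn_eqF l2) andbF.
by rewrite scaler0.
Qed.

Lemma P1_bdd : bdd (P1 rs).
Proof.
rewrite (_ : P1 rs = fun x => x - (P20 rs x + P2S rs x)); last first.
  by apply/funext => x; rewrite /P1 P2E.
apply: bdd_add; first exact: bdd_id.
by apply: bdd_opp; apply: bdd_add; [exact: P20_bdd|exact: P2S_bdd].
Qed.

Lemma P1_P20 x : P1 rs (P20 rs x) = 0.
Proof. by rewrite /P1 P2E P20_P20 P2S_P20 addr0 subrr. Qed.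

End RootSystem.

Section RootSpace.
Context {R : realType} {c : bool} {X Y : normedModType (scal R c)}.
Local Notation K := (scal R c).
Context {A B : linop X Y} {n nu : nat} (rs : root_system A B n nu).
Local Notation phi := (phi rs).
Local Notation q := (qf rs).
Local Notation m := (mult rs).
Local Notation D := (Dset A B).
Local Notation beta i j := (adjoint B (q i j)).
Local Notation domA := (@Dset_domA R c X Y A B).
Local Notation domB := (@Dset_domB R c X Y A B).

Lemma P2_bdd : bdd (P2 rs).
Proof.
rewrite (_ : P2 rs = fun x => P20 rs x + P2S rs x); last by apply/funext => x; rewrite P2E.
by apply: bdd_add; [exact: P20_bdd|exact: P2S_bdd].
Qed.

Lemma P2_phi k l : (1 <= l <= m k)%N -> P2 rs (phi k l) = phi k l.
Proof.
move=> kl; rewrite /P2 (bigD1 k) //= [X in _ + X]big1 ?addr0; last first.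
  move=> i ik; rewrite big_nat_cond; apply: big1 => j; rewrite andbT ltnS => ij.
  by rewrite beta_phi // eq_sym (negbTE ik) scale0r.
rewrite (bigD1_seq l) /=; last 2 first.
- by rewrite mem_index_iota ltnS.
- exact: iota_uniq.
rewrite beta_phi // !eqxx scale1r big_nat_cond big1 ?addr0 // => j.
rewrite ltnS => /andP[kj jl]; rewrite beta_phi // eqxx /= eq_sym (negbTE jl).
by rewrite scale0r.
Qed.

Lemma P2_P20 x : P2 rs (P20 rs x) = P20 rs x.
Proof. by rewrite P2E P20_P20 P2S_P20 addr0. Qed.

(* The solution of [A x = - B z] for [z] in the root space, up to the terms of
   [z] at the ends of the chains. *)
Let shift (z : X) : X :=
  \sum_(i < n) \sum_(1 <= j < m i) beta i j z *: phi i j.+1.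

Let shiftm i j : (1 <= j < m i)%N -> (1 <= j.+1 <= m i)%N.
Proof. by move=> /andP[_]. Qed.

Let shift_D z : D (shift z).
Proof.
apply: Dset_sum => i _; rewrite big_nat_cond; apply: Dset_sum => j.
by rewrite andbT => ij; apply: DsetZ; apply: phi_dom; exact: shiftm.
Qed.

Let P2_shift z : P2 rs (shift z) = shift z.
Proof.
rewrite /shift (bdd_sum _ _ _ P2_bdd); apply: eq_bigr => i _.
rewrite (bdd_sum _ _ _ P2_bdd) big_nat_cond [RHS]big_nat_cond; apply: eq_bigr => j.
rewrite andbT => ij.
by rewrite (bddZ _ _ P2_bdd) P2_phi //; exact: shiftm.
Qed.

(** Inside a chain [B] maps a root vector to minus the image under [A] of the next one; only the
    chain ends leave a term outside this pattern. *)
Lemma B_root z : D z -> P2 rs z = z ->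
  B z = - A (shift z) + \sum_(i < n) beta i (m i) z *: B (phi i (m i)).
Proof.
move=> Dz Pz; rewrite -{1}Pz /P2 /shift.
have Dphi i j : (1 <= j <= m i)%N -> D (beta i j z *: phi i j).
  by move=> ij; apply: DsetZ; exact: phi_dom.
rewrite (linop_sum domB); last first.
  by move=> i _; rewrite big_nat_cond; apply: Dset_sum => j; rewrite andbT ltnS; exact: Dphi.
rewrite (linop_sum domA); last first.
  move=> i _; rewrite big_nat_cond; apply: Dset_sum => j; rewrite andbT => ij.
  by apply: DsetZ; apply: phi_dom; exact: shiftm.
rewrite -sumrN -big_split; apply: eq_bigr => i _ /=.
rewrite big_nat_recr ?mult_gt0 //=.
rewrite (linopD domB); last 2 first.
- rewrite big_nat_cond; apply: Dset_sum => j; rewrite andbT => /andP[j1 jm].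
  by apply: Dphi; rewrite j1 ltnW.
- by apply: Dphi; rewrite mult_gt0 leqnn.
rewrite (linopZ domB); last by apply: phi_dom; rewrite mult_gt0 leqnn.
congr (_ + _).
rewrite [X in B X]big_nat_cond [X in A X]big_nat_cond.
rewrite (linop_sum domB); last first.
  by move=> j; rewrite andbT => /andP[j1 jm]; apply: Dphi; rewrite j1 ltnW.
rewrite (linop_sum domA); last first.
  by move=> j; rewrite andbT => ij; apply: DsetZ; apply: phi_dom; exact: shiftm.
rewrite -sumrN; apply: eq_bigr => j; rewrite andbT => ij.
have ij' : (1 <= j <= m i)%N by case/andP: ij => -> /ltnW.
rewrite (linopZ domB); last exact: phi_dom.
rewrite (linopZ domA); last by apply: phi_dom; exact: shiftm.
rewrite phi_chain /= ?scalerN ?opprK //.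
Qed.

(** Applying the functionals that annihilate the range of [A] shows that [z] has no components at
    chain ends. So [x - shift z] lies in the kernel of [A], which is part of the root space. Used
    along the Laurent coefficients, where [A C_{j+1} y = - B C_j y]. *)
Lemma root_chain x z : D x -> D z -> A x = - B z -> P2 rs z = z -> P2 rs x = x.
Proof.
move=> Dx Dz Axz Pz.
have bz i : beta i (m i) z = 0.
  have im : (1 <= m i <= m i)%N by rewrite mult_gt0 leqnn.
  rewrite betaE // -[B z]opprK -Axz (bddN _ (q_bdd im)).
  by rewrite (q_endA rs i Dx) oppr0.
have Ax : A (x - shift z) = 0.
  rewrite (linopB domA Dx (shift_D z)).
  rewrite Axz (B_root Dz Pz) big1 ?addr0 ?opprK ?subrr // => i _.
  by rewrite bz scale0r.
have := ker_P20 rs (DsetB Dx (shift_D z)) Ax => E.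
by rewrite -[x](subrK (shift z)) -E (bddD _ _ P2_bdd) P2_P20 P2_shift.
Qed.

(** By [B_root], [y] is an image under [A] plus a combination of the vectors [B phi_i^{m_i}]. The
    latter is produced by the finite-rank part of [Atilde], whose coefficients are adjusted with a
    vector [x2] of the kernel of [A]. *)
Lemma Atilde_surj_aux y : (exists x z, [/\ D x, D z, P2 rs z = z & y = A x + B z]) ->
  exists2 x, D x & Atilde rs x = y.
Proof.
move=> [x [z [Dx Dz Pz ->]]]; rewrite (B_root Dz Pz).
pose x1 := x - shift z.
have Dx1 : D x1 by apply: DsetB => //; exact: shift_D.
have rm i : (1 <= m i <= m i)%N by rewrite mult_gt0 leqnn.
pose x2 := \sum_(i < n) (beta i (m i) z - beta i 1 x1) *: phi i 1.
have Dx2 : D x2 by apply: Dset_sum => i _; apply: DsetZ; exact: (phi1_ker rs i).1.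
have Ax2 : A x2 = 0.
  rewrite (linop_sum domA); last first.
    by move=> i _; apply: DsetZ; exact: (phi1_ker rs i).1.
  apply: big1 => i _; rewrite (linopZ domA); last exact: (phi1_ker rs i).1.
  by rewrite (phi1_ker rs i).2 scaler0.
have bx2 k : beta k 1 x2 = beta k (m k) z - beta k 1 x1.
  have b1 := beta_bdd (range1 rs k).
  rewrite (bdd_sum _ _ _ b1).
  rewrite (eq_bigr (fun i => (i == k)%:R *: ((beta i (m i) z - beta i 1 x1) : K^o))) ?sum_delta //.
  move=> i _; rewrite (bddZ _ _ b1) beta1_phi1.
  by rewrite /GRing.scale /= mulrC.
exists (x1 + x2); first exact: DsetD.
rewrite /Atilde (linopD domA) //.
rewrite Ax2 addr0 /x1 (linopB domA Dx (shift_D z)).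
rewrite -addrA; congr (_ + (_ + _)); apply: eq_bigr => k _.
by rewrite (bddD _ _ (beta_bdd (range1 rs k))) bx2 addrC subrK.
Qed.

Lemma qm_Atilde k x : D x -> q k (m k) (Atilde rs x) = beta k 1 x.
Proof.
move=> Dx; have rm i : (1 <= m i <= m i)%N by rewrite mult_gt0 leqnn.
rewrite /Atilde (bddD _ _ (q_bdd (rm k))) q_endA // add0r.
rewrite (bdd_sum _ _ _ (q_bdd (rm k))).
rewrite (eq_bigr (fun i => (i == k)%:R *: (beta i 1 x : K^o))) ?sum_delta //.
move=> i _; rewrite (bddZ _ _ (q_bdd (rm k))) qm_Bphi.
by rewrite /GRing.scale /= mulrC.
Qed.

Lemma Atilde_scaleD (a : K) u v : D u -> D v ->
  Atilde rs (a *: u + v) = a *: Atilde rs u + Atilde rs v.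
Proof.
move=> Du Dv; rewrite /Atilde (linop_scaleD domA) //.
rewrite scalerDr addrACA; congr (_ + _); rewrite scaler_sumr -big_split.
apply: eq_bigr => i _ /=.
by rewrite (beta_bdd (range1 rs i)).1 scalerDl scalerA.
Qed.

Lemma Atilde_inj0 x : D x -> Atilde rs x = 0 -> x = 0.
Proof.
move=> Dx Ax; have rm i : (1 <= m i <= m i)%N by rewrite mult_gt0 leqnn.
have bx k : beta k 1 x = 0.
  by rewrite -qm_Atilde // Ax (bdd0 (q_bdd (rm k))).
have Ax0 : A x = 0.
  by move: Ax; rewrite /Atilde big1 ?addr0 // => i _; rewrite bx scale0r.
by rewrite -(ker_P20 rs Dx Ax0); apply: big1 => i _; rewrite bx scale0r.
Qed.

Lemma Atilde_inj u v : D u -> D v -> Atilde rs u = Atilde rs v -> u = v.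
Proof.
move=> Du Dv uv; apply/eqP; rewrite -subr_eq0; apply/eqP; apply: Atilde_inj0; first exact: DsetB.
by rewrite addrC -scaleN1r Atilde_scaleD // uv scaleN1r addNr.
Qed.

End RootSpace.

(** * Conditions 2A and 2B *)

Section ContractionCondition.
Context {R : realType} {c : bool} {X Y : completeNormedModType (scal R c)}.
Context {A B : linop X Y} {n nu : nat} (rs : root_system A B n nu).
Hypotheses (A_sub_B : dom A `<=` dom B).
Variable f : R -> X -> Y.
Local Notation K := (scal R c).
Local Notation D := (Dset A B).
Local Notation domB := (@Dset_domB R c X Y A B).

Definition residual (t : R) (x : X) : Y := Q2s rs (f t x - B x).

Lemma D20P z : D20 rs z <-> P20 rs z = z.
Proof.
split=> [[x Dx <-]|Pz]; first exact: P20_P20.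
by exists z => //; rewrite -Pz; exact: P20_D.
Qed.

Lemma D20_D z : D20 rs z -> D z.
Proof. by move=> /D20P <-; exact: P20_D. Qed.

Lemma D20B y z : D20 rs y -> D20 rs z -> D20 rs (y - z).
Proof. by move=> /D20P yP /D20P zP; apply/D20P; rewrite (bddB _ _ (P20_bdd rs)) yP zP. Qed.

Lemma Y2sP y : Y2s rs y <-> Q2s rs y = y.
Proof. by split=> [[z _ <-]|yE]; [exact: Q2s_Q2s|exists y]. Qed.

Lemma residual_Y2s t x : Y2s rs (residual t x).
Proof. by exists (f t x - B x). Qed.

Lemma Y2sB y z : Y2s rs y -> Y2s rs z -> Y2s rs (y - z).
Proof. by move=> /Y2sP yP /Y2sP zP; apply/Y2sP; rewrite (bddB _ _ (Q2s_bdd rs)) yP zP. Qed.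

(** [Q2s] after [B] reads only the coefficients at chain ends, so the component [P1 x] drops out.
    This reconciles [F2s], where [B] acts on [x2S + x20], with the residual. *)
Lemma Q2s_B_P2S_P20 x : D x -> Q2s rs (B (P2S rs x + P20 rs x)) = Q2s rs (B x).
Proof.
move=> Dx; apply: eq_bigr => k _; congr (_ *: _).
have km : (1 <= mult rs k <= mult rs k)%N by rewrite mult_gt0 leqnn.
have bk := beta_bdd (rs := rs) km.
rewrite -!betaE //; last by apply: DsetD; [exact: P2S_D|exact: P20_D].
rewrite addrC -P2E /P2 (bdd_sum _ _ _ bk).
rewrite (bigD1 k) //= [X in _ + X]big1 ?addr0; last first.
  move=> i ik; rewrite (bdd_sum _ _ _ bk) big_nat_cond; apply: big1 => j.
  rewrite andbT ltnS => ij; rewrite (bddZ _ _ bk) beta_phi // (negbTE ik).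
  by rewrite scaler0.
rewrite (bdd_sum _ _ _ bk) big_nat_recr ?mult_gt0 //= big_nat_cond big1 ?add0r.
  by rewrite (bddZ _ _ bk) beta_phi // !eqxx /GRing.scale /= mulr1.
move=> j; rewrite andbT => /andP[j1 jm].
rewrite (bddZ _ _ bk) beta_phi //; last by rewrite j1 ltnW.
by rewrite (ltn_eqF jm) andbF scaler0.
Qed.

Lemma F2sE t v z : D v -> P20 rs v = 0 -> D20 rs z ->
  F2s rs f t (P1 rs v) (P2S rs v) z = residual t (v + z).
Proof.
move=> Dv Pv Dz; have zP : P20 rs z = z by exact/D20P.
rewrite /F2s /residual P1_P2S Pv subr0 (bddB _ _ (Q2s_bdd rs)); congr (_ - _).
have Dvz : D (v + z) by apply: DsetD => //; exact: D20_D.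
rewrite -(Q2s_B_P2S_P20 Dvz); congr (Q2s rs (B (_ + _))).
  by rewrite (bddD _ _ (P2S_bdd rs)) -zP P2S_P20 addr0.
by rewrite (bddD _ _ (P20_bdd rs)) Pv add0r zP.
Qed.

Lemma L0_residual t x : L0 rs f t x -> residual t x = 0.
Proof. by case. Qed.

(** A map of finite rank: [B] only acts on the finitely many vectors [phi i 1]. *)
Lemma BP20_bdd : bdd (fun x => B (P20 rs x)).
Proof.
rewrite (_ : (fun x => _) = (fun x => \sum_(i < n) adjoint B (qf rs i 1) x *: B (phi rs i 1))).
  by apply: bdd_bigsum => i _; apply: bdd_rank1; apply: beta_bdd; exact: range1.
apply/funext => x; rewrite (linop_sum domB).
  by apply: eq_bigr => i _; rewrite (linopZ domB) //; exact: (phi1_ker rs i).1.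
by move=> i _; apply: DsetZ; exact: (phi1_ker rs i).1.
Qed.

(** The common consequence of 2A and 2B. Here [v] stands for [x_1 + x_2S], expressed by [P20 v = 0],
    and one radius [d] serves all variables. *)
Definition contraction_condition (Winv : R -> X -> Y -> X) : Prop :=
  forall t' x', L0 rs f t' x' -> exists d k : R, [/\ 0 < d, 0 <= k, k < 1 &
    forall t v y z, 0 <= t -> D v -> P20 rs v = 0 -> D20 rs y -> D20 rs z ->
      `|t - t'| < d -> nrm (v - (x' - P20 rs x')) < d ->
      nrm (y - P20 rs x') < d -> nrm (z - P20 rs x') < d ->
      nrm (y - z - Winv t' x' (residual t (v + y) - residual t (v + z))) <= k * nrm (y - z)].

Variables (Wop : R -> X -> X -> Y) (Winv : R -> X -> Y -> X).

Lemma Winv_bound t' x' : boundedL (Y2s rs) (D20 rs) (Winv t' x') ->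
  exists2 M : R, 0 <= M & forall y, Y2s rs y -> nrm (Winv t' x' y) <= M * nrm y.
Proof.
move=> [_ _ [M HM]]; exists `|M| => // y Yy; apply: le_trans (HM y Yy) _.
by apply: ler_wpM2r; [exact: nrm_ge0|exact: ler_norm].
Qed.

Lemma WinvB t' x' y z : boundedL (Y2s rs) (D20 rs) (Winv t' x') -> Y2s rs y -> Y2s rs z ->
  Winv t' x' (y - z) = Winv t' x' y - Winv t' x' z.
Proof.
move=> [_ W_lin _] Yy Yz.
by have := W_lin (-1) z y Yz Yy; rewrite !scaleN1r addrC => ->; rewrite addrC.
Qed.

Lemma opnorm_le t' x' y : boundedL (Y2s rs) (D20 rs) (Winv t' x') -> Y2s rs y ->
  nrm (Winv t' x' y) <= opnorm (Y2s rs) (Winv t' x') * nrm y.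
Proof.
move=> bW Yy; have [M M0 HM] := Winv_bound bW.
have [y0|y0] := eqVneq (nrm y) 0.
  by have := HM y Yy; rewrite y0 !mulr0.
have ny : 0 < nrm y by rewrite lt_neqAle eq_sym y0 nrm_ge0.
pose u := ofR c (nrm y)^-1 *: y.
have yP : Q2s rs y = y by exact/Y2sP.
have Yu : Y2s rs u by apply/Y2sP; rewrite (bddZ _ _ (Q2s_bdd rs)) yP.
have nu1 : nrm u = 1 by rewrite nrmZ gtr0_norm ?invr_gt0 // mulVf.
have Wu : Winv t' x' u = ofR c (nrm y)^-1 *: Winv t' x' y.
  have [_ W_lin _] := bW.
  have Y0 : Y2s rs 0 by apply/Y2sP; rewrite (bdd0 (Q2s_bdd rs)).
  have W0 : Winv t' x' 0 = 0 by have := WinvB bW Y0 Y0; rewrite !subrr.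
  by rewrite -[u]addr0 W_lin // W0 addr0.
rewrite -ler_pdivrMr // mulrC.
have -> : (nrm y)^-1 * nrm (Winv t' x' y) = nrm (Winv t' x' u).
  by rewrite Wu nrmZ gtr0_norm ?invr_gt0.
apply: ub_le_sup; last by exists u => //; split=> //; rewrite nu1.
exists M => _ [z [Yz z1] <-]; apply: le_trans (HM z Yz) _.
by rewrite ler_piMr.
Qed.

(** Applying [Winv] to the estimate of 2A multiplies it by the operator norm, and the limit of [q]
    is below the inverse of that norm. *)
Lemma condition_2A_contraction : condition_2A rs f Wop Winv -> contraction_condition Winv.
Proof.
move=> [_ inv H2A] t' x' L; have [bWop [q [l [Hq ql l_lt]]]] := H2A t' x' L.
have [[WD WD' WK WK'] bW] := inv t' x' L.
pose N := opnorm (Y2s rs) (Winv t' x').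
have N0 : 0 <= N.
  apply: ub_le_sup; last first.
    exists 0.
      by split; [apply/Y2sP; rewrite (bdd0 (Q2s_bdd rs))|rewrite nrm0].
    have Y0 : Y2s rs 0 by apply/Y2sP; rewrite (bdd0 (Q2s_bdd rs)).
    have W0 : Winv t' x' 0 = 0 by have := WinvB bW Y0 Y0; rewrite !subrr.
    by rewrite W0 nrm0.
  have [M M0 HM] := Winv_bound bW.
  exists M => _ [z [Yz z1] <-]; apply: le_trans (HM z Yz) _.
  by rewrite ler_piMr.
(* For [N = 0] the inverse has the default value [0], hence a separate case. Otherwise [q0] is taken
   halfway between [l] and [N^-1], with [l] replaced by [0] if negative so that [k >= 0]. *)
have [q0 [k [k0 k1 lq0 Nq0]]] : exists q0 k : R, [/\ 0 <= k, k < 1, l < q0 & N * q0 <= k].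
  have [NE|Npos] := eqVneq N 0.
    by exists (l + 1), 0; rewrite NE mul0r; split=> //; rewrite ltrDl.
  have Ngt0 : 0 < N by rewrite lt_neqAle eq_sym Npos.
  pose q1 := Num.max l 0.
  have q1N : q1 < N^-1 by rewrite gt_max l_lt invr_gt0.
  have q10 : 0 <= q1 by rewrite le_max lexx orbT.
  have lq1 : l <= q1 by rewrite le_max lexx.
  exists ((q1 + N^-1) / 2), (N * ((q1 + N^-1) / 2)); split=> //.
  - by rewrite mulr_ge0 // divr_ge0 // addr_ge0 // invr_ge0.
  - by rewrite -[X in _ < X](mulfV Npos) ltr_pM2l //; lra.
  - lra.
have qnear : \forall p \near radii_to0, q p.1 p.2 < q0.
  have FF : Filter (@radii_to0 R) by rewrite /radii_to0; typeclasses eauto.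
  exact: (@cvgr_lt R _ _ FF _ l ql q0 lq0).
have [d d0 Hd] : exists2 d : R, 0 < d & forall t x1 x2S y z,
    0 <= t -> D1 rs x1 -> D2S rs x2S -> D20 rs y -> D20 rs z ->
    `|t - t'| < d -> nrm (x1 - P1 rs x') < d -> nrm (x2S - P2S rs x') < d ->
    nrm (y - P20 rs x') < d -> nrm (z - P20 rs x') < d ->
    nrm (F2s rs f t x1 x2S y - F2s rs f t x1 x2S z - Wop t' x' (y - z)) <= q0 * nrm (y - z).
  have := filterI Hq qnear.
  move=> [[S1 S4] /= [[[S12 S3] /= [[[S1' S2] /= [n1 n2] s12] n3] s123] n4] sub].
  have near_pos (S : set R) : nbhs (0 : R)^'+ S -> exists2 e : R, 0 < e & forall s, 0 < s < e -> S s.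
    move=> /nbhs_ballP[e /= e0 He]; exists e => // s /andP[s0 se].
    by apply: He => //; rewrite -ball_normE /= sub0r normrN gtr0_norm.
  have [e1 e10 H1] := near_pos _ n1; have [e2 e20 H2] := near_pos _ n2.
  have [e3 e30 H3] := near_pos _ n3; have [e4 e40 H4] := near_pos _ n4.
  (* Convergence in the four radii allows one common value for all of them. *)
  have [mm [m0 a1 a2 a3 a4]] : exists mm : R, [/\ 0 < mm, mm <= e1, mm <= e2, mm <= e3 & mm <= e4].
    exists (Num.min (Num.min e1 e2) (Num.min e3 e4)).
    by rewrite !lt_min e10 e20 e30 e40 !ge_min !lexx !orbT.
  pose d := mm / 2.
  have d0 : 0 < d by rewrite divr_gt0.
  have dm : d < mm by rewrite ltr_pdivrMr // ltr_pMr // ltr1n.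
  have in_range (e : R) : mm <= e -> 0 < d < e by move=> me; rewrite d0 (lt_le_trans dm me).
  have Sd : (S1 `*` S4) ((d, d, d), d).
    split=> /=; last by apply: H4; exact: in_range.
    apply: s123; split=> /=; last by apply: H3; exact: in_range.
    by apply: s12; split=> /=; [apply: H1|apply: H2]; exact: in_range.
  have [/= Hp qp] := sub _ Sd.
  exists d => // t x1 x2S y z t0 D1x D2x Dy Dz tt xx1 xx2 yy zz.
  apply: le_trans (Hp t x1 x2S y z t0 D1x D2x Dy Dz tt xx1 xx2 yy zz) _.
  by apply: ler_wpM2r; [exact: nrm_ge0|exact: ltW].
have [_ [M1 M10 HM1]] := P1_bdd rs; have [_ [M2 M20 HM2]] := P2S_bdd rs.
(* The neighbourhoods of 2A concern [x_1] and [x_2S] separately; closeness of [v] passes to them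
   through the bounds of [P1] and [P2S]. *)
pose d' := d / (1 + M1 + M2).
have sM : 0 < 1 + M1 + M2 by lra.
have d'0 : 0 < d' by rewrite divr_gt0.
have d'd : d' * (1 + M1 + M2) = d by rewrite /d' divfK // gt_eqF.
exists d', k; split=> // t v y z t0 Dv Pv Dy Dz tt vv yy zz.
have Dyz := D20B Dy Dz.
have vE (P : X -> X) : bdd P -> (forall x, P (P20 rs x) = 0) ->
    P v - P x' = P (v - (x' - P20 rs x')).
  by move=> bP P0; rewrite !(bddB _ _ bP) P0 subr0.
have YF := residual_Y2s t.
have E : y - z - Winv t' x' (residual t (v + y) - residual t (v + z)) =
  - Winv t' x' (residual t (v + y) - residual t (v + z) - Wop t' x' (y - z)).
  by rewrite [in RHS](WinvB bW) ?WK ?opprB //; [exact: Y2sB|exact: WD].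
rewrite E nrmN; apply: le_trans (opnorm_le bW _) _; first by apply: Y2sB; [exact: Y2sB|exact: WD].
have := Hd t (P1 rs v) (P2S rs v) y z t0 _ _ Dy Dz.
rewrite !F2sE // => Hd'.
have {}Hd' : nrm (residual t (v + y) - residual t (v + z) - Wop t' x' (y - z)) <= q0 * nrm (y - z).
  apply: Hd'; rewrite -?/N.
  - by exists v.
  - by exists v.
  - nra.
  - rewrite (vE _ (P1_bdd rs) (P1_P20 rs)); apply: le_lt_trans (HM1 _) _; nra.
  - rewrite (vE _ (P2S_bdd rs) (P2S_P20 rs)); apply: le_lt_trans (HM2 _) _; nra.
  - nra.
  - nra.
apply: le_trans (ler_wpM2l N0 Hd') _; rewrite mulrA; apply: ler_wpM2r => //.
exact: nrm_ge0.
Qed.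

End ContractionCondition.

Section DerivativeCondition.
Context {R : realType} {c : bool} {X Y : completeNormedModType (scal R c)}.
Context {A B : linop X Y} {n nu : nat} (rs : root_system A B n nu).
Variable f : R -> X -> Y.
Local Notation K := (scal R c).
Local Notation D := (Dset A B).
Local Notation domB := (@Dset_domB R c X Y A B).

Let boundedLZ (S : set X) (T : X -> Y) (a : K) h : Defs.subspace S -> boundedL S setT T -> S h ->
  T (a *: h) = a *: T h.
Proof.
move=> [S0 _] [_ T_lin _] Sh.
have T0 : T 0 = 0.
  exact: linear_fun0 (T_lin 1 0 0 S0 S0).
by rewrite -[a *: h]addr0 T_lin // T0 addr0.
Qed.

Let Dsub : Defs.subspace D.
Proof. by split; [exact: Dset0|move=> a u v; exact: Dset_scaleD]. Qed.

Lemma frechet_deriv_on (t : R) (df : X -> X -> Y) (v h : X) (J : set R) (s : R) :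
  (forall x, D x -> is_frechet D (f t) x (df x)) -> D v -> D h ->
  deriv_on J (fun r : R => f t (v + ofR c r *: h) : rl Y) s (df (v + ofR c s *: h) h : rl Y).
Proof.
move=> Hdf Dv Dh e e0.
have Dr (r : R) : D (v + ofR c r *: h) by apply: DsetD => //; exact: DsetZ.
have [bdf Hd] := Hdf _ (Dr s).
have h0 := nrm_ge0 h; have h1 : 0 < nrm h + 1 by lra.
have [d d0 {}Hd] := Hd (e / (nrm h + 1)) (divr_gt0 e0 h1).
exists (d / (nrm h + 1)) => [|r _]; first exact: divr_gt0.
rewrite ltr_pdivlMr // => rs_d.
have := Hd (ofR c (r - s) *: h) (DsetZ _ Dh).
rewrite nrmZ => /(_ ltac:(have := normr_ge0 (r - s); nra)).
rewrite (boundedLZ _ Dsub bdf Dh).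
have -> : v + ofR c s *: h + ofR c (r - s) *: h = v + ofR c r *: h.
  by rewrite -addrA -scalerDl -ofRD; congr (_ + ofR c _ *: _); ring.
move=> /le_trans; apply.
rewrite (_ : e / _ * _ = e * `|r - s| * (nrm h / (nrm h + 1))); last by ring.
rewrite ler_piMr ?mulr_ge0 ?(ltW e0) //.
by rewrite ler_pdivrMr // mul1r lerDl.
Qed.

(** Mean value inequality along the segment from [v] to [u] for [f t] minus the fixed linear map
    [df t' x']. It gives strict differentiability, uniformly in [t] near [t']. *)
Lemma frechet_increment (df : R -> X -> X -> Y) :
  (forall t x, 0 <= t -> D x -> is_frechet D (f t) x (df t x)) ->
  (forall t' x', 0 <= t' -> D x' -> forall e : R, 0 < e ->
     exists2 d : R, 0 < d & forall t x, 0 <= t -> D x ->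
       `|t - t'| < d -> nrm (x - x') < d ->
       forall h, D h -> nrm (df t x h - df t' x' h) <= e * nrm h) ->
  forall t' x', 0 <= t' -> D x' -> forall e : R, 0 < e -> exists2 d : R, 0 < d &
    forall t u v, 0 <= t -> D u -> D v -> `|t - t'| < d ->
      nrm (u - x') < d -> nrm (v - x') < d ->
      nrm (f t u - f t v - df t' x' (u - v)) <= e * nrm (u - v).
Proof.
move=> Hdf Hc t' x' t'0 Dx' e e0; have [d d0 Hd] := Hc t' x' t'0 Dx' e e0.
exists d => // t u v t0 Du Dv tt ud vd.
pose h := u - v; have Dh : D h by exact: DsetB.
pose L : rl Y := df t' x' h.
pose g (r : R) : rl Y := (f t (v + ofR c r *: h) : rl Y) - r *: L.
have Ej (r : R) : deriv_on [set s | 0 <= s <= 1] (fun s : R => s *: L) r L.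
  by move=> e1 e10; exists 1 => // s _ _; rewrite -scalerBl subrr normr0 mulr_ge0 // ltW.
have : `|g 1 - g 0| <= e * nrm h * (1 - 0).
  apply: deriv_on_le; first exact: ler01.
  move=> r /andP[r0 r1].
  exists ((df t (v + ofR c r *: h) h : rl Y) - L).
    apply: deriv_onB; last exact: Ej.
    by apply: frechet_deriv_on => // x Dx; exact: Hdf.
  apply: Hd => //; first by apply: DsetD => //; exact: DsetZ.
  have -> : v + ofR c r *: h - x' = ofR c (1 - r) *: (v - x') + ofR c r *: (u - x').
    rewrite /h ofRD ofRN ofR1; module (scal R c).
  apply: le_lt_trans (nrmD _ _) _; rewrite !nrmZ !ger0_norm ?subr_ge0 //.
  (* The strict inequality needs a weight known to be positive: [1 - r] in the first case, [r] in
     the second. *)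
  have [r12|r12] := leP r (1 / 2).
    have := ler_wpM2l r0 (ltW ud).
    have : (1 - r) * nrm (v - x') < (1 - r) * d by rewrite ltr_pM2l //; lra.
    lra.
  have := ler_wpM2l (_ : 0 <= 1 - r) (ltW vd); rewrite subr_ge0 => /(_ r1).
  have : r * nrm (u - x') < r * d by rewrite ltr_pM2l //; lra.
  lra.
rewrite subr0 mulr1; congr (nrm _ <= _).
rewrite /g scale1r scale0r subr0 ofR1 ofR0 scale1r scale0r addr0.
have -> : v + h = u by rewrite /h addrC subrK.
by rewrite addrAC.
Qed.

Lemma continuous_partial_lipschitz : continuous_partial (A := A) (B := B) f ->
  locally_lipschitz (A := A) (B := B) f.
Proof.
move=> [df [Hdf Hc]] t' x' t'0 Dx'.
have [d d0 Hd] := frechet_increment Hdf Hc t'0 Dx' ltr01.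
have [[_ df_lin [M HM]] _] := Hdf t' x' t'0 Dx'.
exists d, (1 + `|M|); split=> //.
move=> t u v t0 tt Du Dv ud vd; have := Hd t u v t0 Du Dv tt ud vd.
have := HM (u - v) (DsetB Du Dv).
rewrite -[X in nrm X <= (1 + _) * _](subrK (df t' x' (u - v))) => h1 h2.
apply: le_trans (nrmD _ _) _.
have := ler_wpM2r (nrm_ge0 (u - v)) (ler_norm M); lra.
Qed.

Lemma condition_2B_contraction (Wop : R -> X -> X -> Y) (Winv : R -> X -> Y -> X) :
  condition_2B rs f Wop Winv -> contraction_condition rs f Winv.
Proof.
move=> [[df [Hdf Hc]] inv HW] t' x' L.
have [t'0 Dx' Rx'] := L.
have [T [bT HT] WT] := HW t' x' L.
have [[WD WD' WK WK'] bW] := inv t' x' L.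
have [M M0 HM] := Winv_bound bW.
have [_ [N N0 HN]] := Q2s_bdd rs.
have [bdf Hdf'] := Hdf t' x' t'0 Dx'.
(* [T] is given separately as a derivative of [Q2s f]; this is the uniqueness of the derivative. *)
have TE h : D h -> T h = Q2s rs (df t' x' h).
  move=> Dh; apply/eqP; rewrite -subr_eq0; apply/eqP; apply: nrm_eq0; apply/eqP.
  rewrite eq_le nrm_ge0 andbT; apply/ler_addgt0Pr => e e0; rewrite add0r.
  pose e1 := e / ((1 + N) * (nrm h + 1)).
  have h0 := nrm_ge0 h.
  have h1 : 0 < nrm h + 1 by lra.
  have N1 : 0 < 1 + N by lra.
  have e10 : 0 < e1 by rewrite divr_gt0 // mulr_gt0.
  have [d1 d10 H1] := HT e1 e10; have [d2 d20 H2] := Hdf' e1 e10.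
  pose s := Num.min d1 d2 / 2 / (nrm h + 1).
  have m0 : 0 < Num.min d1 d2 by rewrite lt_min d10.
  have s0 : 0 < s by rewrite !divr_gt0.
  have sh : nrm (ofR c s *: h) < Num.min d1 d2.
    rewrite nrmZ gtr0_norm // /s mulrAC ltr_pdivrMr //.
    have : Num.min d1 d2 / 2 * nrm h <= Num.min d1 d2 / 2 * (nrm h + 1).
      by rewrite ler_pM2l ?divr_gt0 // lerDl.
    have := mulr_gt0 m0 h1; lra.
  move: sh; rewrite lt_min => /andP[sh1 sh2].
  have Dsh : D (ofR c s *: h) by exact: DsetZ.
  have := H1 _ Dsh sh1; have := H2 _ Dsh sh2.
  rewrite (boundedLZ _ Dsub bT Dh) (boundedLZ _ Dsub bdf Dh) nrmZ gtr0_norm //.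
  set a := f t' _; set b := f t' _ => h2 h3.
  have h4 := le_trans (HN _) (ler_wpM2l N0 h2).
  move: h4; rewrite !(bddB _ _ (Q2s_bdd rs)) (bddZ _ _ (Q2s_bdd rs)) => h4.
  have h5 : s * nrm (T h - Q2s rs (df t' x' h)) <= s * ((1 + N) * e1 * nrm h).
    rewrite -[X in X * _](gtr0_norm s0) -nrmZ scalerBr.
    rewrite (_ : _ - _ = (Q2s rs a - Q2s rs b - ofR c s *: Q2s rs (df t' x' h)) -
      (Q2s rs a - Q2s rs b - ofR c s *: T h)); last by module (scal R c).
    by apply: le_trans (nrmB _ _) _; lra.
  rewrite ler_pM2l // in h5; apply: le_trans h5 _.
  rewrite (_ : (1 + N) * e1 * nrm h = e * (nrm h / (nrm h + 1))); last first.
    by rewrite /e1; field; rewrite !gt_eqF.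
  by rewrite ler_piMr ?(ltW e0) // ler_pdivrMr // mul1r lerDl.
(* Makes [M * N * e <= 1 / 2], so the contraction constant is 1/2. *)
pose e := (2 * (M * N + 1))^-1.
have MN := mulr_ge0 M0 N0.
have e0 : 0 < e by rewrite invr_gt0; lra.
have MNe : M * N * e <= 2^-1 by rewrite ler_pdivrMr; lra.
have [d d0 Hd] := frechet_increment Hdf Hc t'0 Dx' e0.
exists (d / 2), 2^-1; split=> //; [lra|lra|].
move=> t v y z t0 Dv Pv Dy Dz tt vv yy zz.
have Dyz := D20B Dy Dz.
have Dvy : D (v + y) by apply: DsetD => //; exact: (D20_D (rs := rs)).
have Dvz : D (v + z) by apply: DsetD => //; exact: (D20_D (rs := rs)).
have near (w : X) : nrm (w - P20 rs x') < d / 2 -> nrm (v + w - x') < d.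
  move=> ww; rewrite (_ : v + w - x' = (v - (x' - P20 rs x')) + (w - P20 rs x')); last by module (scal R c).
  by apply: le_lt_trans (nrmD _ _) _; lra.
have := Hd t (v + y) (v + z) t0 Dvy Dvz ltac:(lra) (near y yy) (near z zz).
have -> : v + y - (v + z) = y - z by module (scal R c).
move=> h1.
have YF := residual_Y2s rs f t.
have E : y - z - Winv t' x' (residual rs f t (v + y) - residual rs f t (v + z)) =
  - Winv t' x' (residual rs f t (v + y) - residual rs f t (v + z) - Wop t' x' (y - z)).
  by rewrite [in RHS](WinvB bW) ?WK ?opprB //; [exact: Y2sB|exact: WD].
rewrite E nrmN; apply: le_trans (HM _ _) _; first by apply: Y2sB; [exact: Y2sB|exact: WD].
have -> : residual rs f t (v + y) - residual rs f t (v + z) - Wop t' x' (y - z) =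
    Q2s rs (f t (v + y) - f t (v + z) - df t' x' (y - z)).
  have yzP : P20 rs (y - z) = y - z by exact/D20P.
  rewrite WT // yzP TE; last exact: (D20_D (rs := rs)).
  rewrite /residual !(bddB _ _ (Q2s_bdd rs)).
  have -> : Q2s rs (B (y - z)) = Q2s rs (B (v + y)) - Q2s rs (B (v + z)).
    rewrite -(bddB _ _ (Q2s_bdd rs)) -(linopB domB Dvy Dvz); congr (Q2s rs (B _)).
    by module (scal R c).
  by module (scal R c).
apply: le_trans (ler_wpM2l M0 (HN _)) _.
apply: le_trans (ler_wpM2l M0 (ler_wpM2l N0 h1)) _.
rewrite !mulrA; apply: ler_wpM2r => //; exact: nrm_ge0.
Qed.

End DerivativeCondition.

(** * Lyapunov functionals *)

Lemma finite_radius {R : realType} (m : nat) (P : 'I_m -> R -> Prop) :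
  (forall i (d d' : R), d <= d' -> P i d' -> P i d) ->
  (forall i, exists2 d : R, 0 < d & P i d) -> exists2 d : R, 0 < d & forall i, P i d.
Proof.
move=> Pmono Pex.
have [d Hd] : {d : 'I_m -> R & forall i, 0 < d i /\ P i (d i)}.
  apply: (@choice _ _ (fun i d => 0 < d /\ P i d)) => i.
  by have [d] := Pex i; exists d.
exists (\big[Num.min/1]_(i < m) d i) => [|i].
  by apply/bigmin_gtP; split=> // i _; exact: (Hd i).1.
by apply: Pmono (Hd i).2; exact: bigmin_le.
Qed.

Section LyapunovFunctional.
Context {R : realType} {E : completeNormedModType R}.
Variable S : set E.
Hypotheses (S_sub : forall x y, S x -> S y -> S (x - y))
  (S_scale : forall (a : R) x, S x -> S (a *: x)).
Variables (R0 : R) (m : nat) (V_ : 'I_m -> E -> R) (dV : 'I_m -> E -> E -> R) (V : E -> R).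
Hypotheses (VE : forall w, S w -> V w = \big[Num.max/0]_(i < m) V_ i w)
  (dV_lin : forall i w, S w -> R0 <= `|w| -> forall (a : R) u v, S u -> S v ->
     dV i w (a *: u + v) = a * dV i w u + dV i w v)
  (dV_bdd : forall i w, S w -> R0 <= `|w| ->
     exists M : R, forall h, S h -> `|dV i w h| <= M * `|h|)
  (V_diff : forall i w, S w -> R0 <= `|w| -> forall e : R, 0 < e -> exists2 d : R, 0 < d &
     forall h, S h -> `|h| < d -> `|V_ i (w + h) - V_ i w - dV i w h| <= e * `|h|).

Lemma V_le w (y : R) : S w -> 0 <= y -> (forall i, V_ i w <= y) -> V w <= y.
Proof. by move=> Sw y0 Vy; rewrite VE //; apply/bigmax_leP; split. Qed.

Lemma V_ge w i : S w -> V_ i w <= V w.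
Proof. by move=> Sw; rewrite VE //; apply: le_bigmax. Qed.

Lemma V_nonneg w : S w -> 0 <= V w.
Proof. by move=> Sw; rewrite VE //; apply: bigmax_ge_id. Qed.

Let dV_bound i w : S w -> R0 <= `|w| ->
  exists2 M : R, 0 <= M & forall h, S h -> `|dV i w h| <= M * `|h|.
Proof.
move=> Sw wR; have [M HM] := dV_bdd i Sw wR; exists `|M| => // h Sh.
by apply: le_trans (HM h Sh) _; apply: ler_wpM2r => //; exact: ler_norm.
Qed.

(** Over a time [tau] a solution moves by some [k] close to [tau *: g]. The error of
    differentiability and the effect of [k - tau *: g] take [e / 2 * tau] each. *)
Lemma V_increment i w g (e : R) : S w -> R0 <= `|w| -> S g -> 0 < e ->
  exists2 d : R, 0 < d & forall k (tau : R), S k -> 0 <= tau -> `|k| < d ->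
    `|k - tau *: g| <= d * tau -> V_ i (w + k) <= V_ i w + (dV i w g + e) * tau.
Proof.
move=> Sw wR Sg e0; have [M M0 HM] := dV_bound i Sw wR.
have g0 := normr_ge0 g.
have e10 : 0 < e / 2 / (`|g| + 1) by rewrite !divr_gt0 //; lra.
have [d d0 Hd] := V_diff i Sw wR e10.
have M1 : 0 < M + 1 by lra.
have e20 : 0 < e / 2 / (M + 1) by rewrite !divr_gt0.
pose h := Num.min (Num.min d 1) (e / 2 / (M + 1)).
have h0 : 0 < h by rewrite !lt_min d0 e20 ltr01.
have [hd h1 hM] : [/\ h <= d, h <= 1 & h * (M + 1) <= e / 2].
  by rewrite -ler_pdivlMr // /h !ge_min !lexx !orbT.
clearbody h; exists h => // k tau Sk tau0 kh ktau.
have So : S (k - tau *: g) by apply: S_sub => //; exact: S_scale.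
have kE : k = tau *: g + (k - tau *: g) by module R.
have := le_trans (ler_norm _) (Hd k Sk (lt_le_trans kh hd)).
rewrite {2}kE dV_lin //.
have h2 : dV i w (k - tau *: g) <= M * (h * tau).
  by apply: le_trans (ler_norm _) _; apply: le_trans (HM _ So) _; apply: ler_wpM2l.
have h3 : `|k| <= (`|g| + 1) * tau.
  rewrite {1}kE; apply: le_trans (ler_normD _ _) _; rewrite normrZ (ger0_norm tau0).
  have := ler_wpM2r tau0 h1; lra.
have h4 : e / 2 / (`|g| + 1) * `|k| <= e / 2 * tau.
  apply: le_trans (ler_wpM2l (ltW e10) h3) _.
  by rewrite mulrA divfK ?gt_eqF //; lra.
have := ler_wpM2r tau0 hM; have := mulr_ge0 (ltW h0) tau0; lra.
Qed.

Lemma V_cont_eps i w (e : R) : S w -> R0 <= `|w| -> 0 < e -> exists2 d : R, 0 < d &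
  forall k, S k -> `|k| < d -> `|V_ i (w + k) - V_ i w| <= e.
Proof.
move=> Sw wR e0; have [M M0 HM] := dV_bound i Sw wR.
have [d d0 Hd] := V_diff i Sw wR ltr01.
have M1 : 0 < M + 1 by lra.
exists (Num.min d (e / (M + 1))) => [|k Sk]; first by rewrite lt_min d0 divr_gt0.
rewrite lt_min => /andP[kd]; rewrite ltr_pdivlMr // => ke.
have := Hd k Sk kd; rewrite mul1r => h1; have h2 := HM k Sk.
rewrite -[V_ i (w + k) - V_ i w](subrK (dV i w k)).
by apply: le_trans (ler_normD _ _) _; lra.
Qed.

Variables (U psi : R -> R).
Hypotheses (U_cont : {within [set u : R | 0 <= u], continuous U})
  (U_ge0 : forall u : R, 0 <= u -> 0 <= U u)
  (psi_ge0 : forall t : R, 0 <= t -> 0 <= psi t)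
  (psi_int : integrable_on_finite_intervals psi)
  (U_div : tail_integral_inv_diverges U)
  (V_infty : forall M : R, exists r : R, forall w, S w -> r <= `|w| -> M <= V w).
Variable G : R -> E -> E.
Hypotheses (S_G : forall (t : R) w, 0 <= t -> S w -> S (G t w))
  (dV_G : forall (t : R) w, 0 <= t -> S w -> R0 <= `|w| -> forall j, V w = V_ j w ->
     dV j w (G t w) <= U (V w) * psi t).

(** Only the indices attaining the maximum at [t] determine its upper right derivative, and [dV_G]
    bounds these. By continuity the others stay below [V (u t)] for a short time. Then [dini_bound]
    bounds [V (u t)], hence [u]. *)
Lemma lyapunov_far (a T : R) (u : R -> E) : 0 <= a -> a < T ->
  (forall t, a <= t < T -> deriv_on [set s | a <= s < T] u t (G t (u t))) ->
  (forall t, a <= t < T -> S (u t)) -> (forall t, a <= t < T -> R0 <= `|u t|) ->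
  exists r : R, forall t, a <= t < T -> `|u t| <= r.
Proof.
move=> a0 aT su Su uR.
pose v t := V (u t).
have uE t s : u t + (u s - u t) = u s by rewrite addrC subrK.
have ucont t (e : R) : a <= t < T -> 0 < e -> exists2 d : R, 0 < d &
    forall s, a <= s < T -> `|s - t| < d -> `|u s - u t| < e.
  move=> atT e0; have [|d d0 Hd] := deriv_on_cont (su t atT) (e := e / 2); first lra.
  by exists d => // s asT st; apply: le_lt_trans (Hd s asT st) _; lra.
have [] := dini_bound U_cont U_ge0 U_div psi_ge0 psi_int (a := a) (T := T) (v := v) a0 aT.
- by move=> t atT; apply: V_nonneg; exact: Su.
- move=> t atT e e0.
  have [i d d' dd H s as_ st|i|d d0 Hd] := finite_radius (P := fun (i : 'I_m) (d : R) =>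
      forall s, a <= s < T -> `|s - t| < d -> `|V_ i (u s) - V_ i (u t)| <= e).
  + exact: H as_ (lt_le_trans st dd).
  + have [d d0 Hd] := V_cont_eps i (Su t atT) (uR t atT) e0.
    have [d1 d10 Hd1] := ucont t d atT d0; exists d1 => // s asT st.
    rewrite -(uE t s); apply: Hd; last exact: Hd1.
    by apply: S_sub; exact: Su.
  + exists d => // s asT st.
    have Ss := Su s asT; have St := Su t atT.
    have vs := V_nonneg Ss; have vt := V_nonneg St.
    rewrite ler_distl /v; apply/andP; split; rewrite ?lerBlDr; apply: V_le => //; try lra.
    * move=> i; have := Hd i s asT st; rewrite ler_distl => /andP[h _].
      have := V_ge i Ss; lra.
    * move=> i; have := Hd i s asT st; rewrite ler_distl => /andP[_ h].
      have := V_ge i St; lra.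
- move=> t atT e e0.
  have t0 : 0 <= t by move: atT => /andP[]; lra.
  have St := Su t atT; have vt := V_nonneg St.
  have Up : 0 <= U (V (u t)) * psi t by apply: mulr_ge0; [exact: U_ge0|exact: psi_ge0].
  have [i d d' dd H s /andP[ts st]|i|d d0 Hd] := finite_radius (P := fun (i : 'I_m) (d : R) =>
      forall s, t < s < t + d -> s < T -> V_ i (u s) <= v t + (U (v t) * psi t + e) * (s - t)).
  + by apply: H; rewrite ts (lt_le_trans st) // lerD2l.
  + have sub s : a <= s < T -> S (u s - u t) by move=> asT; apply: S_sub => //; exact: Su.
    have [Vi|Vi] := eqVneq (V (u t)) (V_ i (u t)).
      have [d d0 Hd] := V_increment i St (uR t atT) (S_G t0 St) e0.
      have [d1 d10 Hd1] := ucont t d atT d0; have [d2 d20 Hd2] := su t atT d d0.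
      exists (Num.min d1 d2) => [|s /andP[ts std] sT]; first by rewrite lt_min d10.
      have asT : a <= s < T by move: atT => /andP[]; lra.
      have st0 : 0 <= s - t by lra.
      have : s - t < Num.min d1 d2 by lra.
      rewrite lt_min => /andP[sd1 sd2].
      have := Hd (u s - u t) (s - t) (sub s asT) st0 (Hd1 s asT ltac:(by rewrite ger0_norm)).
      rewrite uE => /(_ _)/le_trans -> //.
        by have := Hd2 s asT; rewrite ger0_norm //; exact.
      rewrite /v -Vi lerD2l; apply: ler_wpM2r => //; rewrite lerD2r; exact: (dV_G t0 St (uR t atT) Vi).
    have Vlt : V_ i (u t) < V (u t) by rewrite lt_neqAle eq_sym Vi V_ge.
    have [d d0 Hd] := V_cont_eps i St (uR t atT) (e := V (u t) - V_ i (u t)) ltac:(lra).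
    have [d1 d10 Hd1] := ucont t d atT d0.
    exists d1 => // s /andP[ts std] sT.
    have asT : a <= s < T by move: atT => /andP[]; lra.
    have := Hd (u s - u t) (sub s asT) (Hd1 s asT ltac:(rewrite ger0_norm; lra)).
    rewrite uE => /(le_trans (ler_norm _)) h.
    have := mulr_ge0 (addr_ge0 Up (ltW e0)) (ltac:(lra) : 0 <= s - t).
    by rewrite /v; lra.
  + exists d => // s std sT.
    have asT : a <= s < T by move: atT std => /andP[? ?] /andP[]; lra.
    apply: V_le; [exact: Su| |by move=> i; exact: Hd].
    apply: addr_ge0; first by rewrite /v.
    by move: std => /andP[ts _]; apply: mulr_ge0; [rewrite /v; lra|lra].
move=> C HC; have [r Hr] := V_infty (C + 1).
exists r => t atT; rewrite leNgt; apply/negP => ru.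
by have := Hr _ (Su t atT) (ltW ru); have := HC t atT; rewrite /v; lra.
Qed.

Hypothesis G_bdd : forall T r : R, exists M : R, forall (t : R) w,
  0 <= t <= T -> S w -> `|w| <= r -> `|G t w| <= M.

Lemma cont_on_bounded (a b : R) (u : R -> E) : a <= b ->
  (forall t, a <= t <= b -> cont_on [set s | a <= s <= b] u t) ->
  exists M : R, forall t, a <= t <= b -> `|u t| <= M.
Proof.
move=> ab uc.
have near t : a <= t <= b -> exists2 d : R, 0 < d &
    forall s, a <= s <= b -> `|s - t| < d -> `|u s| <= `|u t| + 1.
  move=> atb; have [d d0 Hd] := uc t atb 1 ltr01; exists d => // s asb st.
  rewrite -[u s](subrK (u t)) addrC; apply: le_trans (ler_normD _ _) _.
  by rewrite lerD2l; exact: Hd.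
suff : forall t, a <= t <= b -> exists M : R, forall s, a <= s <= t -> `|u s| <= M.
  by apply; rewrite ab lexx.
apply: real_induction => //.
- exists `|u a| => s /andP[h1 h2]; have -> : s = a by lra.
  exact: lexx.
- move=> t atb /(_ t) []; first by move: atb => /andP[-> _] /=.
  move=> M HM; have [|d d0 Hd] := near t; first by move: atb => /andP[]; lra.
  exists d => // s std sb; exists (Num.max M (`|u t| + 1)) => r /andP[ar rs].
  rewrite le_max; have [rt|tr] := leP r t; first by rewrite HM ?ar.
  rewrite Hd ?orbT //; first lra.
  by move: std => /andP[]; rewrite gtr0_norm; lra.
- move=> t /andP[a_t tb] IH; have [|d d0 Hd] := near t; first lra.
  pose s0 := Num.max a (t - d / 2).
  have [s0a s0t s0d] : [/\ a <= s0, s0 < t & t - d / 2 <= s0].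
    by rewrite /s0 gt_max !le_max !lexx orbT a_t; split=> //=; lra.
  have [|M HM] := IH s0; first by rewrite s0a.
  exists (Num.max M (`|u t| + 1)) => r /andP[ar rt].
  rewrite le_max; have [rs|sr] := leP r s0; first by rewrite HM ?ar.
  rewrite Hd ?orbT //; first lra.
  by rewrite ler0_norm; lra.
Qed.

(** Either [u] stays outside the ball of radius [R0] from some time on, and [lyapunov_far] applies,
    or it is inside at times arbitrarily close to [T]. In the second case its speed in the ball of
    radius [R0 + 1] is bounded, so from a late enough time it cannot leave that larger ball before
    [T]. *)
Lemma lyapunov_bound (a T : R) (u : R -> E) : 0 <= a -> a < T ->
  (forall b, b < T -> sol G [set t | a <= t <= b] u) ->
  (forall t, a <= t < T -> S (u t)) ->
  exists M : R, forall t, a <= t < T -> `|G t (u t)| <= M.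
Proof.
move=> a0 aT su Su.
suff [t1 [r [a1 t1T Hr]]] : exists t1 r : R, [/\ a <= t1, t1 < T &
    forall t, t1 <= t < T -> `|u t| <= r].
  have [r' Hr'] := cont_on_bounded a1 (fun t at1 => deriv_on_cont (su t1 t1T t at1)).
  have [M HM] := G_bdd T (Num.max r r').
  exists M => t /andP[a_t tT]; apply: HM; [by apply/andP; lra|by apply: Su; rewrite a_t|].
  rewrite le_max; have [t1t|tt1] := leP t1 t; first by rewrite Hr // t1t.
  by rewrite Hr' ?orbT // a_t ltW.
have [far|] := pselect (exists2 t1, a <= t1 < T & forall t, t1 <= t < T -> R0 <= `|u t|).
  have [t1 /andP[a1 t1T] far1] := far.
  have [|t /andP[t1t tT]|t /andP[t1t tT]|r Hr] := @lyapunov_far t1 T u _ t1T _ _ far1.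
  - lra.
  - pose b := (t + T) / 2.
    apply: (@deriv_on_near _ _ [set s | a <= s <= b] _ _ _ _ (b - t)); first by rewrite /b; lra.
      move=> s /= /andP[t1s sT] st; have := le_lt_trans (ler_norm _) st; lra.
    by apply: su; rewrite /= /b; lra.
  - by apply: Su; lra.
  by exists t1, r.
move=> Nfar.
have [M0 HM0] := G_bdd T (R0 + 1).
pose M := Num.max M0 0.
have [M00 HM] : 0 <= M /\ forall t w, 0 <= t <= T -> S w -> `|w| <= R0 + 1 -> `|G t w| <= M.
  split=> [|t w tT Sw wR]; first by rewrite le_max lexx orbT.
  by rewrite le_max HM0.
have M1 : 0 < M + 1 by lra.
(* From [t1] to [T] a motion of speed at most [M] covers a distance of at most 1. *)
pose t1 := Num.max a (T - 1 / (M + 1)).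
have i0 : 0 < 1 / (M + 1) by rewrite divr_gt0.
have [a1 t1T t1M] : [/\ a <= t1, t1 < T & (M + 1) * (T - t1) <= 1].
  split; [by rewrite le_max lexx|by rewrite gt_max aT /=; lra|].
  rewrite mulrC -ler_pdivlMr // lerBlDl -lerBlDr.
  by rewrite le_max lexx orbT.
have [t2 t12 ut2] : exists2 t2, t1 <= t2 < T & `|u t2| < R0.
  apply: contrapT => N; apply: Nfar; exists t1; first by rewrite a1.
  by move=> t t1t; rewrite leNgt; apply/negP => ut; apply: N; exists t.
have /andP[h12 h2T] := t12.
exists t2, (R0 + 1); split=> [||t /andP[t2t tT]]; [lra|lra|].
suff : `|u t| < R0 + 1 by exact: ltW.
have su' : sol G [set s | a <= s <= t] u by apply: su.
have ucont s (e : R) : t2 <= s <= t -> 0 < e -> exists2 d : R, 0 < d &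
    forall q, t2 <= q <= t -> `|q - s| < d -> `|u q - u s| <= e.
  move=> s2t e0; have [|d d0 Hd] := deriv_on_cont (su' s _) e0; first by rewrite /=; lra.
  by exists d => // q q2t; apply: Hd; rewrite /=; lra.
apply: (real_induction (P := fun s => `|u s| < R0 + 1) (a := t2) (b := t)); [lra|lra| | |lra].
- move=> s s2t /(_ s) us; have {}us : `|u s| < R0 + 1 by apply: us; lra.
  have [||d d0 Hd] := ucont s ((R0 + 1 - `|u s|) / 2); [lra|lra|].
  exists d => // q sq qt.
  have := Hd q ltac:(lra) ltac:(rewrite gtr0_norm; lra).
  rewrite -{2}[u q](subrK (u s)) => h; apply: le_lt_trans (ler_normD _ _) _; lra.
- move=> s s2t IH.
  have us : `|u s| <= R0 + 1.
    apply/ler_addgt0Pr => e e0; have [|d d0 Hd] := ucont s e _ e0; first lra.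
    pose q := Num.max t2 (s - d / 2).
    have [q2 qs qd] : [/\ t2 <= q, q < s & s - d / 2 <= q].
      by rewrite /q gt_max !le_max !lexx orbT; split=> //=; lra.
    have := Hd q ltac:(lra) ltac:(rewrite ltr0_norm; lra); rewrite distrC => h.
    have := IH q ltac:(lra); rewrite -[u s](subrK (u q)) => h1.
    by apply: le_trans (ler_normD _ _) _; lra.
  have := @deriv_on_le _ _ u t2 s M ltac:(lra) _.
  have step : forall q, t2 <= q <= s ->
      exists2 l, deriv_on [set s0 | t2 <= s0 <= s] u q l & `|l| <= M.
    move=> q q2s; exists (G q (u q)).
      by apply: deriv_onW (su' q _) => [p|] /=; lra.
    apply: HM; [lra|by apply: Su; lra|].
    have [qs|sq] := ltP q s; first by apply: ltW; apply: IH; lra.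
    have -> : q = s by lra.
    exact: us.
  move=> /(_ step) h; rewrite -[u s](subrK (u t2)).
  apply: le_lt_trans (ler_normD _ _) _.
  have : M * (s - t2) <= (M + 1) * (T - t1) by apply: ler_pM; lra.
  by lra.
Qed.

End LyapunovFunctional.

(** * Behaviour of solutions at the initial time *)

Section EndPoint.
Context {R : realType} {E : completeNormedModType R}.
Implicit Types (w g : R -> E).

Lemma jcont_comp (G : R -> E -> E) (J : set R) w (t : R) :
  jcont G -> cont_on J w t -> cont_on J (fun s => G s (w s)) t.
Proof.
move=> Gc wc e e0; have [d d0 Hd] := Gc t (w t) e e0.
have [|d1 d10 Hd1] := wc (d / 2); first lra.
exists (Num.min d d1) => [|s Js]; first by rewrite lt_min d0.
rewrite lt_min => /andP[sd sd1]; apply: Hd => //.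
by apply: le_lt_trans (Hd1 s Js sd1) _; lra.
Qed.

Lemma deriv_on_scale (J : set R) (l : E) (t : R) : deriv_on J (fun s => s *: l) t l.
Proof.
by move=> e e0; exists 1 => // s _ _; rewrite -scalerBl subrr normr0 mulr_ge0 // ltW.
Qed.

(** Over [R_+] the equation is required only for positive times. The derivative at the end point
    follows from the mean value inequality on [[a + h, s]] as [h] tends to [0], by continuity of [w]
    and [g] at [a]. *)
Lemma deriv_on_left_end w g (a b : R) : a < b ->
  (forall t, a < t <= b -> deriv_on [set s | a < s <= b] w t (g t)) ->
  cont_on [set s | a <= s <= b] w a -> cont_on [set s | a <= s <= b] g a ->
  deriv_on [set s | a <= s <= b] w a (g a).
Proof.
move=> ab wg wc gc e e0; have [d d0 Hd] := gc e e0.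
exists d => // s /= /andP[a_s sb] sd.
have [->|sa] := eqVneq s a; first by rewrite !subrr scale0r subr0 !normr0 mulr0.
have {}a_s : a < s by rewrite lt_neqAle eq_sym sa.
have sa0 : 0 < s - a by lra.
rewrite (gtr0_norm sa0) in sd *.
apply/ler_addgt0Pr => e1 e10.
have [|d1 d10 Hd1] := wc (e1 / 2); first lra.
have g0 := normr_ge0 (g a).
have g1 : 0 < `|g a| + 1 by lra.
pose h := Num.min (Num.min (d1 / 2) ((s - a) / 2)) (e1 / 2 / (`|g a| + 1)).
have h0 : 0 < h by rewrite !lt_min !divr_gt0 //; lra.
have [h1 h2 h3] : [/\ h <= d1 / 2, h <= (s - a) / 2 & h * (`|g a| + 1) <= e1 / 2].
  by rewrite -ler_pdivlMr // /h !ge_min !lexx !orbT.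
clearbody h.
have hs := @deriv_on_le _ _ (fun r => w r - r *: g a) (a + h) s e ltac:(lra).
have {}hs : `|w s - s *: g a - (w (a + h) - (a + h) *: g a)| <= e * (s - (a + h)).
  apply: hs => t /andP[aht ts]; exists (g t - g a).
    apply: deriv_onB; last exact: deriv_on_scale.
    by apply: deriv_onW (wg t _) => [r|] /=; lra.
  by apply: Hd; rewrite /= ?gtr0_norm; lra.
have hw := Hd1 (a + h) ltac:(rewrite /=; lra) ltac:(rewrite gtr0_norm; lra).
rewrite (_ : w s - w a - (s - a) *: g a = (w s - s *: g a - (w (a + h) - (a + h) *: g a)) +
  (w (a + h) - w a) - h *: g a); last by module R.
apply: le_trans (ler_normB _ _) _; apply: le_trans (lerD (ler_normD _ _) (lexx _)) _.
rewrite normrZ gtr0_norm //.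
by have := mulr_ge0 (ltW e0) (ltW h0); lra.
Qed.

Lemma sol_left_end (G : R -> E -> E) w (a b : R) : a < b -> jcont G ->
  sol G [set s | a < s <= b] w -> cont_on [set s | a <= s <= b] w a ->
  sol G [set s | a <= s <= b] w.
Proof.
move=> ab Gc sw wc t /= /andP[a_t tb].
have [->|ta] := eqVneq t a.
  exact: (deriv_on_left_end (g := fun s => G s (w s)) ab sw wc (jcont_comp Gc wc)).
have at' : a < t by rewrite lt_neqAle eq_sym ta.
apply: (@deriv_on_near _ _ [set s | a < s <= b] _ _ _ _ (t - a)); first lra.
  by move=> s /= /andP[_ sb] st; have := le_lt_trans (ler_norm _) st; rewrite distrC in st;
    have := le_lt_trans (ler_norm _) st; lra.
by apply: sw; rewrite /= at'.
Qed.

(** Nothing is known at [a], so the estimate runs backwards from [b]: a bound [k + q] improves to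
    [k + q / 2], with [k] the fixed point of this improvement. The starting bound [S] comes from
    compactness of [[t0, b]] and depends on [t0], but it disappears in the limit. *)
Lemma linear_growth_bounded w (a b C N : R) : 0 <= C -> 0 <= N -> N * (b - a) <= 2^-1 ->
  (forall t, a < t <= b ->
     exists2 l, deriv_on [set s | a < s <= b] w t l & `|l| <= C + N * `|w t|) ->
  exists M : R, forall t, a < t <= b -> `|w t| <= M.
Proof.
move=> C0 N0 Nab wl; pose k := 2 * (`|w b| + C * (b - a)).
exists k => t0 /andP[at0 t0b].
have wc t : t0 <= t <= b -> cont_on [set s | t0 <= s <= b] w t.
  move=> tb; have [|l wt _] := wl t; first lra.
  by apply: deriv_on_cont; apply: deriv_onW wt => s /=; lra.
have [S HS] := cont_on_bounded t0b wc.
have S0 : 0 <= S by have := HS t0 ltac:(lra); apply: le_trans.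
have ba : 0 <= b - a by lra.
suff Hn p : forall t, t0 <= t <= b -> `|w t| <= k + S * 2^-1 ^+ p.
  apply/ler_addgt0Pr => e e0; have [p Hp] := half_pow_small S e0.
  by apply: le_trans (Hn p t0 _) _; [lra|rewrite lerD2l].
elim: p => [|p IHp] t tb.
  rewrite expr0 mulr1; have := HS t tb; have := normr_ge0 (w b).
  by have := mulr_ge0 C0 ba; rewrite /k; lra.
have p0 : 0 <= S * 2^-1 ^+ p by rewrite mulr_ge0 // exprn_ge0.
pose q := S * 2^-1 ^+ p.
have k0 : 0 <= k.
  by have := normr_ge0 (w b); have := mulr_ge0 C0 ba; rewrite /k; lra.
have /(_ _) h : (forall s, t <= s <= b -> exists2 l,
    deriv_on [set s | t <= s <= b] w s l & `|l| <= C + N * (k + q)) ->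
    `|w b - w t| <= (C + N * (k + q)) * (b - t).
  by apply: deriv_on_le; lra.
have {}h : `|w b - w t| <= (C + N * (k + q)) * (b - t).
  apply: h => s sb; have [|l wt hl] := wl s; first lra.
  exists l; first by apply: deriv_onW wt => r /=; lra.
  apply: le_trans hl _; rewrite lerD2l; apply: ler_wpM2l => //; apply: IHp; lra.
have h1 : (C + N * (k + q)) * (b - t) <= C * (b - a) + (k + q) * 2^-1.
  have kq : 0 <= k + q by rewrite addr_ge0.
  apply: (@le_trans _ _ ((C + N * (k + q)) * (b - a))).
    by apply: ler_wpM2l; [rewrite addr_ge0 // mulr_ge0|lra].
  by rewrite mulrDl lerD2l mulrAC mulrC; apply: ler_wpM2l.
have : `|w t| <= `|w b| + `|w b - w t|.
  by rewrite -{1}(subKr (w b) (w t)); exact: ler_normB.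
rewrite exprS (mulrCA S) -/q; have : k / 2 = `|w b| + C * (b - a) by rewrite /k; lra.
by lra.
Qed.

Lemma lipschitz_right_lim w (a b M : R) : a < b ->
  (forall s t, a < s -> s <= t -> t <= b -> `|w t - w s| <= M * (t - s)) ->
  exists l, forall t, a < t -> t <= b -> `|w t - l| <= M * (t - a).
Proof.
move=> ab wM.
have [||l Hl] := @lipschitz_left_lim _ _ (fun r => w (- r)) (- b) (- a) M; first lra.
  move=> s t bs st ta; rewrite distrC /=.
  have := wM (- t) (- s) ltac:(lra) ltac:(lra) ltac:(lra).
  by rewrite opprK (addrC (- s)).
exists l => t a_t tb; have := Hl (- t) ltac:(lra) ltac:(lra).
by rewrite /= !opprK (addrC (- a)).
Qed.

End EndPoint.

(** * Continuity and derivatives as estimates in the real norm *)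

Section Transfer.
Context {R : realType} {c : bool}.
Local Notation K := (scal R c).

Lemma within_continuous_nrmP (E : normedModType K) (J : set R) (x : R -> E) :
  {within J, continuous x} <-> forall t, J t -> forall e : R, 0 < e ->
    exists2 d : R, 0 < d & forall s, J s -> `|s - t| < d -> nrm (x s - x t) <= e.
Proof.
split=> [/subspace_continuousP xc t Jt e e0|H].
  have nb : nbhs (x t) [set y | nrm (y - x t) < e] by apply/nbhs_nrmP; exists e.
  have /nbhs_ballP[d /= d0 Hd] := xc t Jt _ nb; exists d => // s Js st.
  by apply: ltW; apply: Hd => //; rewrite -ball_normE /= distrC.
apply/subspace_continuousP => t Jt S /nbhs_nrmP[e e0 He].
have [|d d0 Hd] := H t Jt (e / 2); first lra.
apply/nbhs_ballP; exists d => //= s; rewrite -ball_normE /= distrC => st Js.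
by apply: He; apply: le_lt_trans (Hd s Js st) _; lra.
Qed.

Lemma derivative_withinP (Y : completeNormedModType K) (J : set R) (g : R -> Y) (t : R) (l : Y) :
  derivative_within J g t l <-> deriv_on J (g : R -> rl Y) t (l : rl Y).
Proof.
have quot s : s != t ->
    nrm (ofR c (s - t)^-1 *: (g s - g t) - l) * `|s - t| =
    `|(g s : rl Y) - g t - (s - t) *: (l : rl Y)|.
  move=> st; have st0 : s - t != 0 by rewrite subr_eq0.
  rewrite mulrC -nrmZ scalerBr scalerA -ofRM divff // ofR1 scale1r.
  by [].
split=> [H e e0|H S /nbhs_nrmP[e e0 He]].
  have nb : nbhs l [set y | nrm (y - l) < e] by apply/nbhs_nrmP; exists e.
  have /nbhs_ballP[d /= d0 Hd] := H _ nb; exists d => // s Js st.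
  have [->|s_t] := eqVneq s t; first by rewrite !subrr scale0r subr0 !normr0 mulr0.
  rewrite -quot //; apply: ler_wpM2r => //; apply: ltW; apply: Hd => //.
  by rewrite -ball_normE /= distrC.
have [|d d0 Hd] := H (e / 2); first lra.
apply/nbhs_ballP; exists d => //= s; rewrite -ball_normE /= distrC => st [Js s_t].
apply: He; apply: le_lt_trans (_ : e / 2 < e); last lra.
by rewrite -(ler_pM2r (_ : 0 < `|s - t|)) ?normr_gt0 ?subr_eq0 // quot //; exact: Hd.
Qed.

End Transfer.

(** * The reduced equation *)

Lemma rl_closed_prod (R : realType) (c : bool) (X Y : normedModType (scal R c))
    (S : set (X * Y)) : closed S -> closed (S : set (rl X * rl Y)).
Proof.
move=> cS p clp; apply: cS => N Np; apply: clp.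
by move: Np; rewrite /nbhs /= !rl_nbhsE.
Qed.

Lemma deriv_on_bdd {R : realType} {c : bool} {E F : completeNormedModType (scal R c)}
    (T : E -> F) (J : set R) (u : R -> rl E) (t : R) (l : rl E) :
  bdd T -> deriv_on J u t l -> deriv_on J (fun s => T (u s) : rl F) t (T l : rl F).
Proof.
move=> bT H e e0; have [_ [M M0 HM]] := bT.
have M1 : 0 < M + 1 by lra.
have [d d0 Hd] := H (e / (M + 1)) (divr_gt0 e0 M1); exists d => // s Js st.
have -> : (T (u s) : rl F) - T (u t) - (s - t) *: (T l : rl F) =
    T (u s - u t - (s - t) *: l : rl E).
  by rewrite !(bddB _ _ bT) [in RHS](bddZ (ofR c (s - t)) l bT).
rewrite rl_normE; apply: le_trans (HM _) _.
apply: le_trans (ler_wpM2l M0 (Hd s Js st)) _.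
rewrite mulrA; apply: ler_wpM2r => //.
by rewrite mulrCA ler_piMr ?ler_pdivrMr ?mul1r //; lra.
Qed.

Section ReducedEquation.
Context {R : realType} {c : bool} {X Y : completeNormedModType (scal R c)}.
Context {A B : linop X Y} {n nu : nat} (rs : root_system A B n nu).
Hypotheses (A_closed : closed_op A) (B_closed : closed_op B)
  (A_sub_B : dom A `<=` dom B) (AB_regular : regular_pencil A B nu).
Local Notation K := (scal R c).
Local Notation D := (Dset A B).
Local Notation Ainv := (Atilde_inv rs).

Lemma Dset_dom : D = dom A.
Proof. by apply/seteqP; split=> [x []//|x Ax]; split=> //; exact: A_sub_B. Qed.

Let A_closed' : closed [set p : rl X * rl Y | D p.1 /\ p.2 = A p.1].
Proof. by rewrite Dset_dom; exact: rl_closed_prod A_closed. Qed.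

Let B_closed' : closed [set p : rl X * rl Y | dom B p.1 /\ p.2 = B p.1].
Proof. exact: rl_closed_prod B_closed. Qed.

Lemma B_relatively_bounded : exists2 b : R, 0 <= b &
  forall x, D x -> nrm (B x) <= b * (nrm (A x) + nrm x).
Proof.
have [nu0 [C [G [r [r0 GK GK' G_lin _]]]]] := real_pencil_exists AB_regular.
(* One regular value of the parameter is enough for the graph norm argument. *)
have r2 : 0 < r / 2 < r by apply/andP; split; lra.
apply: (@graph_bounded R (rl X) (rl Y) D (dom B) A B (r / 2) (G (r / 2))).
- by move=> x [].
- by move=> a u v Du Dv; exact: (linop_scaleD (@Dset_domA _ _ _ _ A B)).
- by move=> a u v Du Dv; exact: fn_linear.
- exact: A_closed'.
- exact: B_closed'.
- by move=> a u v; exact: G_lin.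
- by move=> y; have [] := GK _ y r2.
- by move=> y; have [] := GK _ y r2.
- by move=> x Dx; exact: GK'.
Qed.

Lemma Atilde_surj y : exists2 x, D x & Atilde rs x = y.
Proof.
have [nu0 [C [G [r [r0 GK GK' G_lin Gser]]]]] := real_pencil_exists AB_regular.
have [b b0 Hb] := B_relatively_bounded.
have coef := @laurent_coef R (rl X) (rl Y) D A B b (@Dset0 _ _ _ _ A B)
  (fun a u v Du Dv => Dset_scaleD (ofR c a) Du Dv)
  (fun a u v Du Dv => linop_scaleD (@Dset_domA _ _ _ _ A B) (ofR c a) Du Dv)
  (fun a u v Du Dv => linop_scaleD (@Dset_domB _ _ _ _ A B) (ofR c a) Du Dv)
  A_closed' b0 Hb C G r nu r0 (fun mu y m => (GK mu y m).1) (fun mu y m => (GK mu y m).2) Gser y.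
apply: Atilde_surj_aux; exists (C nu y), (C nu.-1 y).
have [Dnu Anu] := coef nu (leqnn nu).
have root j : (j < nu)%N -> P2 rs (C j y) = C j y.
  elim: j => [|j IHj] jnu.
    have [D0 A0] := coef 0%N (ltnW jnu).
    move: A0; rewrite ltn_eqF //= subr0 => A0.
    by have := ker_P20 rs D0 A0 => <-; exact: P2_P20.
  have [Dj Aj] := coef j (ltnW (ltnW jnu)).
  have [DSj ASj] := coef j.+1 (ltnW jnu).
  apply: (root_chain (z := C j y)) => //; last exact: IHj (ltnW jnu).
  by move: ASj; rewrite ltn_eqF // sub0r.
have nuS : (nu.-1 < nu)%N by rewrite prednK.
split=> //.
- exact: (coef nu.-1 (ltnW nuS)).1.
- exact: root.
by rewrite Anu eqxx; case: (nu) nu0 => //= k _; rewrite subrK.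
Qed.

Lemma AinvP y : D (Ainv y) /\ Atilde rs (Ainv y) = y.
Proof.
have [x Dx xy] := Atilde_surj y.
have := @xgetPex _ 0 [set x | D x /\ Atilde rs x = y] (ex_intro _ x (conj Dx xy)).
by [].
Qed.

Lemma Ainv_D y : D (Ainv y). Proof. exact: (AinvP y).1. Qed.
Lemma AinvK y : Atilde rs (Ainv y) = y. Proof. exact: (AinvP y).2. Qed.

Lemma Ainv_scaleD (a : K) u v : Ainv (a *: u + v) = a *: Ainv u + Ainv v.
Proof.
apply: (Atilde_inj (rs := rs)); [exact: Ainv_D|by apply: Dset_scaleD; exact: Ainv_D|].
by rewrite Atilde_scaleD ?AinvK //; exact: Ainv_D.
Qed.

Let finite_part (x : X) : Y := \sum_(i < n) adjoint B (qf rs i 1) x *: B (phi rs i (mult rs i)).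

Let finite_part_bdd : bdd finite_part.
Proof.
by apply: bdd_bigsum => i _; apply: bdd_rank1; apply: beta_bdd; exact: range1.
Qed.

(** [Atilde] differs from the closed operator [A] by a bounded map of finite rank, so its inverse
    has a closed graph. *)
Lemma Ainv_bdd : bdd Ainv.
Proof.
split; first exact: Ainv_scaleD.
apply: (@closed_graph R (rl Y) (rl X) Ainv).
  by move=> a u v; exact: Ainv_scaleD.
move=> u y x uy xy.
have [F_lin [M M0 HM]] := finite_part_bdd.
have Fx : (finite_part (Ainv (u k)) : rl Y) @[k --> \oo] --> (finite_part x : rl Y).
  apply/cvgrPdist_le => e e0.
  have /cvgrPdist_le /(_ (e / (M + 1)) ltac:(rewrite divr_gt0 //; lra)) := xy.
  apply: filterS => k; rewrite ler_pdivlMr; last lra.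
  move=> h; rewrite rl_normE -(bddB _ _ finite_part_bdd).
  apply: le_trans (HM _) _; have := nrm_ge0 (x - Ainv (u k)).
  by move: h; rewrite rl_normE; nra.
have Ax : (A (Ainv (u k)) : rl Y) @[k --> \oo] --> (y - finite_part x : rl Y).
  rewrite (_ : (fun k => _) = (fun k => (u k : rl Y) - finite_part (Ainv (u k)))).
    exact: (cvgB uy Fx).
  by apply/funext => k; rewrite -{2}[u k]AinvK /Atilde /finite_part addrK.
have [Dx AxE] : [set p : rl X * rl Y | D p.1 /\ p.2 = A p.1] (x, y - finite_part x).
  apply: (closed_cvg (F := \oo) (u_ := fun k => (Ainv (u k) : rl X, A (Ainv (u k)) : rl Y)) _ A_closed').
    by apply: nearW => k; split; [exact: Ainv_D|].
  exact: (cvg_pair xy Ax).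
apply: (Atilde_inj (rs := rs)); [exact: Ainv_D|exact: Dx|].
by rewrite AinvK /Atilde -/(finite_part x) -[A x]/(A (x, y - finite_part x).1) -AxE subrK.
Qed.

(** [A Ainv] is the identity minus a bounded map, so the relative bound of [B] applies. This is
    where the unbounded [B] becomes harmless in the equation for [w]. *)
Lemma B_Ainv_bdd : bdd (fun y => B (Ainv y)).
Proof.
split.
  move=> a u v; rewrite Ainv_scaleD (linop_scaleD (@Dset_domB _ _ _ _ A B)) //; exact: Ainv_D.
have [b b0 Hb] := B_relatively_bounded.
have [_ [M M0 HM]] := Ainv_bdd.
have [_ [N N0 HN]] := finite_part_bdd.
exists (b * (1 + N * M + M)) => [|y]; first by rewrite mulr_ge0 // !addr_ge0 // mulr_ge0.
apply: le_trans (Hb _ (Ainv_D y)) _; rewrite -mulrA; apply: ler_wpM2l => //.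
have -> : A (Ainv y) = y - finite_part (Ainv y).
  by rewrite -{2}[y]AinvK /Atilde /finite_part addrK.
have := nrmB y (finite_part (Ainv y)); have := HN (Ainv y); have := HM y.
by move=> h1 h2 h3; have := ler_wpM2l N0 h1; nra.
Qed.

(** [W] is handled as the kernel of [Q2s]; this inclusion carries over the hypotheses on [V], which
    are stated on [Wsp]. *)
Lemma Q2s_Wsp w : Q2s rs w = 0 -> Wsp rs w.
Proof.
move=> Qw; exists (Q1 rs w); first by exists w.
by exists (Q2S rs w); [exists w|rewrite Q1_Q2S Qw subr0].
Qed.

Lemma P20_Ainv w : Q2s rs w = 0 -> P20 rs (Ainv w) = 0.
Proof.
move=> Qw; apply: big1 => k _.
by rewrite -(qm_Atilde rs) ?AinvK ?qm_eq0 ?scale0r //; exact: Ainv_D.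
Qed.

Lemma A_Ainv w : Q2s rs w = 0 -> A (Ainv w) = w.
Proof.
move=> Qw; rewrite -{2}[w]AinvK /Atilde big1 ?addr0 // => k _.
by rewrite -(qm_Atilde rs) ?AinvK ?qm_eq0 ?scale0r //; exact: Ainv_D.
Qed.

Lemma Ainv_A x : D x -> Ainv (A x) = x - P20 rs x.
Proof.
move=> Dx; apply: (Atilde_inj (rs := rs)); [exact: Ainv_D|by apply: DsetB => //; exact: P20_D|].
rewrite AinvK /Atilde (linopB (@Dset_domA _ _ _ _ A B) Dx (P20_D rs x)) A_P20 subr0.
rewrite big1 ?addr0 // => k _.
by rewrite (bddB _ _ (beta_bdd (range1 rs k))) beta1_P20 subrr scale0r.
Qed.

(** * Regularity of the algebraic component and of the reduced right-hand side *)

Variable f : R -> X -> Y.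
Local Notation domB := (@Dset_domB R c X Y A B).
Hypotheses
  (f_cont : {within [set p : R * X | 0 <= p.1 /\ D p.2], continuous (fun p => f p.1 p.2)})
  (f_lip : locally_lipschitz (A := A) (B := B) f).
Variables (Winv : R -> X -> Y -> X) (Wop : R -> X -> X -> Y).
Hypotheses (W_inv : invertible_family rs f Wop Winv)
  (CC : contraction_condition rs f Winv).
Variable eta : R -> Y -> X.
Hypotheses
  (eta_sol : forall (t : R) w, 0 <= t -> Q2s rs w = 0 ->
     D20 rs (eta t w) /\ L0 rs f t (Ainv w + eta t w))
  (eta_uniq : forall (t : R) w z, 0 <= t -> Q2s rs w = 0 -> D20 rs z ->
     residual rs f t (Ainv w + z) = 0 -> z = eta t w).

Lemma f_cont_eps (t' : R) x' (e : R) : 0 <= t' -> D x' -> 0 < e -> exists2 d : R, 0 < d &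
  forall (t : R) x, 0 <= t -> D x -> `|t - t'| < d -> nrm (x - x') < d ->
    nrm (f t x - f t' x') <= e.
Proof.
move=> t'0 Dx' e0.
have /subspace_continuousP /(_ (t', x') (conj t'0 Dx')) := f_cont.
have nb : nbhs (f t' x') [set y | nrm (y - f t' x') < e].
  by apply/nbhs_nrmP; exists e.
move=> /(_ _ nb) [[S1 S2] /= [n1 n2] sub].
have /nbhs_ballP[d1 /= d10 H1] := n1.
have [d2 d20 H2] := (nbhs_nrmP _ _).1 n2.
exists (Num.min d1 d2) => [|t x t0 Dx]; first by rewrite lt_min d10.
rewrite lt_min => /andP[td1 _]; rewrite lt_min => /andP[_ xd2].
apply: ltW; apply: (sub (t, x)) => //; split=> /=; last exact: H2.
by apply: H1; rewrite -ball_normE /= distrC.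
Qed.


Lemma state_D (t : R) w : 0 <= t -> Q2s rs w = 0 -> D (Ainv w + eta t w).
Proof. by move=> t0 Qw; have [_ []] := eta_sol t0 Qw. Qed.

Lemma state_P20 (t : R) w : 0 <= t -> Q2s rs w = 0 -> P20 rs (Ainv w + eta t w) = eta t w.
Proof.
move=> t0 Qw; have [De _] := eta_sol t0 Qw.
by rewrite (bddD _ _ (P20_bdd rs)) P20_Ainv // add0r; apply/D20P.
Qed.

Let residual_cont (t' : R) w' (e : R) : 0 <= t' -> Q2s rs w' = 0 -> 0 < e ->
  exists2 d : R, 0 < d & forall (t : R) w, 0 <= t -> Q2s rs w = 0 ->
    `|t - t'| < d -> nrm (w - w') < d -> nrm (residual rs f t (Ainv w + eta t' w')) <= e.
Proof.
move=> t'0 Qw' e0.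
have [_ [N N0 HN]] := Q2s_bdd rs.
have [_ [Ma Ma0 HMa]] := Ainv_bdd.
have [_ [Mb Mb0 HMb]] := B_Ainv_bdd.
have [De [_ Dx' R0]] := eta_sol t'0 Qw'.
have N1 : 0 < 2 * (N + 1) by lra.
have [d1 d10 H1] := f_cont_eps t'0 Dx' (divr_gt0 e0 N1).
have Ma1 : 0 < Ma + 1 by lra.
have Mb1 : 0 < Mb + 1 by lra.
pose d := Num.min (Num.min d1 (d1 / (Ma + 1))) (e / (2 * (N + 1)) / (Mb + 1)).
have d0 : 0 < d by rewrite !lt_min d10 !divr_gt0.
exists d => // t w t0 Qw; rewrite !lt_min => /andP[/andP[td1 _] _] /andP[/andP[_ wd1] wd2].
rewrite ltr_pdivlMr // in wd1; rewrite ltr_pdivlMr // in wd2.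
have Dv := Ainv_D w; have Dv' := Ainv_D w'.
have Dx : D (Ainv w + eta t' w') by apply: DsetD => //; exact: (D20_D (rs := rs)).
have dv : Ainv w + eta t' w' - (Ainv w' + eta t' w') = Ainv (w - w').
  by rewrite (bddB _ _ Ainv_bdd); module (scal R c).
have nw := nrm_ge0 (w - w').
have h1 := H1 t _ t0 Dx td1 ltac:(rewrite dv; apply: le_lt_trans (HMa _) _; lra).
have h2 : nrm (B (Ainv w + eta t' w') - B (Ainv w' + eta t' w')) <= e / (2 * (N + 1)).
  rewrite -(linopB domB Dx Dx') dv; apply: le_trans (HMb _) _; lra.
rewrite (_ : residual rs f t _ = residual rs f t (Ainv w + eta t' w') -
    residual rs f t' (Ainv w' + eta t' w')); last by rewrite [X in _ - X]R0 subr0.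
rewrite /residual -(bddB _ _ (Q2s_bdd rs)).
rewrite (_ : _ - _ - _ = (f t (Ainv w + eta t' w') - f t' (Ainv w' + eta t' w')) -
  (B (Ainv w + eta t' w') - B (Ainv w' + eta t' w'))); last by module (scal R c).
apply: le_trans (HN _) _; apply: le_trans (ler_wpM2l N0 (nrmB _ _)) _.
apply: le_trans (ler_wpM2l N0 (lerD h1 h2)) _.
rewrite (_ : _ + _ = e / (N + 1)); last by field; rewrite gt_eqF //; lra.
by rewrite mulrA ler_pdivrMr ?(mulrC N) ?ler_pM2l //; lra.
Qed.

Lemma D20_closed : closed (D20 rs : set (rl X)).
Proof.
have [P_lin [M M0 HM]] := P20_bdd rs.
have -> : D20 rs = [set z | P20 rs z = z].
  by apply/seteqP; split=> z /D20P.
move=> z clz /=; apply/eqP; rewrite -subr_eq0; apply/eqP; apply: nrm_eq0; apply/eqP.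
rewrite eq_le nrm_ge0 andbT; apply/ler_addgt0Pr => e e0; rewrite add0r.
have M1 : 0 < M + 1 by lra.
have [y [/= Py]] := clz _ (nbhsx_ballx (z : rl X) _ (divr_gt0 e0 M1)).
rewrite -ball_normE /= rl_normE ltr_pdivlMr // => zy.
rewrite (_ : P20 rs z - z = P20 rs (z - y) - (z - y)); last first.
  by rewrite (bddB _ _ (P20_bdd rs)) Py; module (scal R c).
apply: le_trans (nrmB _ _) _; apply: le_trans (lerD (HM _) (lexx _)) _; lra.
Qed.

(** The contraction has a fixed point within [e] of [eta t' w']. Its residual vanishes because
    [Winv] is injective, and the uniqueness in condition 1, which is global in [D20], identifies it
    with [eta t w]. *)
Lemma eta_cont (t' : R) w' (e : R) : 0 <= t' -> Q2s rs w' = 0 -> 0 < e ->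
  exists2 d : R, 0 < d & forall (t : R) w, 0 <= t -> Q2s rs w = 0 ->
    `|t - t'| < d -> nrm (w - w') < d -> nrm (eta t w - eta t' w') <= e.
Proof.
move=> t'0 Qw' e0.
have [De L'] := eta_sol t'0 Qw'.
have [d [k [d0 k0 k1 Hd]]] := CC L'.
have [[WD WD' WK WK'] bW] := W_inv L'.
have [M M0 HM] := Winv_bound bW.
rewrite (state_P20 t'0 Qw') in Hd.
have [_ [Ma Ma0 HMa]] := Ainv_bdd.
pose r := Num.min e (d / 2).
have r0 : 0 < r by rewrite lt_min e0 divr_gt0.
have [re rd] : r <= e /\ r < d.
  have : r <= e /\ r <= d / 2 by rewrite /r !ge_min !lexx orbT.
  by case; split=> //; lra.
have k1' : 0 < 1 - k by lra.
have M1 : 0 < M + 1 by lra.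
have Ma1 : 0 < Ma + 1 by lra.
(* Multiplied by the bound [M] of [Winv], this residual stays below the [(1 - k) * r] of
   [fixed_point_ball]. *)
have [d1 d10 H1] := residual_cont t'0 Qw' (divr_gt0 (mulr_gt0 k1' r0) M1).
pose d2 := Num.min (Num.min d1 d) (d / (Ma + 1)).
exists d2 => [|t w t0 Qw]; first by rewrite !lt_min d10 d0 divr_gt0.
rewrite !lt_min => /andP[/andP[td1 td] _] /andP[/andP[wd1 wd] wd2].
rewrite ltr_pdivlMr // in wd2.
pose v := Ainv w.
have Dv : D v := Ainv_D w.
have Pv : P20 rs v = 0 := P20_Ainv Qw.
have vv : nrm (v - (Ainv w' + eta t' w' - eta t' w')) < d.
  rewrite addrK -(bddB _ _ Ainv_bdd); apply: le_lt_trans (HMa _) _.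
  by have := nrm_ge0 (w - w'); lra.
pose Phi (z : rl X) : rl X := z - Winv t' (Ainv w' + eta t' w') (residual rs f t (v + z)).
have YF z := residual_Y2s rs f t z.
have [|y z Dy Dz yr zr||z [Dz zr Phiz]] :=
    @fixed_point_ball R (rl X) (D20 rs) (eta t' w') r k Phi D20_closed De (ltW r0) k0 k1.
- by move=> z Dz _; apply: D20B => //; exact: WD'.
- have -> : Phi y - Phi z = (y : X) - z - Winv t' (Ainv w' + eta t' w')
      (residual rs f t (v + y) - residual rs f t (v + z)).
    by rewrite (WinvB bW) // /Phi; module (scal R c).
  by apply: Hd => //; [exact: le_lt_trans yr rd|exact: le_lt_trans zr rd].
- rewrite rl_normE /Phi addrC addKr nrmN; apply: le_trans (HM _ (YF _)) _.
  apply: le_trans (ler_wpM2l M0 (H1 t w t0 Qw td1 wd1)) _.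
  rewrite mulrA ler_pdivrMr // [leRHS]mulrC ler_pM2r ?mulr_gt0 //; lra.
suff zE : z = eta t w by rewrite -zE; exact: le_trans zr re.
apply: eta_uniq => //.
have W0 : Winv t' (Ainv w' + eta t' w') (residual rs f t (v + z)) = 0.
  move: Phiz => /eqP; rewrite /Phi -subr_eq0 addrAC subrr add0r oppr_eq0 => /eqP.
  by [].
have Y0 : Y2s rs 0 by apply/Y2sP; rewrite (bdd0 (Q2s_bdd rs)).
have Winv0 : Winv t' (Ainv w' + eta t' w') 0 = 0.
  by have := WinvB bW Y0 Y0; rewrite !subrr.
by rewrite -[LHS](WK' _ (YF _)) W0 -Winv0 WK'.
Qed.

(** The contraction estimate compares [eta t w1] and [eta t w2] over the same [Ainv w1]. There the
    first has residual [0], and the second has a residual of order [w1 - w2], since it vanishes over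
    [Ainv w2]. *)
Lemma eta_lipschitz (t' : R) w' : 0 <= t' -> Q2s rs w' = 0 -> exists d L : R, [/\ 0 < d, 0 <= L &
  forall (t : R) w1 w2, 0 <= t -> Q2s rs w1 = 0 -> Q2s rs w2 = 0 -> `|t - t'| < d ->
    nrm (w1 - w') < d -> nrm (w2 - w') < d ->
    nrm (eta t w1 - eta t w2) <= L * nrm (w1 - w2) /\
    nrm (f t (Ainv w1 + eta t w1) - f t (Ainv w2 + eta t w2)) <= L * nrm (w1 - w2)].
Proof.
move=> t'0 Qw'.
have [De L'] := eta_sol t'0 Qw'.
have Dx' := state_D t'0 Qw'.
have [d [k [d0 k0 k1 Hd]]] := CC L'.
have [_ bW] := W_inv L'.
have [M M0 HM] := Winv_bound bW.
have [_ [N N0 HN]] := Q2s_bdd rs.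
rewrite (state_P20 t'0 Qw') in Hd.
have [_ [Ma Ma0 HMa]] := Ainv_bdd.
have [_ [Mb Mb0 HMb]] := B_Ainv_bdd.
have [d1 [Lf [d10 Lf0 Hf]]] := f_lip t'0 Dx'.
pose r := Num.min d d1 / 2.
have r0 : 0 < r by rewrite divr_gt0 // lt_min d0.
have [rd rd1] : r < d /\ 2 * r <= d1.
  have [] : Num.min d d1 <= d /\ Num.min d d1 <= d1 by rewrite !ge_min !lexx orbT.
  by rewrite /r; split; lra.
have r2d : r / 2 < d by lra.
have rr : r / 2 + r / 2 < d1 by lra.
have td1 x : x < r -> x < d1 by lra.
have [d2 d20 H2] := eta_cont t'0 Qw' (divr_gt0 r0 (ltr0n R 2)).
have Ma1 : 0 < Ma + 1 by lra.
pose d3 := Num.min (Num.min d2 r) (r / 2 / (Ma + 1)).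
have d30 : 0 < d3 by rewrite !lt_min d20 r0 /= divr_gt0 // divr_gt0.
(* A Lipschitz constant of the residual in [w] at fixed [x_20]; solving the contraction inequality
   for the distance gives [L1] below. *)
pose C := N * (Lf * Ma + Mb).
have C0 : 0 <= C by apply: mulr_ge0 => //; apply: addr_ge0 => //; exact: mulr_ge0.
have k1' : 0 < 1 - k by lra.
pose L1 := M * C / (1 - k).
have L10 : 0 <= L1 by apply: divr_ge0 (ltW k1'); exact: mulr_ge0.
have near (w : Y) : nrm (w - w') < d3 -> nrm (Ainv w - Ainv w') <= r / 2.
  rewrite !lt_min => /andP[_]; rewrite ltr_pdivlMr // => wd.
  rewrite -(bddB _ _ Ainv_bdd); apply: le_trans (HMa _) _.
  have := nrm_ge0 (w - w'); lra.
exists d3, (L1 + Lf * (Ma + L1)); split=> //.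
  by rewrite addr_ge0 // mulr_ge0 // addr_ge0.
move=> t w1 w2 t0 Qw1 Qw2 td w1d w2d.
have [De1 [_ Dx1 R1]] := eta_sol t0 Qw1; have [De2 [_ Dx2 R2]] := eta_sol t0 Qw2.
have n1 := near _ w1d; have n2 := near _ w2d.
move: (td) (w1d) (w2d); rewrite !lt_min => /andP[/andP[td2 tr] _] /andP[/andP[w1d2 _] _] /andP[/andP[w2d2 _] _].
have e1 := H2 t w1 t0 Qw1 td2 w1d2; have e2 := H2 t w2 t0 Qw2 td2 w2d2.
have Dv1 := Ainv_D w1; have Dv2 := Ainv_D w2.
pose x12 := Ainv w1 + eta t w2.
have Dx12 : D x12 by apply: DsetD => //; exact: (D20_D (rs := rs)).
have close (w : Y) (z : X) : nrm (Ainv w - Ainv w') <= r / 2 -> nrm (z - eta t' w') <= r / 2 ->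
    nrm (Ainv w + z - (Ainv w' + eta t' w')) < d1.
  move=> h1 h2; rewrite (_ : _ - _ = (Ainv w - Ainv w') + (z - eta t' w')); last by module (scal R c).
  by apply: le_lt_trans (nrmD _ _) _; exact: le_lt_trans (lerD h1 h2) rr.
have lipf x y : D x -> D y -> nrm (x - (Ainv w' + eta t' w')) < d1 ->
    nrm (y - (Ainv w' + eta t' w')) < d1 -> nrm (f t x - f t y) <= Lf * nrm (x - y).
  by move=> Dx Dy xd yd; apply: Hf => //; exact: td1.
have dw := nrm_ge0 (w1 - w2).
have eL : nrm (eta t w1 - eta t w2) <= L1 * nrm (w1 - w2).
  have := Hd t (Ainv w1) (eta t w1) (eta t w2) t0 Dv1 (P20_Ainv Qw1) De1 De2
    (lt_trans tr rd) ltac:(rewrite addrK; exact: le_lt_trans n1 r2d)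
    (le_lt_trans e1 r2d) (le_lt_trans e2 r2d).
  set W := Winv _ _ _ => h1.
  have h2 : nrm W <= M * (C * nrm (w1 - w2)).
    apply: le_trans (HM _ (Y2sB (residual_Y2s _ _ _ _) (residual_Y2s _ _ _ _))) _.
    apply: ler_wpM2l => //.
    rewrite [X in nrm (X - _)](_ : _ = 0) //.
    rewrite -{1}R2 -/(residual rs f t (Ainv w2 + eta t w2)) /residual -(bddB _ _ (Q2s_bdd rs)).
    apply: le_trans (HN _) _; rewrite /C -mulrA; apply: ler_wpM2l => //.
    rewrite -/x12 (_ : _ - _ - _ = (f t (Ainv w2 + eta t w2) - f t x12)
      - (B (Ainv w2 + eta t w2) - B x12)); last by module (scal R c).
    rewrite -(linopB domB Dx2 Dx12) mulrDl.
    have xE : Ainv w2 + eta t w2 - x12 = Ainv (w2 - w1).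
      by rewrite (bddB _ _ Ainv_bdd) /x12; module (scal R c).
    apply: le_trans (nrmB _ _) (lerD _ _); last first.
      by rewrite xE (nrm_distC w1); exact: HMb.
    apply: le_trans (lipf _ _ Dx2 Dx12 (close _ _ n2 e2) (close _ _ n1 e2)) _.
    by rewrite xE -mulrA; apply: ler_wpM2l => //; rewrite (nrm_distC w1); exact: HMa.
  have h3 : nrm (eta t w1 - eta t w2) <= k * nrm (eta t w1 - eta t w2) + M * (C * nrm (w1 - w2)).
    rewrite -[X in nrm X <= _](subrK W); apply: le_trans (nrmD _ _) (lerD h1 h2).
  rewrite /L1 mulrAC ler_pdivlMr //; lra.
split; first by have := mulr_ge0 Lf0 (addr_ge0 Ma0 L10); nra.
apply: le_trans (lipf _ _ Dx1 Dx2 (close _ _ n1 e1) (close _ _ n2 e2)) _.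
rewrite (_ : _ - _ = Ainv (w1 - w2) + (eta t w1 - eta t w2)); last first.
  by rewrite (bddB _ _ Ainv_bdd); module (scal R c).
have h := le_trans (nrmD (Ainv (w1 - w2)) (eta t w1 - eta t w2)) (lerD (HMa _) eL).
apply: le_trans (ler_wpM2l Lf0 h) _.
have := mulr_ge0 L10 dw; lra.
Qed.

Definition rhs (t : R) (w : Y) : Y := f t (Ainv w + eta t w) - B (Ainv w + eta t w).

Lemma Q2s_rhs (t : R) w : 0 <= t -> Q2s rs w = 0 -> Q2s rs (rhs t w) = 0.
Proof. by move=> t0 Qw; have [_ []] := eta_sol t0 Qw. Qed.

(** [P20] is inserted so that both terms are bounded maps, of [w] and of [eta t w]. *)
Lemma B_state (t : R) w : 0 <= t -> Q2s rs w = 0 ->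
  B (Ainv w + eta t w) = B (Ainv w) + B (P20 rs (eta t w)).
Proof.
move=> t0 Qw; have [De _] := eta_sol t0 Qw.
rewrite (linopD domB (Ainv_D w)); last exact: (D20_D (rs := rs)).
by have /D20P -> := De.
Qed.

Lemma rhs_cont (t' : R) w' (e : R) : 0 <= t' -> Q2s rs w' = 0 -> 0 < e ->
  exists2 d : R, 0 < d & forall (t : R) w, 0 <= t -> Q2s rs w = 0 ->
    `|t - t'| < d -> nrm (w - w') < d -> nrm (rhs t w - rhs t' w') <= e.
Proof.
move=> t'0 Qw' e0.
have [_ [Ma Ma0 HMa]] := Ainv_bdd.
have [_ [Mb Mb0 HMb]] := B_Ainv_bdd.
have [_ [Mp Mp0 HMp]] := BP20_bdd rs.
have e2 : 0 < e / 2 by lra.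
have [d1 d10 H1] := f_cont_eps t'0 (state_D t'0 Qw') e2.
have M1 : 0 < Ma + Mb + Mp + 1 by lra.
pose h := Num.min (d1 / 2) (e / 4 / (Ma + Mb + Mp + 1)).
have h0 : 0 < h by rewrite lt_min !divr_gt0.
have [hd he] : h <= d1 / 2 /\ (Ma + Mb + Mp + 1) * h <= e / 4.
  by rewrite (mulrC _ h) -ler_pdivlMr // /h; split; rewrite ge_min lexx ?orbT.
clearbody h.
have [d2 d20 H2] := eta_cont t'0 Qw' h0.
pose d3 := d1 / 2 / (Ma + 1).
have Ma1 : 0 < Ma + 1 by lra.
have d30 : 0 < d3 by rewrite !divr_gt0.
exists (Num.min (Num.min d1 d2) (Num.min h d3)) => [|t w t0 Qw].
  by rewrite !lt_min d10 d20 h0.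
rewrite !lt_min => /andP[/andP[td1 td2] _] /andP[/andP[_ wd2] /andP[wh]].
rewrite ltr_pdivlMr // => wd3.
have eh := H2 t w t0 Qw td2 wd2.
have nw := nrm_ge0 (w - w').
have [De' _] := eta_sol t'0 Qw'; have [De _] := eta_sol t0 Qw.
have xx : nrm (Ainv w + eta t w - (Ainv w' + eta t' w')) < d1.
  rewrite (_ : _ - _ = Ainv (w - w') + (eta t w - eta t' w')); last first.
    by rewrite (bddB _ _ Ainv_bdd); module (scal R c).
  apply: le_lt_trans (nrmD _ _) _; apply: le_lt_trans (lerD (HMa _) eh) _; lra.
have hf := H1 t _ t0 (state_D t0 Qw) td1 xx.
have hB : nrm (B (Ainv w + eta t w) - B (Ainv w' + eta t' w')) <= e / 2.
  rewrite !B_state // (_ : _ - _ = B (Ainv (w - w')) + B (P20 rs (eta t w - eta t' w'))).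
    apply: le_trans (nrmD _ _) _; apply: le_trans (lerD (HMb _) (HMp _)) _.
    have := ler_wpM2l Mb0 (ltW wh); have := ler_wpM2l Mp0 eh.
    have := mulr_ge0 Ma0 (ltW h0); lra.
  rewrite [X in _ = X + _](bddB _ _ B_Ainv_bdd) [X in _ = _ + X](bddB _ _ (BP20_bdd rs)).
  by module (scal R c).
rewrite /rhs (_ : _ - _ - _ = (f t (Ainv w + eta t w) - f t' (Ainv w' + eta t' w')) -
  (B (Ainv w + eta t w) - B (Ainv w' + eta t' w'))); last by module (scal R c).
by apply: le_trans (nrmB _ _) _; lra.
Qed.

Lemma rhs_lipschitz (t' : R) w' : 0 <= t' -> Q2s rs w' = 0 -> exists d L : R, [/\ 0 < d, 0 <= L &
  forall (t : R) w1 w2, 0 <= t -> Q2s rs w1 = 0 -> Q2s rs w2 = 0 -> `|t - t'| < d ->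
    nrm (w1 - w') < d -> nrm (w2 - w') < d ->
    nrm (rhs t w1 - rhs t w2) <= L * nrm (w1 - w2)].
Proof.
move=> t'0 Qw'.
have [_ [Mb Mb0 HMb]] := B_Ainv_bdd.
have [_ [Mp Mp0 HMp]] := BP20_bdd rs.
have [d [L [d0 L0 H]]] := eta_lipschitz t'0 Qw'.
exists d, (L + (Mb + Mp * L)); split=> //; first by rewrite !addr_ge0 // mulr_ge0.
move=> t w1 w2 t0 Q1 Q2 td d1 d2; have [he hf] := H t w1 w2 t0 Q1 Q2 td d1 d2.
rewrite /rhs (_ : _ - _ - _ = (f t (Ainv w1 + eta t w1) - f t (Ainv w2 + eta t w2)) -
  (B (Ainv w1 + eta t w1) - B (Ainv w2 + eta t w2))); last by module (scal R c).
rewrite mulrDl; apply: le_trans (nrmB _ _) (lerD hf _).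
rewrite !B_state // (_ : _ - _ = B (Ainv (w1 - w2)) + B (P20 rs (eta t w1 - eta t w2))).
  rewrite mulrDl -mulrA; apply: le_trans (nrmD _ _) (lerD (HMb _) _).
  by apply: le_trans (HMp _) _; exact: ler_wpM2l.
rewrite [X in _ = X + _](bddB _ _ B_Ainv_bdd) [X in _ = _ + X](bddB _ _ (BP20_bdd rs)).
by module (scal R c).
Qed.

(* Extends [rhs] from the closed set [0 <= t], [w \in ker Q2s] to the whole space. *)
Definition rhs_ext (t : R) (w : rl Y) : rl Y := rhs (Num.max t 0) ((w : Y) - Q2s rs w).

Lemma rhs_extE (t : R) w : 0 <= t -> Q2s rs w = 0 -> rhs_ext t w = rhs t w.
Proof. by move=> t0 Qw; rewrite /rhs_ext Qw subr0 max_l. Qed.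

Lemma Q2s_proj w : Q2s rs (w - Q2s rs w) = 0.
Proof. by rewrite (bddB _ _ (Q2s_bdd rs)) Q2s_Q2s subrr. Qed.

Lemma Q2s_rhs_ext (t : R) w : Q2s rs (rhs_ext t w) = 0.
Proof. by apply: Q2s_rhs; [rewrite le_max lexx orbT|exact: Q2s_proj]. Qed.

Let proj_lip : exists2 N : R, 0 < N &
  forall u v, nrm (u - Q2s rs u - (v - Q2s rs v)) <= N * nrm (u - v).
Proof.
have [_ [N N0 HN]] := Q2s_bdd rs.
exists (1 + N) => [|u v]; first by rewrite ltr_pwDl.
rewrite (_ : _ - _ = (u - v) - Q2s rs (u - v)); last first.
  by rewrite (bddB _ _ (Q2s_bdd rs)); module (scal R c).
by rewrite mulrDl mul1r; apply: le_trans (nrmB _ _) _; rewrite lerD2l.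
Qed.

Lemma rhs_ext_jcont : jcont rhs_ext.
Proof.
move=> t w e e0; have [N N0 HN] := proj_lip.
have m0 s : 0 <= Num.max s 0 :> R by rewrite le_max lexx orbT.
have [d d0 H] := rhs_cont (m0 t) (Q2s_proj w) e0.
exists (Num.min d (d / N)) => [|s v]; first by rewrite lt_min d0 divr_gt0.
rewrite !lt_min => /andP[sd _] /andP[_]; rewrite ltr_pdivlMr // => vd.
apply: H => //; [exact: Q2s_proj|exact: le_lt_trans (clamp_le _ _) sd|].
by apply: le_lt_trans (HN _ _) _; rewrite mulrC.
Qed.

Lemma rhs_ext_lipschitz : loc_lipschitz rhs_ext.
Proof.
move=> t w; have [N N0 HN] := proj_lip.
have m0 s : 0 <= Num.max s 0 :> R by rewrite le_max lexx orbT.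
have [d [L [d0 L0 H]]] := rhs_lipschitz (m0 t) (Q2s_proj w).
exists (Num.min d (d / N)), (L * N); split; first by rewrite lt_min d0 divr_gt0.
  by rewrite mulr_ge0 // ltW.
move=> s u v; rewrite !lt_min => /andP[sd _] /andP[_]; rewrite ltr_pdivlMr // => ud.
move=> /andP[_]; rewrite ltr_pdivlMr // => vd.
have pd (x : Y) : nrm (x - w) * N < d -> nrm (x - Q2s rs x - (w - Q2s rs w)) < d.
  by move=> xd; apply: le_lt_trans (HN _ _) _; rewrite mulrC.
have := H _ _ _ (m0 s) (Q2s_proj u) (Q2s_proj v) (le_lt_trans (clamp_le _ _) sd) (pd _ ud) (pd _ vd).
by move=> h; apply: le_trans h _; rewrite -mulrA; exact: ler_wpM2l.
Qed.

Local Notation G := (rhs_ext).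

Lemma F2s_residual t x : D x -> F2s rs f t (P1 rs x) (P2S rs x) (P20 rs x) = residual rs f t x.
Proof.
by move=> Dx; rewrite /F2s Q2s_B_P2S_P20 // P1_P2S subrK /residual (bddB _ _ (Q2s_bdd rs)).
Qed.

(** [Q2s] kills the right-hand side, so [Q2s (u t)] has zero derivative. Hence solutions of the
    extended equation that start in [W] stay there. *)
Lemma sol_ker (a b : R) (u : R -> rl Y) : sol G [set t | a <= t <= b] u ->
  Q2s rs (u a) = 0 -> forall t, a <= t <= b -> Q2s rs (u t) = 0.
Proof.
move=> su ua t /andP[a_t tb].
have := @deriv_on_le _ (rl Y) (fun s => Q2s rs (u s)) a t 0 a_t.
rewrite ua mul0r subr0 => H; apply: nrm_eq0; apply/eqP; rewrite eq_le nrm_ge0 andbT.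
apply: H => s /andP[a_s st]; exists (Q2s rs (G s (u s))).
  apply: deriv_on_bdd (Q2s_bdd rs) _.
  by apply: deriv_onW (su s _) => [p|] /=; lra.
by rewrite Q2s_rhs_ext // normr0.
Qed.

Hypothesis cond3 : forall a1 a2 : R, 0 < a1 -> 0 < a2 ->
  exists K : R,
  [/\ 0 < K,
      forall t x, L0 rs f t x -> t <= a1 ->
        normD rs (P1 rs x + P2S rs x) <= a2 ->
        nrm (P20 rs x
             - Winv t x (F2s rs f t (P1 rs x) (P2S rs x) (P20 rs x))) <= K
    & exists M : R, forall t x, L0 rs f t x -> t <= a1 ->
        normD rs (P1 rs x + P2S rs x) <= a2 -> nrm (P20 rs x) <= K ->
        nrm (Q1 rs (f t x) + Q2S rs (f t x)) <= M].

(** On [L0] the function [F2s] vanishes, so the first supremum of condition 3 simply bounds [x_20];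
    then the second bounds [(Q1 + Q2S) f], and [B x] is bounded through [w] and [x_20]. *)
Lemma rhs_bounded (T r : R) : exists M : R, forall (t : R) w,
  0 <= t <= T -> Q2s rs w = 0 -> nrm w <= r -> nrm (rhs t w) <= M.
Proof.
have [_ [Ma Ma0 HMa]] := Ainv_bdd.
have [_ [Mb Mb0 HMb]] := B_Ainv_bdd.
have [_ [Mp Mp0 HMp]] := BP20_bdd rs.
have [_ [N N0 HN]] := Q2s_bdd rs.
have [_ [p1 p10 Hp1]] := P1_bdd rs.
have [_ [p2 p20 Hp2]] := P2S_bdd rs.
have r0 : 0 <= `|r| by [].
(* Condition 3 asks for positive [a1] and [a2], hence the [+ 1] in both. *)
have a10 : 0 < `|T| + 1 by rewrite ltr_pwDr.
have a20 : 0 < (p1 + p2) * (Ma * `|r|) + 1.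
  by rewrite ltr_pwDr // mulr_ge0 ?mulr_ge0 ?addr_ge0.
have [k [k0 Hk [M HM]]] := cond3 a10 a20.
exists (M + (1 + N) * (Mb * `|r| + Mp * k)) => t w /andP[t0 tT] Qw wr.
have [De L] := eta_sol t0 Qw; have [_ Dx Rx] := L.
set x := Ainv w + eta t w.
have wr' : nrm w <= `|r| by apply: le_trans wr (ler_norm _).
have Px : P20 rs x = eta t w by exact: (state_P20).
have PAw := P20_Ainv Qw.
have nD : normD rs (P1 rs x + P2S rs x) <= (p1 + p2) * (Ma * `|r|) + 1.
  rewrite P1_P2S Px addrK /normD PAw nrm0 addr0.
  have h := le_trans (HMa w) (ler_wpM2l Ma0 wr').
  have := le_trans (Hp1 (Ainv w)) (ler_wpM2l p10 h).
  have := le_trans (Hp2 (Ainv w)) (ler_wpM2l p20 h); lra.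
have ta : t <= `|T| + 1 by have := ler_norm T; lra.
have ek : nrm (P20 rs x) <= k.
  have := Hk t x L ta nD; rewrite F2s_residual // (L0_residual L).
  have Y0 : Y2s rs 0 by apply/Y2sP; rewrite (bdd0 (Q2s_bdd rs)).
  have := WinvB (W_inv L).2 Y0 Y0; rewrite !subrr => ->.
  by rewrite subr0.
have fM := HM t x L ta nD ek.
rewrite (_ : rhs t w = (Q1 rs (f t x) + Q2S rs (f t x)) - (B x - Q2s rs (B x))); last first.
  move: Rx; rewrite Q1_Q2S (bddB _ _ (Q2s_bdd rs)) => /eqP; rewrite subr_eq0 => /eqP ->.
  by rewrite /rhs -/x; module (scal R c).
apply: le_trans (nrmB _ _) (lerD fM _).
have hB : nrm (B x) <= Mb * `|r| + Mp * k.
  rewrite (B_state) // -Px P20_P20; apply: le_trans (nrmD _ _) (lerD _ _).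
    by apply: le_trans (HMb w) _; exact: ler_wpM2l.
  by have := HMp (P20 rs x); rewrite P20_P20 => /le_trans; apply; exact: ler_wpM2l.
apply: le_trans (nrmB _ _) _; rewrite mulrDl mul1r; apply: lerD => //.
by apply: le_trans (HN _) _; exact: ler_wpM2l.
Qed.

Variables (R0 : R) (m : nat) (V_ : 'I_m -> Y -> R) (dV : 'I_m -> Y -> Y -> R) (V : Y -> R).
Variables (U psi : R -> R).
Hypotheses (VE : forall w, Wsp rs w -> V w = \big[Num.max/0]_(i < m) V_ i w)
  (V_diff : forall i w, Wsp rs w -> R0 <= nrm w ->
     is_gradient (Wsp rs) (V_ i) w (dV i w))
  (U_cont : {within [set u : R | 0 <= u], continuous U})
  (U_ge0 : forall u : R, 0 <= u -> 0 <= U u)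
  (psi_ge0 : forall t : R, 0 <= t -> 0 <= psi t)
  (psi_int : integrable_on_finite_intervals psi)
  (U_div : tail_integral_inv_diverges U)
  (V_infty : forall M : R, exists r : R, forall w, Wsp rs w -> r <= nrm w -> M <= V w)
  (cond4 : forall (t : R) (w : Y) (x20 : X), Wsp rs w -> R0 <= nrm w -> D20 rs x20 ->
     L0 rs f t (Ainv w + x20) ->
     forall j, V w = V_ j w ->
     dV j w (Atilde rs (Pi_ rs f t (Ainv w + x20))) <= U (V w) * psi t).

Lemma Atilde_Pi t x : L0 rs f t x -> Atilde rs (Pi_ rs f t x) = f t x - B x.
Proof.
move=> L; rewrite /Pi_ (AinvK) Q1_Q2S.
by rewrite -/(residual rs f t x) (L0_residual L) subr0.
Qed.

Lemma reduced_global (t0 : R) w0 : 0 <= t0 -> Q2s rs w0 = 0 ->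
  exists u : R -> rl Y, [/\ u t0 = w0, forall b, sol G [set t | t0 <= t <= b] u
    & forall t, t0 <= t -> Q2s rs (u t) = 0].
Proof.
move=> t00 Qw0.
have SW := Q2s_Wsp.
have Gc := rhs_ext_jcont.
have GL := rhs_ext_lipschitz.
have [|u u0 su] := ode_global Gc GL (a := t0) (w := (w0 : rl Y)).
  move=> T u t0T u0 su.
  have Su t : t0 <= t < T -> Q2s rs (u t) = 0.
    move=> /andP[t0t tT]; apply: (sol_ker (su t tT)); rewrite ?u0 //.
    by rewrite t0t lexx.
  apply: (@lyapunov_bound R (rl Y) [set w | Q2s rs w = 0] _ _ R0 m V_ dV V
    _ _ _ _ U psi U_cont U_ge0 psi_ge0 psi_int U_div _ G _ _ _ t0 T u t00 t0T su Su).
  - by move=> x y /= Qx Qy; rewrite (bddB _ _ (Q2s_bdd rs)) Qx Qy subrr.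
  - by move=> a x /= Qx; rewrite (bddZ (ofR c a) x (Q2s_bdd rs)) Qx scaler0.
  - by move=> w /= /SW; exact: VE.
  - move=> i w /= /SW Sw wR a x y /SW Sx /SW Sy.
    by have [L _ _] := V_diff i Sw wR; exact: L.
  - move=> i w /= /SW Sw wR; have [_ [M HM] _] := V_diff i Sw wR.
    by exists M => h /SW; exact: HM.
  - move=> i w /= /SW Sw wR e e0; have [_ _ H] := V_diff i Sw wR.
    by have [d d0 Hd] := H e e0; exists d => // h /SW; exact: Hd.
  - by move=> M; have [r Hr] := V_infty M; exists r => w /SW; exact: Hr.
  - by move=> t w t0' /= Qw; exact: (Q2s_rhs_ext).
  - move=> t w t0' /= Qw wR j Vj; have [De L] := eta_sol t0' Qw.
    rewrite rhs_extE // /rhs -Atilde_Pi //.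
    exact: cond4 (SW _ Qw) wR De L j Vj.
  - move=> T' r; have [M HM] := rhs_bounded T' r; exists M => t w t0' Qw wr.
    by rewrite rhs_extE //; [exact: HM|move: t0' => /andP[]].
exists u; split=> // t t0t.
by apply: (sol_ker (su t)); rewrite ?u0 // t0t lexx.
Qed.

(** * Equivalence of the reduced and the original equation *)

Lemma state_eq (t : R) x : L0 rs f t x ->
  eta t (A x) = P20 rs x /\ Ainv (A x) + eta t (A x) = x.
Proof.
move=> [t0 Dx Rx].
have etaE : P20 rs x = eta t (A x).
  apply: eta_uniq => //; [exact: Q2s_A|by apply/D20P; exact: P20_P20|].
  by rewrite Ainv_A // subrK.
by split; rewrite -etaE // Ainv_A // subrK.
Qed.

Lemma G_state (t : R) x : L0 rs f t x -> G t (A x) = f t x - B x.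
Proof.
move=> L; have [t0 Dx _] := L.
by rewrite rhs_extE ?Q2s_A // /rhs (state_eq L).2.
Qed.

Lemma A_state (t : R) w : 0 <= t -> Q2s rs w = 0 -> A (Ainv w + eta t w) = w.
Proof.
move=> t0 Qw; have [De _] := eta_sol t0 Qw.
rewrite (linopD (@Dset_domA R c X Y A B)); last exact: (D20_D (rs := rs)).
  have /D20P <- := De.
  by rewrite A_P20 addr0; exact: (A_Ainv).
exact: (Ainv_D).
Qed.

Lemma reduced_to_solution (t0 : R) (u : R -> rl Y) : 0 <= t0 ->
  (forall b, sol G [set t | t0 <= t <= b] u) ->
  (forall t, t0 <= t -> Q2s rs (u t) = 0) ->
  is_solution A B f [set t | t0 <= t] (fun t => Ainv (u t) + eta t (u t)).
Proof.
move=> t00 su Qu.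
have [_ [Ma Ma0 HMa]] := Ainv_bdd.
have Gc := rhs_ext_jcont.
have du t : t0 <= t -> deriv_on [set s | t0 <= s] u t (G t (u t)).
  move=> t0t; apply: (@deriv_on_near _ _ [set s | t0 <= s <= t + 1] _ _ _ _ 1) => //.
    by move=> s /= t0s st; have := le_lt_trans (ler_norm _) st; lra.
  by apply: su; rewrite /= t0t; lra.
have uc t : t0 <= t -> cont_on [set s | t0 <= s] u t.
  by move=> t0t; exact: deriv_on_cont (du t t0t).
have sub : equation_times [set t | t0 <= t] `<=` [set t | t0 <= t] by move=> t [].
split.
- apply/within_continuous_nrmP => t /= t0t e e0.
  have t0' : 0 <= t by lra.
  have e2 : 0 < e / 2 by lra.
  have [d d0 Hd] := eta_cont t0' (Qu t t0t) e2.
  have Ma1 : 0 < Ma + 1 by lra.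
  pose h := Num.min (d / 2) (e / 2 / (Ma + 1)).
  have h0 : 0 < h by rewrite lt_min !divr_gt0.
  have [hd he] : h <= d / 2 /\ h * (Ma + 1) <= e / 2.
    by rewrite -ler_pdivlMr // /h; split; rewrite ge_min lexx ?orbT.
  clearbody h; have hd2 : h < d by lra.
  have [d1 d10 Hd1] := uc t t0t h h0.
  exists (Num.min d d1) => [|s t0s]; first by rewrite lt_min d0.
  rewrite lt_min => /andP[sd sd1]; have := Hd1 s t0s sd1; rewrite rl_normE => uh.
  rewrite (_ : _ - _ = Ainv (u s - u t) + (eta s (u s) - eta t (u t))); last first.
    by rewrite (bddB _ _ Ainv_bdd); module (scal R c).
  have he2 := Hd s (u s) (le_trans t00 t0s) (Qu s t0s) sd (le_lt_trans uh hd2).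
  apply: le_trans (nrmD _ _) _; apply: le_trans (lerD (HMa _) he2) _.
  by have := ler_wpM2l Ma0 uh; lra.
- by move=> t /= t0t; apply: (state_D); [lra|exact: Qu].
- have AE s : t0 <= s -> A (Ainv (u s) + eta s (u s)) = u s.
    by move=> t0s; apply: A_state; [lra|exact: Qu].
  exists (fun t => G t (u t)); split.
  + move=> t It; have t0t := sub t It; apply/derivative_withinP.
    apply: (@eq_deriv_on _ _ _ u) => // [s /sub t0s|]; first by rewrite AE.
    exact: deriv_onW sub (du t t0t).
  + apply/within_continuous_nrmP => t /sub t0t e e0.
    have [d d0 Hd] := jcont_comp Gc (uc t t0t) e0.
    by exists d => // s /sub t0s st; exact: Hd.
  + move=> t /sub t0t; rewrite rhs_extE; [|exact: le_trans t00 t0t|exact: Qu].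
    by rewrite subrK.
Qed.

(** [Q2s (A y)] is identically [0], so [Q2s] kills the derivative of [A y], which is [f - B y]. Thus
    the equation itself forces a solution to stay in [L0]. *)
Lemma solution_interior (J : set R) y (t0 t : R) : is_solution A B f J y ->
  0 <= t0 -> t0 < t -> (forall s, t0 < s <= t -> J s) ->
  L0 rs f t (y t) /\
  deriv_on (equation_times J) (fun s => A (y s) : rl Y) t (G t (A (y t))).
Proof.
move=> [_ yD [dAy [dA _ eqn]]] t00 t0t tJ.
have tI s : t0 < s <= t -> equation_times J s.
  by move=> /andP[t0s st]; split=> [|_]; [apply: tJ; rewrite t0s|lra].
have It : equation_times J t by apply: tI; rewrite t0t lexx.
have Dy : D (y t) by apply: yD; exact: It.1.
have /derivative_withinP dt := dA t It.
have dQ := deriv_on_bdd (Q2s_bdd rs) dt.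
have Q0 : Q2s rs (dAy t) = 0.
  apply: nrm_eq0; apply/eqP; rewrite eq_le nrm_ge0 andbT.
  apply/ler_addgt0Pr => e e0; rewrite add0r.
  have [d d0 Hd] := dQ e e0.
  (* A time before [t]: only []t0, t]] is known to lie in [J]. *)
  pose s := Num.max ((t0 + t) / 2) (t - d / 2).
  have [s1 s2 s3] : [/\ (t0 + t) / 2 <= s, t - d / 2 <= s & s < t].
    by rewrite /s gt_max !le_max !lexx orbT; split=> //; apply/andP; split; lra.
  clearbody s; have Is : equation_times J s by apply: tI; lra.
  have := Hd s Is ltac:(rewrite ltr0_norm; lra).
  rewrite Q2s_A ?Q2s_A //; last by apply: yD; exact: Is.1.
  rewrite subrr sub0r normrN normrZ mulrC ler_pM2r ?normr_gt0 //.
  by rewrite subr_eq0 lt_eqF.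
have dE : dAy t = f t (y t) - B (y t) by rewrite -(eqn t It) addrK.
have L : L0 rs f t (y t) by split; rewrite -?dE //; lra.
by split=> //; rewrite G_state // -dE.
Qed.

(** At [t0 = 0] the definition may say nothing about [A y], and [A] is unbounded, so even its
    continuity there needs proof. As [y] is continuous, [f] stays bounded near [t0] and [G] grows at
    most linearly in [w]. So [w] is bounded, then Lipschitz, and has a right limit at [t0], which
    continuity of [y] identifies with [A x0]. *)
Lemma solution_to_reduced (J : set R) y (t0 t1 : R) : is_solution A B f J y ->
  L0 rs f t0 (y t0) -> t0 < t1 -> (forall s, t0 <= s <= t1 -> J s) ->
  sol G [set t | t0 <= t <= t1] (fun s => A (y s) : rl Y).
Proof.
move=> yS L0x t01 J01; have [t00 Dx0 _] := L0x.
have [_ [Ma Ma0 HMa]] := Ainv_bdd.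
have [_ [Mb Mb0 HMb]] := B_Ainv_bdd.
have [_ [Mp Mp0 HMp]] := BP20_bdd rs.
have [_ [Mq Mq0 HMq]] := P20_bdd rs.
have Gc := rhs_ext_jcont.
pose w s : rl Y := A (y s); pose x0 := y t0.
have inner t : t0 < t <= t1 -> L0 rs f t (y t) /\
    deriv_on (equation_times J) w t (G t (w t)).
  move=> /andP[t0t tt1]; apply: (solution_interior yS t00 t0t) => s st; apply: J01; lra.
have sub : [set t | t0 < t <= t1] `<=` equation_times J.
  by move=> s /= st; split=> [|_]; [apply: J01|]; lra.
have sw : sol G [set t | t0 < t <= t1] w.
  by move=> t tt1; apply: deriv_onW sub (inner t tt1).2.
have [/within_continuous_nrmP yc _ _] := yS.
have Jt0 : J t0 by apply: J01; rewrite lexx ltW.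
have ycont (e : R) : 0 < e -> exists2 d : R, 0 < d &
    forall s, t0 <= s <= t1 -> `|s - t0| < d -> nrm (y s - x0) <= e.
  by move=> e0; have [d d0 Hd] := yc t0 Jt0 e e0; exists d => // s /J01; exact: Hd.
apply: sol_left_end => //.
have [df df0 Hf] := f_cont_eps t00 Dx0 ltr01.
have [dy dy0 Hy] := ycont (Num.min 1 (df / 2)) ltac:(rewrite lt_min; lra).
have Mb1 : 0 < Mb + 1 by lra.
(* Besides the two continuity radii, [Mb * h <= 1 / 2] is what [linear_growth_bounded] requires. *)
pose h := Num.min (Num.min (df / 2) (dy / 2)) (Num.min (2^-1 / (Mb + 1)) (t1 - t0)).
have h0 : 0 < h by rewrite !lt_min !divr_gt0 //=; lra.
have [h1 h2 h3 h4] : [/\ h <= df / 2, h <= dy / 2, h * (Mb + 1) <= 2^-1 & h <= t1 - t0].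
  by rewrite -ler_pdivlMr // /h !ge_min !lexx !orbT.
clearbody h; pose C := nrm (f t0 x0) + 1 + Mp * (nrm x0 + 1).
have C0 : 0 <= C.
  by have := nrm_ge0 (f t0 x0); have := mulr_ge0 Mp0 (addr_ge0 (nrm_ge0 x0) ler01);
    rewrite /C; lra.
have Gw t : t0 < t <= t0 + h -> `|G t (w t)| <= C + Mb * `|w t|.
  move=> th; have [L _] := inner t ltac:(lra); have [t0' Dy _] := L.
  have yx := Hy t ltac:(lra) ltac:(rewrite gtr0_norm; lra).
  rewrite le_min in yx; have /andP[yx1 yx2] := yx.
  have hf := Hf t (y t) t0' Dy ltac:(rewrite gtr0_norm; lra) ltac:(lra).
  rewrite /w G_state // !rl_normE.
  have fb : nrm (f t (y t)) <= nrm (f t0 x0) + 1.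
    by rewrite -[f t (y t)](subrK (f t0 x0)) addrC; apply: le_trans (nrmD _ _) _; rewrite lerD2l.
  have yb : nrm (y t) <= nrm x0 + 1.
    by rewrite -[y t](subrK x0) addrC; apply: le_trans (nrmD _ _) _; rewrite lerD2l.
  have Bb : nrm (B (y t)) <= Mb * nrm (A (y t)) + Mp * (nrm x0 + 1).
    have yE : y t = Ainv (A (y t)) + P20 rs (y t) by rewrite Ainv_A // subrK.
    rewrite {1}yE (linopD domB); last exact: P20_D.
      apply: le_trans (nrmD _ _) (lerD (HMb _) _).
      by apply: le_trans (HMp _) _; exact: ler_wpM2l.
    exact: (Ainv_D).
  by apply: le_trans (nrmB _ _) _; rewrite /C; lra.
have t0h : t0 < t0 + h by lra.
have dw t : t0 < t <= t0 + h -> deriv_on [set s | t0 < s <= t0 + h] w t (G t (w t)).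
  by move=> th; apply: deriv_onW (sw t _) => [s|] /=; lra.
have [|M HM] := @linear_growth_bounded _ _ w t0 (t0 + h) C Mb C0 Mb0 _
    (fun t th => ex_intro2 _ _ _ (dw t th) (Gw t th)).
  by have := mulr_ge0 Mb0 (ltW h0); lra.
pose L := C + Mb * M.
have wL s t : t0 < s -> s <= t -> t <= t0 + h -> `|w t - w s| <= L * (t - s).
  move=> t0s st th; apply: deriv_on_le => // r rst; exists (G r (w r)).
    by apply: deriv_onW (dw r _) => [q|] /=; lra.
  apply: le_trans (Gw r _) _; first lra.
  by rewrite lerD2l; apply: ler_wpM2l => //; apply: HM; lra.
have [l Hl] := lipschitz_right_lim t0h wL.
have L0 : 0 <= L.
  have := wL (t0 + h / 2) (t0 + h) ltac:(lra) ltac:(lra) ltac:(lra).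
  move=> /(le_trans (normr_ge0 _)); rewrite pmulr_lge0 //; lra.
(* [Ainv (w t) = y t - P20 (y t)] tends to [x0 - P20 x0 = Ainv (A x0)], and [Ainv] is injective. *)
have lE : l = A x0.
  apply/eqP; rewrite -subr_eq0; apply/eqP.
  suff Z : Ainv (l - A x0) = 0 by rewrite -[LHS]AinvK Z -(bdd0 Ainv_bdd) AinvK.
  apply: nrm_eq0; apply/eqP; rewrite eq_le nrm_ge0 andbT.
  apply/ler_addgt0Pr => e e0; rewrite add0r.
  have Mq1 : 0 < Mq + 1 by lra.
  have ML1 : 0 < Ma * L + 1 by have := mulr_ge0 Ma0 L0; lra.
  have [d d0 Hd] := ycont (e / 2 / (Mq + 1)) ltac:(by rewrite !divr_gt0).
  pose k := Num.min (Num.min (d / 2) h) (e / 2 / (Ma * L + 1)).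
  have k0 : 0 < k by rewrite !lt_min !divr_gt0 //= h0.
  have [k1 k2 k3] : [/\ k <= d / 2, k <= h & k * (Ma * L + 1) <= e / 2].
    by rewrite -ler_pdivlMr // /k !ge_min !lexx !orbT.
  clearbody k; pose t := t0 + k.
  have [Lt _] := inner t ltac:(rewrite /t; lra); have [_ Dy _] := Lt.
  have yx := Hd t ltac:(rewrite /t; lra) ltac:(rewrite /t gtr0_norm; lra).
  rewrite ler_pdivlMr // in yx.
  have lw := Hl t ltac:(rewrite /t; lra) ltac:(rewrite /t; lra).
  rewrite distrC rl_normE (_ : t - t0 = k) in lw; last by rewrite /t addrC addKr.
  rewrite (_ : Ainv (l - A x0) = Ainv (l - w t) + ((y t - x0) - P20 rs (y t - x0))); last first.
    rewrite !(bddB _ _ Ainv_bdd) (bddB _ _ (P20_bdd rs)) /w !Ainv_A //.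
    by module (scal R c).
  apply: le_trans (nrmD _ _) _.
  have h5 := le_trans (HMa _) (ler_wpM2l Ma0 lw).
  have h6 := le_trans (nrmB (y t - x0) _) (lerD (lexx _) (HMq (y t - x0))).
  by apply: le_trans (lerD h5 h6) _; lra.
move=> e e0; have L1 : 0 < L + 1 by lra.
exists (Num.min h (e / (L + 1))) => [|s /= st]; first by rewrite lt_min h0 divr_gt0.
rewrite lt_min => /andP[sh]; rewrite ltr_pdivlMr // => se.
have [->|s_t] := eqVneq s t0; first by rewrite subrr normr0 ltW.
have t0s : 0 < s - t0 by move: st => /andP[]; rewrite subr_gt0 lt_neqAle eq_sym s_t.
rewrite gtr0_norm // in sh se.
have := Hl s ltac:(lra) ltac:(lra); rewrite lE => Hs.
by apply: le_trans Hs _; lra.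
Qed.

End ReducedEquation.

Theorem theorem4p2
  (R : realType) (c : bool) (X Y : completeNormedModType (scal R c))
  (A B : linop X Y)
  (A_closed : closed_op A) (B_closed : closed_op B)
  (A_dense : dense (dom A)) (B_dense : dense (dom B))
  (A_range : closed (A @` dom A))
  (D_neq0 : exists2 x, Dset A B x & x != 0)
  (A_sub_B : dom A `<=` dom B)
  (n : nat)
  (kerA_dim : exists e : 'I_n -> X, is_basis [set x | dom A x /\ A x = 0] e)
  (nu : nat) (AB_regular : regular_pencil A B nu)
  (rs : root_system A B n nu)
  (f : R -> X -> Y)
  (f_cont : {within [set p : R * X | 0 <= p.1 /\ Dset A B p.2],
               continuous (fun p => f p.1 p.2)})
  (cond1 : forall (t : R) (x1 x2S : X), 0 <= t -> D1 rs x1 -> D2S rs x2S ->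
     exists! x20, D20 rs x20 /\ L0 rs f t (x1 + x2S + x20))
  (Wop : R -> X -> X -> Y) (Winv : R -> X -> Y -> X)
  (cond2 : condition_2A rs f Wop Winv \/ condition_2B rs f Wop Winv)
  (cond3 : forall a1 a2 : R, 0 < a1 -> 0 < a2 ->
     exists K : R,
     [/\ 0 < K,
         forall t x, L0 rs f t x -> t <= a1 ->
           normD rs (P1 rs x + P2S rs x) <= a2 ->
           nrm (P20 rs x
                - Winv t x (F2s rs f t (P1 rs x) (P2S rs x) (P20 rs x))) <= K
       & exists M : R, forall t x, L0 rs f t x -> t <= a1 ->
           normD rs (P1 rs x + P2S rs x) <= a2 -> nrm (P20 rs x) <= K ->
           nrm (Q1 rs (f t x) + Q2S rs (f t x)) <= M])
  (R0 : R) (R0_gt0 : 0 < R0)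
  (m : nat) (m_gt0 : (0 < m)%N)
  (V_ : 'I_m -> Y -> R) (dV : 'I_m -> Y -> Y -> R) (V : Y -> R)
  (VE : forall w, Wsp rs w -> V w = \big[Num.max/0]_(i < m) V_ i w)
  (V_cont : forall i, {within Wsp rs, continuous (V_ i)})
  (V_ge0 : forall i w, Wsp rs w -> 0 <= V_ i w)
  (V_diff : forall i w, Wsp rs w -> R0 <= nrm w ->
     is_gradient (Wsp rs) (V_ i) w (dV i w))
  (dV_cont : forall i w', Wsp rs w' -> R0 <= nrm w' ->
     forall e : R, 0 < e -> exists2 d : R, 0 < d &
     forall w, Wsp rs w -> R0 <= nrm w -> nrm (w - w') < d ->
     forall h, Wsp rs h -> `|dV i w h - dV i w' h| <= e * nrm h)
  (U psi : R -> R)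
  (U_cont : {within [set u : R | 0 <= u], continuous U})
  (U_ge0 : forall u : R, 0 <= u -> 0 <= U u)
  (psi_ge0 : forall t : R, 0 <= t -> 0 <= psi t)
  (psi_int : integrable_on_finite_intervals psi)
  (U_div : tail_integral_inv_diverges U)
  (V_infty : forall M : R, exists r : R, forall w, Wsp rs w -> r <= nrm w -> M <= V w)
  (cond4 : forall (t : R) (w : Y) (x20 : X), Wsp rs w -> R0 <= nrm w -> D20 rs x20 ->
     L0 rs f t (Atilde_inv rs w + x20) ->
     forall j, V w = V_ j w ->
     dV j w (Atilde rs (Pi_ rs f t (Atilde_inv rs w + x20))) <= U (V w) * psi t) :
  forall (t0 : R) (x0 : X), L0 rs f t0 x0 ->
  exists x : R -> X,
    [/\ is_solution A B f [set t | t0 <= t] x,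
        x t0 = x0
      & forall (T : \bar R) (y : R -> X), (t0%:E < T)%E ->
          is_solution A B f [set t | t0 <= t /\ (t%:E < T)%E] y -> y t0 = x0 ->
          forall t, t0 <= t -> (t%:E < T)%E -> y t = x t].
Proof.
move=> t0 x0 L00; have [t00 Dx0 Rx0] := L00.
(* From here on 2A and 2B are treated alike, through these three facts. *)
have [f_lip W_inv CC] : [/\ locally_lipschitz (A := A) (B := B) f,
    invertible_family rs f Wop Winv & contraction_condition rs f Winv].
  case: cond2 => C2; have [H1 H2 _] := C2; split=> //.
  - exact: condition_2A_contraction C2.
  - exact: continuous_partial_lipschitz.
  - exact: condition_2B_contraction C2.
pose Ainv := Atilde_inv rs.
have cond1' t w : 0 <= t -> Q2s rs w = 0 ->
    exists! x20, D20 rs x20 /\ L0 rs f t (Ainv w + x20).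
  move=> t_ge0 Qw; have Dv := Ainv_D rs A_closed B_closed A_sub_B AB_regular w.
  have Pv := P20_Ainv A_closed B_closed A_sub_B AB_regular Qw.
  have := cond1 t _ _ t_ge0 (imageP (P1 rs) Dv) (imageP (P2S rs) Dv).
  by rewrite P1_P2S Pv subr0.
have [e He] : {e : R * Y -> X & forall p : R * Y, 0 <= p.1 -> Q2s rs p.2 = 0 ->
    unique (fun x20 => D20 rs x20 /\ L0 rs f p.1 (Ainv p.2 + x20)) (e p)}.
  (* The choice is made over all pairs [(t, w)], with the dummy value [0] where condition 1 does not
     apply. *)
  apply: (@choice _ _ (fun p z => 0 <= p.1 -> Q2s rs p.2 = 0 ->
    unique (fun x20 => D20 rs x20 /\ L0 rs f p.1 (Ainv p.2 + x20)) z)) => -[t w] /=.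
  have [t_ge0|] := pselect (0 <= t); last by exists 0.
  have [Qw|] := pselect (Q2s rs w = 0); last by exists 0.
  by have [z Hz] := cond1' t w t_ge0 Qw; exists z.
pose eta t w := e (t, w).
have eta_sol (t : R) w : 0 <= t -> Q2s rs w = 0 ->
    D20 rs (eta t w) /\ L0 rs f t (Ainv w + eta t w).
  by move=> t_ge0 Qw; exact: (He (t, w) t_ge0 Qw).1.
have eta_uniq (t : R) w z : 0 <= t -> Q2s rs w = 0 -> D20 rs z ->
    residual rs f t (Ainv w + z) = 0 -> z = eta t w.
  move=> t_ge0 Qw Dz Rz; apply/esym; apply: (He (t, w) t_ge0 Qw).2; split=> //.
  split=> //; apply: DsetD; last exact: (D20_D (rs := rs)).
  exact: (Ainv_D rs A_closed B_closed A_sub_B AB_regular).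
have [u [u0 su Qu]] := reduced_global A_closed B_closed A_sub_B AB_regular f_cont f_lip
  W_inv CC eta_sol eta_uniq cond3 VE V_diff U_cont U_ge0 psi_ge0 psi_int U_div V_infty cond4
  t00 (Q2s_A rs Dx0).
have stE := state_eq A_closed B_closed A_sub_B AB_regular eta_uniq.
exists (fun t => Ainv (u t) + eta t (u t)); split.
- exact: (reduced_to_solution A_closed B_closed A_sub_B AB_regular f_cont W_inv CC
    eta_sol eta_uniq).
- by rewrite u0; exact: (stE _ _ L00).2.
- move=> T y t0T yS y0 t t0t tT.
  have [->|tt0] := eqVneq t t0; first by rewrite y0 u0; exact/esym/(stE _ _ L00).2.
  have {}t0t : t0 < t by rewrite lt_neqAle eq_sym tt0.
  have Jt s : t0 <= s <= t -> t0 <= s /\ (s%:E < T)%E.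
    by move=> /andP[t0s st]; split=> //; apply: le_lt_trans tT; rewrite lee_fin.
  have Ly0 : L0 rs f t0 (y t0) by rewrite y0.
  have sw := solution_to_reduced A_closed B_closed A_sub_B AB_regular f_cont W_inv CC
    eta_sol eta_uniq yS Ly0 t0t Jt.
  have GL := rhs_ext_lipschitz A_closed B_closed A_sub_B AB_regular f_cont f_lip W_inv CC
    eta_sol eta_uniq.
  have uA : A (y t) = u t.
    apply: (sol_unique GL (ltW t0t) sw (su t)); first by rewrite y0 u0.
    by rewrite lexx ltW.
  have [|Ly _] := solution_interior A_closed B_closed A_sub_B AB_regular eta_uniq
    yS t00 t0t _; first by move=> s /andP[t0s st]; apply: Jt; rewrite st ltW.
  by rewrite -uA; exact/esym/(stE _ _ Ly).2.
Qed.
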